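(* Suppose that $k$ is an algebraically closed field of characteristic $0$. (i) Suppose that $\mathcal B$ is a $\Lambda$-graded algebra, where $\Lambda$ is a free abelian group of rank $n\ge1$. Then $\mathcal B$ is graded-central-simple with $\Gamma(\mathcal B)$ of finite index in $\Lambda$ if and only if $\mathcal B$ is isograded-isomorphic to $M_{\mathbf m}(\mathcal A,\sigma_1,\dots,\sigma_n)$ for some central-simple (ungraded) algebra $\mathcal A$, some $n$-tuple of positive integers $\mathbf m=(m_1,\dots,m_n)$ and some sequence $\sigma_1,\dots,\sigma_n$ of commuting finite order algebra automorphisms of $\mathcal A$ such that $\sigma_i^{m_i}=1$ for all $i$. (ii) Let $\mathcal B=M_{\mathbf m}(\mathcal A,\sigma_1,\dots,\sigma_n)$ and $\mathcal B'=M_{\mathbf m'}(\mathcal A',\sigma'_1,\dots,\sigma'_n)$ (both $\mathbb Z^n$-graded), where $\mathcal A$ and $\mathcal A'$ are central-simple algebras, $\mathbf m=(m_1,\dots,m_n)$ and $\mathbf m'=(m'_1,\dots,m'_n)$ are $n$-tuples of positive integers, $\sigma_1,\dots,\sigma_n$ are commuting automorphisms of $\mathcal A$ with $\sigma_i^{m_i}=1$ for all $i$, and $\sigma'_1,\dots,\sigma'_n$ are commuting automorphisms of $\mathcal A'$ with $\sigma_i'^{\,m'_i}=1$ for all $i$. Then $\mathcal B\simeq_{\mathrm{ig}}\mathcal B'$ if and only if there exist a matrix $P=(p_{ij})\in\mathrm{GL}_n(\mathbb Z)$ and an algebra isomorphism $\varphi:\mathcal A\to\mathcal A'$ such that $P$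 is $(\mathbf m',\mathbf m)$-admissible and $$\sigma'_j=\varphi\Big(\prod_{i=1}^n\sigma_i^{p_{ij}}\Big)\varphi^{-1}\qquad(1\le j\le n).\qquad( * )$$ Moreover, if $\langle\mathrm{supp}_{\mathbb Z^n}(\mathcal B)\rangle=\mathbb Z^n$ and $\langle\mathrm{supp}_{\mathbb Z^n}(\mathcal B')\rangle=\mathbb Z^n$, then $\mathcal B\simeq_{\mathrm{ig}}\mathcal B'$ if and only if there exist $P=(p_{ij})\in\mathrm{GL}_n(\mathbb Z)$ and an algebra isomorphism $\varphi:\mathcal A\to\mathcal A'$ such that $( * )$ holds. (iii) Suppose $\mathcal B$ is a graded-central-simple $\Lambda$-graded algebra with $\Gamma(\mathcal B)$ of finite index in $\Lambda$, where $\Lambda$ is a free abelian group of rank $n\ge1$, and suppose $\mathcal B\simeq_{\mathrm{ig}}M_{\mathbf m}(\mathcal A,\sigma_1,\dots,\sigma_n)$, where $\mathcal A$ is a central-simple algebra, $\mathbf m$ is an $n$-tuple of positive integers and $\sigma_1,\dots,\sigma_n$ are commuting automorphisms of $\mathcal A$ with $\sigma_i^{m_i}=1$ for all $i$. Then $\mathcal A$ is finite dimensional if and only if $\mathcal B$ is fgc.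
   Context: All algebras are over $k$ and not necessarily associative or unital. For an abelian group $\Lambda$, a $\Lambda$-graded algebra is an algebra $\mathcal B=\bigoplus_{\lambda\in\Lambda}\mathcal B^\lambda$ with $\mathcal B^\lambda\mathcal B^\mu\subseteq\mathcal B^{\lambda+\mu}$; $\mathrm{supp}_\Lambda(\mathcal B)=\{\lambda:\mathcal B^\lambda\neq0\}$, and $\langle\cdot\rangle$ denotes the generated subgroup. A $\Lambda$-graded algebra $\mathcal B$ and a $\Lambda'$-graded algebra $\mathcal B'$ are isograded-isomorphic, $\mathcal B\simeq_{\mathrm{ig}}\mathcal B'$, if there are an algebra isomorphism $\varphi:\mathcal B\to\mathcal B'$ and a group isomorphism $\nu:\Lambda\to\Lambda'$ with $\varphi(\mathcal B^\lambda)=\mathcal B'^{\,\nu(\lambda)}$ for all $\lambda\in\Lambda$. Centroid: $C(\mathcal B)$ is the centralizer in $\mathrm{End}_k(\mathcal B)$ of the unital subalgebra generated by all left and right multiplications by elements of $\mathcal B$; $C(\mathcal B)^\lambda=\{c\in C(\mathcal B):c(\mathcal B^\mu)\subseteq\mathcal B^{\lambda+\mu}\ \forall\mu\}$. $\mathcal B$ is simple (resp. graded-simple) if $\mathcal B\mathcal B\neq0$ and its only ideals (resp. graded ideals) are $0,\mathcal B$; central if $C(\mathcal B)=k1$; graded-central if $C(\mathcal B)^0=k1$; central-simple = central and simple; graded-central-simple = graded-central and graded-simple. For $\mathcal B$ graded-simple, $\Gamma(\mathcal B)=\{\lambda\in\Lambda:C(\mathcal B)^\lambda\neq0\}$, a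 subgroup of $\Lambda$. $\mathcal B$ is fgc if it is finitely generated as a $C(\mathcal B)$-module. Multiloop algebras: fix primitive $\ell$-th roots of unity $\zeta_\ell\in k$ for all $\ell\ge1$ with $\zeta_{m\ell}^m=\zeta_\ell$ for all $\ell,m\ge1$. Given $\mathbf m=(m_1,\dots,m_n)$ positive integers, an algebra $\mathcal A$ and pairwise commuting automorphisms $\sigma_1,\dots,\sigma_n$ of $\mathcal A$ with $\sigma_i^{m_i}=1$, put $\bar\Lambda=\mathbb Z/(m_1)\oplus\cdots\oplus\mathbb Z/(m_n)$ and $\mathcal A^{(\bar\ell_1,\dots,\bar\ell_n)}=\{u\in\mathcal A:\sigma_ju=\zeta_{m_j}^{\ell_j}u,\ 1\le j\le n\}$. Then $M_{\mathbf m}(\mathcal A,\sigma_1,\dots,\sigma_n)=\sum_{(\ell_1,\dots,\ell_n)\in\mathbb Z^n}\mathcal A^{(\bar\ell_1,\dots,\bar\ell_n)}\otimes z_1^{\ell_1}\cdots z_n^{\ell_n}\subseteq\mathcal A\otimes_kk[z_1^{\pm1},\dots,z_n^{\pm1}]$, a $\mathbb Z^n$-graded algebra whose component of degree $(\ell_1,\dots,\ell_n)$ is the corresponding summand. Admissibility: let $D_{\mathbf m}=\mathrm{diag}(m_1,\dots,m_n)$. $P\in\mathrm{GL}_n(\mathbb Z)$ is $(\mathbf m',\mathbf m)$-admissible if $D_{\mathbf m'}P^tD_{\mathbf m}^{-1}\in\mathrm{GL}_n(\mathbb Z)$. *)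

(* Defs.v *)
From HB Require Import structures.
From mathcomp Require Import all_boot all_algebra.
From mathcomp Require Import finmap all_classical.
From mathcomp Require Import monalg.

Set Implicit Arguments.
Unset Strict Implicit.
Unset Printing Implicit Defensive.

Import GRing.Theory.
Local Open Scope ring_scope.
Local Open Scope classical_set_scope.

(* Algebras are neither associative nor unital, so MathComp's [algType]      *)
(* does not apply.                                                           *)
HB.mixin Record Lmodule_isNAAlgebra (k : fieldType) A of GRing.Lmodule k A := {
  namul : A -> A -> A;
  namul_bilinear : bilinear_for *:%R *:%R namul
}.

#[short(type="naAlgType")]
HB.structure Definition NAAlgebra (k : fieldType) :=
  { A of GRing.Lmodule k A & Lmodule_isNAAlgebra k A }.

Arguments namul {k s} _ _.

Notation "x ** y" := (namul x y) (at level 40, left associativity) : ring_scope.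

HB.instance Definition _ (k : fieldType) (A : naAlgType k) :=
  bilinear_isBilinear.Build k A A A _ _ (@namul k A) (@namul_bilinear k A).

Section ProductTheory.
Variables (k : fieldType) (A : naAlgType k).
Implicit Types (c : k) (x y : A).

Lemma namulZl c x y : (c *: x) ** y = c *: (x ** y).
Proof. exact: linearZl_LR. Qed.

Lemma namulZr c x y : x ** (c *: y) = c *: (x ** y).
Proof. exact: linearZr_LR. Qed.

End ProductTheory.

Section Algebra.
Variable k : fieldType.
Implicit Types A B : naAlgType k.

Record alg_iso A B := AlgIso {
  iso_fun :> {linear A -> B};
  iso_inv : B -> A;
  iso_mul : {morph iso_fun : x y / x ** y};
  iso_funK : cancel iso_fun iso_inv;
  iso_invK : cancel iso_inv iso_fun
}.

Definition ideal B (I : set B) : Prop :=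
  submod_closed [in I] /\ forall x y, I x -> I (x ** y) /\ I (y ** x).

Definition simple_alg B : Prop :=
  (exists x y : B, x ** y <> 0) /\
  (forall I : set B, ideal I -> I = [set 0] \/ I = setT).

(* The unital subalgebra of End_k(B) generated by all left and right         *)
(* multiplications.                                                          *)
Inductive mult_alg B : set (B -> B) :=
| mult_alg_id : mult_alg id
| mult_alg_left a : mult_alg (fun x => a ** x)
| mult_alg_right a : mult_alg (fun x => x ** a)
| mult_alg_add f g : mult_alg f -> mult_alg g -> mult_alg (fun x => f x + g x)
| mult_alg_scale c f : mult_alg f -> mult_alg (fun x => c *: f x)
| mult_alg_comp f g : mult_alg f -> mult_alg g -> mult_alg (f \o g).

Definition centroid B : set (B -> B) :=
  [set c | linear c /\ forall f, @mult_alg B f -> c \o f = f \o c].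

Definition scalar_maps B : set (B -> B) := range (fun (a : k) (x : B) => a *: x).

Definition central_alg B : Prop := @centroid B = @scalar_maps B.

Definition central_simple B : Prop := central_alg B /\ simple_alg B.

Definition fgc B : Prop :=
  exists (d : nat) (b : 'I_d -> B), forall x : B,
    exists2 c : 'I_d -> B -> B,
      (forall i, centroid (c i)) & x = \sum_i c i (b i).

Definition finite_dimensional B : Prop :=
  exists (d : nat) (b : 'I_d -> B), forall x : B,
    exists a : 'I_d -> k, x = \sum_i a i *: b i.

End Algebra.

Section Group.
Variable L : zmodType.

Definition free_abelian_of_rank (n : nat) : Prop :=
  exists b : 'I_n -> L,
    bijective (fun c : 'rV[int]_n => \sum_i b i *~ c 0 i).

Definition gen_subgroup (S : set L) : set L :=
  smallest (fun H : set L => zmod_closed [in H]) S.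

Definition finite_index (H : set L) : Prop :=
  finite_set (range (fun l : L => [set l + h | h in H])).

End Group.

(* [gcomp_span] and [gcomp_indep] express that B is the direct sum of the    *)
(* [gcomp l].                                                                *)
Record grading (k : fieldType) (L : zmodType) (B : naAlgType k) := Grading {
  gcomp :> L -> set B;
  gcomp_submod : forall l, submod_closed [in gcomp l];
  gcomp_span : forall x : B, exists (s : seq L) (f : L -> B),
    (forall l, gcomp l (f l)) /\ x = \sum_(l <- s) f l;
  gcomp_indep : forall (s : seq L) (f : L -> B), uniq s ->
    (forall l, gcomp l (f l)) -> \sum_(l <- s) f l = 0 ->
    forall l, l \in s -> f l = 0;
  gcomp_mul : forall l l' x y,
    gcomp l x -> gcomp l' y -> gcomp (l + l') (x ** y)
}.

Section Graded.
Variables (k : fieldType) (L : zmodType) (B : naAlgType k).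
Variable gB : grading L B.

Definition gsupport : set L := [set l | gB l <> [set 0]].

Definition graded_ideal (I : set B) : Prop :=
  ideal I /\ forall x, I x -> exists (s : seq L) (f : L -> B),
    (forall l, (I `&` gB l) (f l)) /\ x = \sum_(l <- s) f l.

Definition graded_simple : Prop :=
  (exists x y : B, x ** y <> 0) /\
  (forall I : set B, graded_ideal I -> I = [set 0] \/ I = setT).

Definition centroid_comp (l : L) : set (B -> B) :=
  [set c | centroid c /\ forall l', c @` gB l' `<=` gB (l + l')].

Definition graded_central : Prop := centroid_comp 0 = @scalar_maps k B.

Definition graded_central_simple : Prop := graded_central /\ graded_simple.

(* Gamma(B); a subgroup of L when B is graded-simple. *)
Definition centroid_support : set L :=
  [set l | centroid_comp l <> [set (fun=> 0)]].

End Graded.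

Definition isograded_isomorphic (k : fieldType) (L L' : zmodType)
    (B B' : naAlgType k) (gB : grading L B) (gB' : grading L' B') : Prop :=
  exists (phi : alg_iso B B') (nu : {additive L -> L'}),
    bijective nu /\ forall l, phi @` gB l = gB' (nu l).

(* A (x)_k k[z_1^+-1, ..., z_n^+-1], realised as the finitely supported      *)
(* functions from Z^n to A : << u *g l >> stands for the tensor u (x) z^l.   *)
Definition laurent (k : fieldType) (A : naAlgType k) (n : nat) :=
  {malg A['rV[int]_n]}.

Section Laurent.
Variables (k : fieldType) (A : naAlgType k) (n : nat).
Local Notation L := (laurent A n).
Implicit Types (f g : L) (l : 'rV[int]_n).

HB.instance Definition _ := GRing.Zmodule.on L.

Definition laurent_scale (c : k) f : L :=
  [malg l in msupp f => c *: f@_l].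

Lemma laurent_scaleE c f l : (laurent_scale c f)@_l = c *: f@_l.
Proof. by rewrite mcoeffE; case: msuppP => // _; rewrite scaler0. Qed.

Fact laurent_scaleA c d f :
  laurent_scale c (laurent_scale d f) = laurent_scale (c * d) f.
Proof. by apply/malgP => l; rewrite !laurent_scaleE scalerA. Qed.

Fact laurent_scale1 : left_id 1 laurent_scale.
Proof. by move=> f; apply/malgP => l; rewrite laurent_scaleE scale1r. Qed.

Fact laurent_scaleDr : right_distributive laurent_scale +%R.
Proof.
move=> c f g; apply/malgP => l.
by rewrite mcoeffD !laurent_scaleE mcoeffD scalerDr.
Qed.

Fact laurent_scaleDl f : {morph laurent_scale^~ f : c d / c + d}.
Proof.
move=> c d; apply/malgP => l.
by rewrite mcoeffD !laurent_scaleE scalerDl.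
Qed.

HB.instance Definition _ := GRing.Zmodule_isLmodule.Build k L
  laurent_scaleA laurent_scale1 laurent_scaleDr laurent_scaleDl.

Lemma laurentZE c f l : (c *: f)@_l = c *: f@_l.
Proof. exact: laurent_scaleE. Qed.

(* The product is locked because unifying two unfolded products is slow.     *)
Fact laurent_mul_key : unit. Proof. exact: tt. Qed.

Definition laurent_mul : L -> L -> L := locked_with laurent_mul_key (fun f g =>
  \sum_(a <- msupp f) \sum_(b <- msupp g) << f@_a ** g@_b *g a + b >>).

Canonical laurent_mul_unlockable := [unlockable fun laurent_mul].

Lemma laurent_mulE f g l :
  (laurent_mul f g)@_l = \sum_(a <- msupp f) f@_a ** g@_(l - a).
Proof.
rewrite unlock raddf_sum; apply: eq_bigr => a _; rewrite raddf_sum /=.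
have eq_ab b : (a + b == l) = (b == l - a) by rewrite addrC eq_sym -subr_eq eq_sym.
under eq_bigr do rewrite mcoeffU eq_ab.
have [lg|lg] := msuppP g (l - a).
  rewrite (big_fsetD1 _ lg) /= eqxx mulr1n big1_fset ?addr0 // => b.
  by rewrite in_fsetD1 => /andP[/negbTE->].
rewrite linear0r big1_fset // => b bg _.
by case: eqP bg lg => [-> ->|].
Qed.

Lemma laurent_mulwE (d : {fset 'rV[int]_n}) f g l : fsubset (msupp f) d ->
  (laurent_mul f g)@_l = \sum_(a <- d) f@_a ** g@_(l - a).
Proof.
move=> fd; rewrite laurent_mulE (big_fset_incl _ fd) // => a _.
by move=> /mcoeff_outdom ->; rewrite linear0l.
Qed.

Fact laurent_mul_bilinear : bilinear_for *:%R *:%R laurent_mul.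
Proof.
split=> [g c f f'|f c g g']; apply/malgP => l; rewrite mcoeffD laurentZE.
  pose d := fsetU (fsetU (msupp f) (msupp f')) (msupp (c *: f + f')).
  have df : fsubset (msupp f) d by rewrite /d -fsetUA fsubsetUl.
  have df' : fsubset (msupp f') d by rewrite /d fsetUAC fsubsetUr.
  have dff' : fsubset (msupp (c *: f + f')) d by exact: fsubsetUr.
  rewrite (laurent_mulwE g l df) (laurent_mulwE g l df').
  rewrite (laurent_mulwE g l dff') scaler_sumr -big_split.
  apply: eq_bigr => a _ /=.
  by rewrite mcoeffD laurentZE linearPl.
rewrite !laurent_mulE scaler_sumr -big_split; apply: eq_bigr => a _ /=.
by rewrite mcoeffD laurentZE linearPr.
Qed.

HB.instance Definition _ :=
  Lmodule_isNAAlgebra.Build k L laurent_mul_bilinear.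

End Laurent.

Record compatible_roots (k : fieldType) := CompatibleRoots {
  root_of :> nat -> k;
  root_of_prim : forall l, (0 < l)%N -> l.-primitive_root (root_of l);
  root_of_compat : forall l m, (0 < l)%N -> (0 < m)%N ->
    root_of (m * l) ^+ m = root_of l
}.

Section MultiloopSpace.
Variables (k : fieldType) (zeta : compatible_roots k) (n : nat).
Variables (A : naAlgType k) (m : 'I_n -> nat) (m_gt0 : forall i, (0 < m i)%N).
Variable sg : 'I_n -> alg_iso A A.
Implicit Types l : 'rV[int]_n.

(* The component of A of degree (l_1 mod m_1, ..., l_n mod m_n).             *)
Definition eigencomp l : {pred A} :=
  [pred u | [forall j, sg j u == zeta (m j) ^ l 0 j *: u]].

Lemma eigencompP l u :
  reflect (forall j, sg j u = zeta (m j) ^ l 0 j *: u) (u \in eigencomp l).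
Proof. by apply: (iffP forallP) => h j; apply/eqP. Qed.

Fact eigencomp_submod l : submod_closed (eigencomp l).
Proof.
split=> [|c u v /eigencompP hu /eigencompP hv]; apply/eigencompP => j.
  by rewrite linear0 scaler0.
by rewrite linearP hu hv scalerDr !scalerA mulrC.
Qed.

Lemma zeta_neq0 j : zeta (m j) != 0.
Proof.
apply/eqP => z0; have := prim_expr_order (root_of_prim zeta (m_gt0 j)).
by rewrite z0 expr0n eqn0Ngt m_gt0 => /eqP; rewrite eq_sym oner_eq0.
Qed.


Lemma eigencomp_mul l l' u v : u \in eigencomp l -> v \in eigencomp l' ->
  u ** v \in eigencomp (l + l').
Proof.
move=> /eigencompP hu /eigencompP hv; apply/eigencompP => j.
rewrite iso_mul hu hv namulZl namulZr scalerA mxE expfzDr //.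
exact: zeta_neq0.
Qed.

(* The sum over l of the A^(l mod m) (x) z^l. *)
Definition multiloop_pred : {pred laurent A n} :=
  [pred f | all (fun l => f@_l \in eigencomp l) (msupp f)].

Lemma multiloopP f :
  reflect (forall l, f@_l \in eigencomp l) (f \in multiloop_pred).
Proof.
apply: (iffP allP) => [h l|h l _]; last exact: h.
by have [/h//|_] := msuppP f l; case: (eigencomp_submod l).
Qed.

Fact multiloop_submod : submod_closed multiloop_pred.
Proof.
split=> [|c f g /multiloopP hf /multiloopP hg]; apply/multiloopP => l.
  by rewrite mcoeff0; case: (eigencomp_submod l).
rewrite mcoeffD laurentZE; exact: (eigencomp_submod l).2.
Qed.

Fact multiloop_pred_mul f g :
  f \in multiloop_pred -> g \in multiloop_pred -> f ** g \in multiloop_pred.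
Proof.
move=> /multiloopP hf /multiloopP hg; apply/multiloopP => l.
rewrite [f ** g]/(laurent_mul f g) laurent_mulE; elim/big_ind: _ => /=.
- by case: (eigencomp_submod l).
- move=> u v hu hv; rewrite -[u]scale1r; exact: (eigencomp_submod l).2.
- by move=> a _; rewrite -{2}[l](subrKC a); apply: eigencomp_mul.
Qed.

HB.instance Definition _ := GRing.isSubmodClosed.Build k _ multiloop_pred
  multiloop_submod.

Record multiloop_space := MultiloopSpace {
  multiloop_val :> laurent A n;
  multiloop_valP : multiloop_val \in multiloop_pred
}.

HB.instance Definition _ := [isSub for multiloop_val].
HB.instance Definition _ := [Choice of multiloop_space by <:].
HB.instance Definition _ := [SubChoice_isSubLmodule of multiloop_space by <:].

End MultiloopSpace.

Section Multiloop.
Variables (k : fieldType) (zeta : compatible_roots k) (n : nat).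
Variables (A : naAlgType k) (m : 'I_n -> nat) (m_gt0 : forall i, (0 < m i)%N).
Variable sg : 'I_n -> alg_iso A A.
Local Notation S := (multiloop_space zeta m sg).

(* An alias of [multiloop_space] that remembers [m_gt0], which is needed for *)
(* the product to be well-defined.                                           *)
Definition multiloop of (forall i, (0 < m i)%N) : Type := S.
Local Notation M := (multiloop m_gt0).
Implicit Types (f g : M) (l : 'rV[int]_n).

HB.instance Definition _ := GRing.Lmodule.on M.

Definition multiloop_mul f g : M :=
  MultiloopSpace (multiloop_pred_mul m_gt0 (multiloop_valP f) (multiloop_valP g)).

Fact multiloop_mul_bilinear : bilinear_for *:%R *:%R multiloop_mul.
Proof.
by split=> [g c f f'|f c g g']; apply: val_inj; rewrite /= ?linearPl ?linearPr.
Qed.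

HB.instance Definition _ :=
  Lmodule_isNAAlgebra.Build k M multiloop_mul_bilinear.

(* A^(l mod m) (x) z^l *)
Definition multiloop_comp l : set M :=
  [set f | exists2 u, u \in eigencomp zeta m sg l &
             multiloop_val f = << u *g l >>].

Lemma multiloop_coef f l :
  (multiloop_val f)@_l \in eigencomp zeta m sg l.
Proof. by move: (multiloop_valP f) => /multiloopP; apply. Qed.

Lemma multiloop_compP l f :
  multiloop_comp l f <-> (forall l', l' != l -> (multiloop_val f)@_l' = 0).
Proof.
split=> [[u _ ->] l' /negbTE ll'|h]; first by rewrite mcoeffU eq_sym ll'.
exists (multiloop_val f)@_l; first exact: multiloop_coef.
apply/malgP => l'; rewrite mcoeffU eq_sym.
by have [->|/h ->] := eqVneq l' l.
Qed.

Fact multiloop_comp_submod l : submod_closed [in multiloop_comp l].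
Proof.
split=> [|c f g]; rewrite !inE.
  by apply/multiloop_compP => l' _; rewrite /= mcoeff0.
move=> /multiloop_compP hf /multiloop_compP hg; apply/multiloop_compP => l' ll'.
by rewrite /= mcoeffD laurentZE hf // hg // scaler0 addr0.
Qed.

Fact multiloop_monP f l :
  << (multiloop_val f)@_l *g l >> \in multiloop_pred zeta m sg.
Proof.
apply/multiloopP => l'; rewrite mcoeffU.
have [<-|_] := eqVneq l l'; first exact: multiloop_coef.
by case: (eigencomp_submod zeta m sg l').
Qed.

Definition multiloop_mon f l : M := MultiloopSpace (multiloop_monP f l).

Fact multiloop_val_sum (s : seq 'rV[int]_n) (F : 'rV[int]_n -> M) :
  multiloop_val (\sum_(l <- s) F l) = \sum_(l <- s) multiloop_val (F l).
Proof. exact: (raddf_sum (val : S -> laurent A n)). Qed.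

Fact multiloop_comp_span f : exists (s : seq 'rV[int]_n) (F : 'rV[int]_n -> M),
  (forall l, multiloop_comp l (F l)) /\ f = \sum_(l <- s) F l.
Proof.
exists (msupp (multiloop_val f)), (multiloop_mon f); split=> [l|].
  by apply/multiloop_compP => l' /negbTE ll'; rewrite mcoeffU eq_sym ll'.
apply: val_inj; rewrite [RHS]multiloop_val_sum; exact: monalgE.
Qed.

Fact multiloop_comp_indep (s : seq 'rV[int]_n) (F : 'rV[int]_n -> M) :
  uniq s -> (forall l, multiloop_comp l (F l)) -> \sum_(l <- s) F l = 0 ->
  forall l, l \in s -> F l = 0.
Proof.
move=> us hF /(congr1 (@multiloop_val _ _ _ _ _ _)) + l ls.
rewrite multiloop_val_sum => /(congr1 (mcoeff l)).
rewrite raddf_sum (bigD1_seq l) //= mcoeff0 big1 ?addr0 => [Fl|l' l'l].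
  apply: val_inj; apply/malgP => l' /=; rewrite mcoeff0.
  have [->//|l'l] := eqVneq l' l.
  by have /multiloop_compP -> := hF l.
by have /multiloop_compP -> := hF l'; rewrite // eq_sym.
Qed.

Fact multiloop_comp_mul l l' f g :
  multiloop_comp l f -> multiloop_comp l' g -> multiloop_comp (l + l') (f ** g).
Proof.
move=> /multiloop_compP hf /multiloop_compP hg; apply/multiloop_compP => a al.
rewrite [multiloop_val _]/(laurent_mul f g) laurent_mulE big1 // => b _.
have [->|bl] := eqVneq b l; last by rewrite hf // linear0l.
by rewrite hg ?linear0r // subr_eq addrC.
Qed.

Definition multiloop_grading : grading 'rV[int]_n M :=
  Grading multiloop_comp_submod multiloop_comp_span multiloop_comp_indep
    multiloop_comp_mul.

End Multiloop.

Definition aut_pow (k : fieldType) (A : naAlgType k) (s : alg_iso A A)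
    (p : int) : A -> A :=
  match p with Posz q => iter q s | Negz q => iter q.+1 (iso_inv s) end.

(* sg'_j = phi (\prod_i sg_i ^ P_ij) phi^-1; the order of the composition is  *)
(* immaterial since the sg_i are assumed to commute wherever this is used.   *)
Definition related_by (k : fieldType) (A A' : naAlgType k) (n : nat)
    (sg : 'I_n -> alg_iso A A) (sg' : 'I_n -> alg_iso A' A')
    (P : 'M[int]_n) (phi : alg_iso A A') : Prop :=
  forall j, sg' j =1
    phi \o \big[(fun f g : A -> A => f \o g)/id]_(i < n) aut_pow (sg i) (P i j)
        \o iso_inv phi.

Definition commuting_periods (k : fieldType) (A : naAlgType k) (n : nat)
    (m : 'I_n -> nat) (sg : 'I_n -> alg_iso A A) : Prop :=
  (forall i j, sg i \o sg j =1 sg j \o sg i) /\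
  (forall i, iter (m i) (sg i) =1 id).

Definition period_mx (n : nat) (m : 'I_n -> nat) : 'M[rat]_n :=
  diag_mx (\row_i (m i)%:R).

Definition admissible (n : nat) (m' m : 'I_n -> nat) (P : 'M[int]_n) : Prop :=
  exists2 Q : 'M[int]_n, Q \in unitmx &
    period_mx m' *m (map_mx intr P)^T *m invmx (period_mx m) = map_mx intr Q.

(* Main.v *)
(* Graded ideals and homogeneous centroid elements of M(A, sigma) descend to A
   along the specialization z_i = 1, because u * ev (c f) = ev (c (lift u)) * ev f.
   This makes M(A, sigma) graded-central-simple with Gamma = diag(m) Z^n when A
   is central-simple.  For the converse, an element of minimal support in an
   ideal of A defines a homogeneous centroid element of M(A, sigma) whose degree
   lies outside Gamma unless the support is a single point.
   Given B, the Smith normal form yields a basis of Lambda adapted to Gamma; the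
   homogeneous centroid elements then form a torus T of shifts, A is B modulo T,
   and the roots of unity turn its Lambda/Gamma-grading into the sigma_i.
   An isograded isomorphism phi has a matrix N with diag(m) N = P diag(m') and
   P in GL_n(Z).  It matches the shifts of both sides up to a character, which
   extends to Z^n because k is algebraically closed; dividing it out, phi
   descends to A -> A'. *)
Require Import Defs.
From HB Require Import structures.
From mathcomp Require Import all_boot all_order all_algebra.
From mathcomp Require Import finmap all_classical.
From mathcomp Require Import monalg.

Set Implicit Arguments.
Unset Strict Implicit.
Unset Printing Implicit Defensive.

Import GRing.Theory Num.Theory Order.TTheory.
Local Open Scope ring_scope.
Local Open Scope classical_set_scope.

(** * Nonassociative algebras, ideals and the centroid *)

Section Centroid.
Variables (k : fieldType) (B : naAlgType k).
Implicit Types (x y : B) (c d : B -> B).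

(** Without an identity element, elements of [A] can only be compared through their products. In a
    simple algebra, and in a graded-simple one, the two-sided annihilator is zero; this makes the
    centroid commutative and lets a centroid element of the multiloop algebra descend to [A].
    Passing from [A] to the multiloop algebra requires [A] to be the sum of the joint eigenspaces of
    the automorphisms, which averaging over cyclic groups provides in any dimension. In (iii), since
    centroid elements descend to scalars, a finite generating family over the centroid specializes
    to a finite spanning family of [A]. In (ii), integer vectors are rows: the isomorphism attached
    to [P] and [phi] sends v z^l to phi(v) z^(l N), where [N] is the transpose of the matrix whose
    invertibility defines admissibility. When the supports generate Z^n, the periods of the second
    family of automorphisms force the divisibilities that make [N] integral, and the second support
    makes it surjective. *)

Lemma namulDl x y z : (x + y) ** z = x ** z + y ** z.
Proof. exact: linearDl. Qed.

Lemma namulDr x y z : x ** (y + z) = x ** y + x ** z.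
Proof. exact: linearDr. Qed.

Lemma namul0l x : 0 ** x = 0 :> B.
Proof. exact: linear0l. Qed.

Lemma namul0r x : x ** 0 = 0 :> B.
Proof. exact: linear0r. Qed.

Lemma namulBl x y z : (x - y) ** z = x ** z - y ** z.
Proof. exact: linearBl. Qed.

Lemma namulBr x y z : x ** (y - z) = x ** y - x ** z.
Proof. exact: linearBr. Qed.

Lemma lin_D c : linear c -> {morph c : x y / x + y}.
Proof. by move=> lc x y; rewrite -[x]scale1r lc !scale1r. Qed.

Lemma lin_0 c : linear c -> c 0 = 0.
Proof.
move=> lc; have := lin_D lc 0 0; rewrite addr0 => /eqP.
by rewrite -subr_eq0 opprD addNKr oppr_eq0 => /eqP.
Qed.

Lemma lin_Z c : linear c -> forall a x, c (a *: x) = a *: c x.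
Proof. by move=> lc a x; rewrite -[a *: x]addr0 lc lin_0 // addr0. Qed.

Lemma lin_B c : linear c -> {morph c : x y / x - y}.
Proof. by move=> lc x y; rewrite addrC -scaleN1r lc scaleN1r addrC. Qed.

Lemma centroidP c : centroid c <->
  [/\ linear c, forall x y, c (x ** y) = x ** c y
    & forall x y, c (x ** y) = c x ** y].
Proof.
split=> [[lc hc]|[lc hl hr]].
  split=> // x y; first exact: (congr1 (fun h => h y) (hc _ (mult_alg_left x))).
  exact: (congr1 (fun h => h x) (hc _ (mult_alg_right y))).
split=> // f; elim=> [|a|a|f1 f2 _ h1 _ h2|a f1 _ h1|f1 f2 _ h1 _ h2] //=;
  apply/funext => x //=.
- have /= <- := congr1 (@^~ x) h1; have /= <- := congr1 (@^~ x) h2.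
  exact: lin_D.
- by have /= <- := congr1 (@^~ x) h1; apply: lin_Z.
- by have /= -> := congr1 (@^~ (f2 x)) h1; have /= -> := congr1 (@^~ x) h2.
Qed.

Lemma centroid_scalar (a : k) : centroid (fun x : B => a *: x).
Proof.
apply/centroidP; split=> [b x y|x y|x y]; rewrite ?namulZl ?namulZr //.
by rewrite scalerDr !scalerA mulrC.
Qed.

Lemma centroid_comp_fun c d : centroid c -> centroid d -> centroid (c \o d).
Proof.
move=> /centroidP[lc cl cr] /centroidP[ld dl dr]; apply/centroidP.
split=> [b x y|x y|x y] /=; first by rewrite ld lc.
  by rewrite dl cl.
by rewrite dr cr.
Qed.

Lemma centroid_inv c d : centroid c -> cancel c d -> cancel d c -> centroid d.
Proof.
move=> /centroidP[lc cl cr] cd dc; have ci := can_inj cd.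
apply/centroidP; split=> [b x y|x y|x y]; apply: ci.
- by rewrite lc !dc.
- by rewrite cl !dc.
- by rewrite cr !dc.
Qed.

(** Its vanishing is the substitute for an identity element: an element is then determined by its
    products. *)
Definition annihilator : set B := [set x | forall y, x ** y = 0 /\ y ** x = 0].

(** Both [c (d x) ** y] and [d (c x) ** y] equal [d x ** c y], and symmetrically on the other side,
    so the commutator takes values in the annihilator. *)
Lemma centroid_commute c d : annihilator `<=` [set 0] ->
  centroid c -> centroid d -> c \o d = d \o c.
Proof.
move=> ann /centroidP[lc cl cr] /centroidP[ld dl dr]; apply/funext => x /=.
apply/eqP; rewrite -subr_eq0; apply/eqP/ann => y; split.
  by rewrite namulBl -[c (d x) ** y]cr cl -[d (c x) ** y]dr -cr cl dr subrr.
by rewrite namulBr -[y ** c (d x)]cl cr -[y ** d (c x)]dl -cl cr dl subrr.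
Qed.

Lemma annihilator_ideal : ideal annihilator.
Proof.
split=> [|x y hx]; last first.
  by split=> z; rewrite ?(hx y).1 ?(hx y).2 ?namul0l ?namul0r.
split; first by rewrite inE => y; rewrite namul0l namul0r.
move=> a x y; rewrite !inE => hx hy z.
rewrite namulDl namulDr namulZl namulZr (hx z).1 (hx z).2 (hy z).1 (hy z).2.
by rewrite scaler0 addr0.
Qed.

Lemma simple_annihilator : simple_alg B -> annihilator `<=` [set 0].
Proof.
move=> [[x [y xy]] /(_ _ annihilator_ideal)[-> //|annT]].
by have : annihilator x by [rewrite annT]; move=> /(_ y)[].
Qed.

Lemma setP0 (I : set B) : I 0 -> I <> [set 0] -> exists2 x, I x & x <> 0.
Proof.
move=> I0 In; apply: contrapT => h; apply: In; apply/seteqP; split=> x /=.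
  by move=> Ix; apply: contrapT => x0; apply: h; exists x.
by move=> ->.
Qed.

End Centroid.

Section Ideal.
Variables (k : fieldType) (B : naAlgType k) (I : set B).
Hypothesis idI : ideal I.

Lemma ideal0 : I 0.
Proof. by case: idI.1 => + _; rewrite inE. Qed.

Lemma idealP a x y : I x -> I y -> I (a *: x + y).
Proof. by move=> Ix Iy; have := idI.1.2 a x y; rewrite !inE; apply. Qed.

Lemma idealD x y : I x -> I y -> I (x + y).
Proof. by move=> Ix Iy; rewrite -[x]scale1r; apply: idealP. Qed.

Lemma ideal_sum (J : eqType) (s : seq J) (F : J -> B) :
  (forall j, j \in s -> I (F j)) -> I (\sum_(j <- s) F j).
Proof.
move=> h; rewrite big_seq; elim/big_ind: _ => //; first exact: ideal0.
exact: idealD.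
Qed.

Lemma idealMl x y : I x -> I (y ** x).
Proof. by move=> /(idI.2 x y)[]. Qed.

Lemma idealMr x y : I x -> I (x ** y).
Proof. by move=> /(idI.2 x y)[]. Qed.

End Ideal.

Lemma alg_iso_build (k : fieldType) (B B' : naAlgType k) (F : {linear B -> B'}) :
  {morph F : x y / x ** y} -> injective F -> (forall y, exists x, F x = y) ->
  exists phi : alg_iso B B', forall x, phi x = F x.
Proof.
move=> Fm Fi Fs; pose G y := projT1 (cid (Fs y)).
have FG : cancel G F by move=> y; rewrite /G; case: cid.
have GF : cancel F G by move=> x; apply: Fi; rewrite FG.
by exists (AlgIso Fm GF FG).
Qed.

Lemma sum_subseq_widen (V : nmodType) (I : eqType) (s t : seq I) (F : I -> V) :
  uniq s -> uniq t -> {subset s <= t} -> (forall i, i \notin s -> F i = 0) ->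
  \sum_(i <- t) F i = \sum_(i <- s) F i.
Proof.
move=> us ut st F0; rewrite (bigID (mem s)) /= [X in _ + X]big1 // addr0 -big_filter.
apply: perm_big; apply: uniq_perm => [||i]; rewrite ?filter_uniq // mem_filter.
by apply: andb_idr; apply: st.
Qed.

(** * Homogeneous components, and linear maps defined degree by degree *)

Section Grading.
Variables (k : fieldType) (L : zmodType) (B : naAlgType k).
Variable g : grading L B.
Implicit Types (l : L) (x y : B).

Lemma gcomp0 l : g l 0.
Proof. by case: (gcomp_submod g l) => + _; rewrite inE. Qed.

Lemma gcompP l a x y : g l x -> g l y -> g l (a *: x + y).
Proof. by move=> hx hy; have := (gcomp_submod g l).2 a x y; rewrite !inE; apply. Qed.

Lemma gcompZ l a x : g l x -> g l (a *: x).
Proof. by move=> hx; rewrite -[_ *: _]addr0; apply: gcompP => //; apply: gcomp0. Qed.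

Lemma gcompB l x y : g l x -> g l y -> g l (x - y).
Proof. by move=> hx hy; rewrite addrC -scaleN1r; apply: gcompP. Qed.

Lemma gind (P : B -> Prop) : P 0 -> (forall x y, P x -> P y -> P (x + y)) ->
  (forall l x, g l x -> P x) -> forall x, P x.
Proof.
move=> P0 PD Ph x; have [s [f [hf ->]]] := gcomp_span g x.
by elim/big_ind: _ => // l _; apply: (Ph l).
Qed.

(** A decomposition is a function of the degree that vanishes off a duplicate-free list; in this
    form it is unique, which is what makes [gproj] a well-behaved projection. *)
Definition is_gdec x (f : L -> B) :=
  (forall l, g l (f l)) /\ exists2 s, uniq s &
    (forall l, l \notin s -> f l = 0) /\ x = \sum_(l <- s) f l.

Lemma gdec_unique x f f' : is_gdec x f -> is_gdec x f' -> f =1 f'.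
Proof.
move=> [hf [s us [fs xs]]] [hf' [s' us' [fs' xs']]] l.
pose t := undup (l :: s ++ s'); have ut : uniq t := undup_uniq _.
have st : {subset s <= t}.
  by move=> i si; rewrite mem_undup inE mem_cat si orbT.
have st' : {subset s' <= t}.
  by move=> i si; rewrite mem_undup inE mem_cat si !orbT.
have /(_ t (fun i => f i - f' i)) := gcomp_indep (g := g).
move=> /(_ ut (fun i => gcompB (hf i) (hf' i))).
rewrite sumrB (sum_subseq_widen us ut st fs) (sum_subseq_widen us' ut st' fs').
rewrite -xs -xs' subrr => /(_ erefl l).
by rewrite mem_undup mem_head => /(_ isT)/eqP; rewrite subr_eq0 => /eqP.
Qed.

Lemma gdec_exists x : exists f, is_gdec x f.
Proof.
have [s [f [hf ->]]] := gcomp_span g x.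
(* The list given by [gcomp_span] may repeat a degree; the summand depends only on the degree, so
   repetitions amount to a multiplicity. *)
exists (fun l => f l *+ count_mem l s); split=> [l|].
  by rewrite -scaler_nat; apply: gcompZ.
exists (undup s); first exact: undup_uniq.
split=> [l|]; first by rewrite mem_undup => /count_memPn ->.
by rewrite big_undup_iterop_count.
Qed.

Definition gproj l x : B := projT1 (cid (gdec_exists x)) l.

Lemma gproj_dec x : is_gdec x (gproj^~ x).
Proof. by rewrite /gproj; case: cid. Qed.

Lemma gproj_in l x : g l (gproj l x).
Proof. exact: (gproj_dec x).1. Qed.

Lemma gproj_unique x f : is_gdec x f -> forall l, gproj l x = f l.
Proof. exact: gdec_unique (gproj_dec x). Qed.

Lemma gdec_hom l x : g l x -> is_gdec x (fun l' => if l' == l then x else 0).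
Proof.
move=> hx; split=> [l'|]; first by case: eqP => [->//|_]; exact: gcomp0.
exists [:: l] => //; split=> [l'|]; first by rewrite inE => /negbTE ->.
by rewrite big_seq1 eqxx.
Qed.

Lemma gproj_id l x : g l x -> gproj l x = x.
Proof. by move=> /gdec_hom/gproj_unique ->; rewrite eqxx. Qed.

Lemma gproj_other l l' x : g l x -> l' != l -> gproj l' x = 0.
Proof. by move=> /gdec_hom/gproj_unique -> /negbTE ->. Qed.

Fact gproj_linear l : linear (gproj l).
Proof.
move=> a x y; have [hx [s us [s0 xs]]] := gproj_dec x.
have [hy [t ut [t0 yt]]] := gproj_dec y.
apply: (@gproj_unique _ (fun l => a *: gproj l x + gproj l y)).
split=> [l'|]; first by apply: gcompP; apply: gproj_in.
exists (undup (s ++ t)); first exact: undup_uniq.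
split=> [l'|].
  rewrite mem_undup mem_cat negb_or => /andP[/s0 -> /t0 ->].
  by rewrite scaler0 addr0.
rewrite big_split -scaler_sumr /=.
rewrite (sum_subseq_widen us (undup_uniq (s ++ t)) _ s0) => [|i si]; last first.
  by rewrite mem_undup mem_cat si.
rewrite (sum_subseq_widen ut (undup_uniq (s ++ t)) _ t0) => [|i ti]; last first.
  by rewrite mem_undup mem_cat ti orbT.
by rewrite -xs -yt.
Qed.

HB.instance Definition _ l :=
  GRing.isLinear.Build k B B _ (gproj l) (gproj_linear l).

Lemma gproj_supp x : exists2 s, uniq s &
  (forall l, l \notin s -> gproj l x = 0) /\ x = \sum_(l <- s) gproj l x.
Proof. exact: (gproj_dec x).2. Qed.

Lemma gproj_eq0 x : (forall l, gproj l x = 0) -> x = 0.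
Proof. by move=> h; have [s _ [_ ->]] := gproj_supp x; rewrite big1. Qed.

Lemma gproj_inj x y : (forall l, gproj l x = gproj l y) -> x = y.
Proof.
move=> h; apply/eqP; rewrite -subr_eq0; apply/eqP/gproj_eq0 => l.
by rewrite linearB /= h subrr.
Qed.

Lemma gproj_mull l l' h x : g l' h -> gproj l (h ** x) = h ** gproj (l - l') x.
Proof.
move=> hh; elim/gind: x => [|x y hx hy|l1 x hx].
- by rewrite namul0r !linear0 namul0r.
- by rewrite namulDr !linearD /= hx hy namulDr.
have hhx := gcomp_mul hh hx; have [->|ll] := eqVneq l (l' + l1).
  by rewrite gproj_id // [l' + l1]addrC addrK gproj_id.
rewrite (gproj_other hhx ll) (gproj_other hx) ?namul0r //.
by apply: contraNneq ll => <-; rewrite addrC subrK.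
Qed.

Lemma gproj_mulr l l' h x : g l' h -> gproj l (x ** h) = gproj (l - l') x ** h.
Proof.
move=> hh; elim/gind: x => [|x y hx hy|l1 x hx].
- by rewrite namul0l !linear0 namul0l.
- by rewrite namulDl !linearD /= hx hy namulDl.
have hhx := gcomp_mul hx hh; have [->|ll] := eqVneq l (l1 + l').
  by rewrite gproj_id // addrK gproj_id.
rewrite (gproj_other hhx ll) (gproj_other hx) ?namul0l //.
by apply: contraNneq ll => <-; rewrite subrK.
Qed.

(** The product of a component of [x] with a homogeneous [y] is a component of the product of [x]
    with [y], which is 0. *)
Lemma graded_annihilator l x : @annihilator k B x -> annihilator (gproj l x).
Proof.
move=> hx y; elim/gind: y => [|y z [hy hy'] [hz hz']|l' y hy].
- by rewrite namul0r namul0l.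
- by rewrite namulDl namulDr hy hy' hz hz' addr0.
have := gproj_mulr (l + l') x hy; have := gproj_mull (l + l') x hy.
by rewrite addrK (hx y).1 (hx y).2 linear0.
Qed.

Lemma graded_idealI (I : set B) : ideal I ->
  (forall l x, I x -> I (gproj l x)) -> graded_ideal g I.
Proof.
move=> idI h; split=> // x Ix; have [s us [_ xs]] := gproj_supp x.
exists s, (gproj^~ x); split=> // l; split; first exact: h.
exact: gproj_in.
Qed.

Lemma graded_ideal_proj (I : set B) l x : graded_ideal g I -> I x -> I (gproj l x).
Proof.
move=> [idI h] /h[s [f [hf ->]]]; rewrite linear_sum /=; apply: ideal_sum => // l' _.
have [Ifl gfl] := hf l'; have [->|ll] := eqVneq l l'; first by rewrite gproj_id.
by rewrite (gproj_other gfl ll); apply: ideal0.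
Qed.

Lemma graded_simple_annihilator :
  graded_simple g -> @annihilator k B `<=` [set 0].
Proof.
move=> [[x [y xy]] /(_ (@annihilator k B))].
move=> /(_ (graded_idealI (annihilator_ideal B) graded_annihilator)).
by case=> [-> //|annT]; have : @annihilator k B x by [rewrite annT]; move=> /(_ y)[].
Qed.

Section Ext.
Variables (V : lmodType k) (F : L -> {linear B -> V}).

(** The linear map that restricts to [F l] on the component of degree [l]. The specializations, the
    shifts, the twists and the isograded isomorphisms below are all built in this way. *)
Definition gext x : V :=
  \sum_(l <- projT1 (cid2 (gproj_supp x))) F l (gproj l x).

Lemma gextE x s : uniq s -> (forall l, l \notin s -> gproj l x = 0) ->
  gext x = \sum_(l <- s) F l (gproj l x).
Proof.
rewrite /gext; case: cid2 => t /= ut [t0 _] us s0.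
have uu := undup_uniq (s ++ t).
rewrite -(sum_subseq_widen ut uu) => [|i ti|i /t0 ->]; last by rewrite linear0.
  rewrite -[RHS](sum_subseq_widen us uu) // => [i si|i /s0 ->]; last by rewrite linear0.
  by rewrite mem_undup mem_cat si.
by rewrite mem_undup mem_cat ti orbT.
Qed.

Fact gext_linear : linear gext.
Proof.
move=> a x y; have [s us [s0 _]] := gproj_supp x; have [t ut [t0 _]] := gproj_supp y.
have uu := undup_uniq (s ++ t).
have xst l : l \notin undup (s ++ t) -> gproj l x = 0.
  by rewrite mem_undup mem_cat negb_or => /andP[/s0].
have yst l : l \notin undup (s ++ t) -> gproj l y = 0.
  by rewrite mem_undup mem_cat negb_or => /andP[_ /t0].
rewrite (gextE uu xst) (gextE uu yst) (@gextE _ _ uu) => [|l hl]; last first.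
  by rewrite linearP /= xst // yst // scaler0 addr0.
by rewrite scaler_sumr -big_split /=; apply: eq_bigr => l _; rewrite !linearP.
Qed.

HB.instance Definition _ := GRing.isLinear.Build k B V _ gext gext_linear.

Lemma gext_hom l x : g l x -> gext x = F l x.
Proof.
move=> hx; rewrite (@gextE _ [:: l]) // ?big_seq1 ?gproj_id // => l'.
by rewrite inE => /(gproj_other hx).
Qed.

End Ext.

Lemma mul_hom (B' : naAlgType k) (f : {linear B -> B'}) :
  (forall l l' x y, g l x -> g l' y -> f (x ** y) = f x ** f y) ->
  {morph f : x y / x ** y}.
Proof.
move=> fm x y; elim/gind: x => [|x x' hx hx'|l x hx].
- by rewrite !(namul0l, linear0).
- by rewrite !(namulDl, linearD) hx hx'.
elim/gind: y => [|y y' hy hy'|l' y hy].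
- by rewrite !(namul0r, linear0).
- by rewrite !(namulDr, linearD) hy hy'.
exact: fm hx hy.
Qed.

End Grading.

(** * Isomorphisms of graded algebras *)

Section AlgIso.
Variables (k : fieldType) (B B' : naAlgType k) (phi : alg_iso B B').

Lemma iso_inj : injective phi.
Proof. exact: can_inj (iso_funK phi). Qed.

Fact iso_inv_linear : linear (iso_inv phi).
Proof. by move=> a x y; apply: iso_inj; rewrite linearP !iso_invK. Qed.

HB.instance Definition _ :=
  GRing.isLinear.Build k B' B _ (iso_inv phi) iso_inv_linear.

Lemma iso_inv_mul : {morph iso_inv phi : x y / x ** y}.
Proof. by move=> x y; apply: iso_inj; rewrite iso_mul !iso_invK. Qed.

Definition iso_sym : alg_iso B' B :=
  @AlgIso _ _ _ (iso_inv phi : {linear B' -> B}) phi iso_inv_mul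
    (iso_invK phi) (iso_funK phi).

Lemma centroid_conj c : centroid c -> centroid (phi \o c \o iso_inv phi).
Proof.
move=> /centroidP[lc cl cr]; apply/centroidP; split=> [a x y|x y|x y] /=.
- by rewrite linearP lc linearP.
- by rewrite iso_inv_mul cl iso_mul iso_invK.
- by rewrite iso_inv_mul cr iso_mul iso_invK.
Qed.

Lemma fgc_iso : fgc B -> fgc B'.
Proof.
move=> [d [b hb]]; exists d, (phi \o b) => x.
have [c hc xE] := hb (iso_inv phi x).
exists (fun i => phi \o c i \o iso_inv phi) => [i|].
  exact: centroid_conj.
rewrite -[LHS](iso_invK phi) xE linear_sum; apply: eq_bigr => i _ /=.
by rewrite iso_funK.
Qed.

End AlgIso.

Lemma iter_linear (k : fieldType) (V : lmodType k) (f : {linear V -> V}) q :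
  linear (iter q f).
Proof. by elim: q => [|q IH] a u v //=; rewrite IH linearP. Qed.

Section Isograded.
Variables (k : fieldType) (L L' : zmodType) (B B' : naAlgType k).
Variables (g : grading L B) (g' : grading L' B').

Definition graded_iso (phi : alg_iso B B') (nu : {additive L -> L'}) : Prop :=
  bijective nu /\ forall l, phi @` g l = g' (nu l).

Section Theory.
Variables (phi : alg_iso B B') (nu : {additive L -> L'}).
Hypothesis giso : graded_iso phi nu.

Lemma graded_iso_in l x : g l x -> g' (nu l) (phi x).
Proof. by move=> gx; rewrite -giso.2; exists x. Qed.

Lemma graded_iso_inv l y : g' (nu l) y -> g l (iso_inv phi y).
Proof. by rewrite -giso.2 => -[x gx <-]; rewrite iso_funK. Qed.

Lemma centroid_comp_conj l c : centroid_comp g l c ->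
  centroid_comp g' (nu l) (phi \o c \o iso_inv phi).
Proof.
move=> [cc hc]; split; first exact: centroid_conj.
have [nu' _ nuK] := giso.1.
move=> l' _ [y gy <-] /=; rewrite -(nuK l') in gy *; rewrite -raddfD.
by apply/graded_iso_in/hc; exists (iso_inv phi y) => //; apply: graded_iso_inv.
Qed.

Lemma centroid_comp0 l : centroid_comp g l (fun=> 0).
Proof.
split; last by move=> l' _ [x _ <-]; exact: gcomp0.
apply/centroidP; split=> [a x y|x y|x y].
- by rewrite scaler0 addr0.
- by rewrite namul0r.
- by rewrite namul0l.
Qed.

Lemma centroid_supportP l : centroid_support g l <->
  exists2 c, centroid_comp g l c & exists x, c x <> 0.
Proof.
split=> [h|[c hc [x cx]] h]; last first.
  by move: hc; rewrite h /= => cE; apply: cx; rewrite cE.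
apply: contrapT => hn; apply: h; apply/seteqP; split=> c /=; last first.
  by move=> ->; exact: centroid_comp0.
move=> hc; apply/funext => x; apply: contrapT => cx; apply: hn.
by exists c => //; exists x.
Qed.

End Theory.

(** Suited to maps given by [gext], for which only the effect on homogeneous elements is known. *)
Lemma isograded_build (F : {linear B -> B'}) (F' : {linear B' -> B})
    (nu : {additive L -> L'}) : bijective nu ->
  (forall l x, g l x -> g' (nu l) (F x)) ->
  (forall l y, g' (nu l) y -> g l (F' y)) ->
  (forall l x, g l x -> F' (F x) = x) ->
  (forall l y, g' (nu l) y -> F (F' y) = y) ->
  (forall l l' x y, g l x -> g l' y -> F (x ** y) = F x ** F y) ->
  exists phi : alg_iso B B', graded_iso phi nu.
Proof.
move=> bnu hF hF' F'F FF' Fm; have [nu' nuK nuK'] := bnu.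
have FK : cancel F F'.
  apply: (gind (g := g)) => [|x y hx hy|l x]; last exact: F'F.
    by rewrite !linear0.
  by rewrite !linearD /= hx hy.
have F'K : cancel F' F.
  apply: (gind (g := g')) => [|x y hx hy|l x]; first by rewrite !linear0.
    by rewrite !linearD /= hx hy.
  by rewrite -(nuK' l); apply: FF'.
exists (AlgIso (mul_hom Fm) FK F'K); split=> // l.
apply/seteqP; split=> [_ [x gx <-]|y gy]; first exact: hF.
by exists (F' y); [exact: hF'|exact: F'K].
Qed.

End Isograded.

Section IsogradedSym.
Variables (k : fieldType) (L L' : zmodType) (B B' : naAlgType k).
Variables (g : grading L B) (g' : grading L' B').

Lemma graded_iso_sym (phi : alg_iso B B') (nu : {additive L -> L'}) :
  graded_iso g g' phi nu -> exists2 nu' : {additive L' -> L},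
    cancel nu nu' /\ cancel nu' nu & graded_iso g' g (iso_sym phi) nu'.
Proof.
move=> giso; have [nu' nuK nuK'] := giso.1.
have nu'D : {morph nu' : x y / x - y}.
  by move=> x y; apply: (can_inj nuK); rewrite raddfB !nuK'.
pose mu := GRing.isZmodMorphism.Build L' L nu' nu'D.
pose nua : {additive L' -> L} := HB.pack nu' mu.
exists nua; first by split.
split; first by exists nu.
move=> l; apply/seteqP; split=> [_ [y gy <-]|x gx].
  by apply: (graded_iso_inv giso); rewrite nuK'.
exists (phi x) => //=; last exact: iso_funK.
by rewrite -(nuK' l); apply: (graded_iso_in giso).
Qed.

Lemma isograded_sym : isograded_isomorphic g g' -> isograded_isomorphic g' g.
Proof.
move=> [phi [nu giso]]; have [nu' _ giso'] := graded_iso_sym giso.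
by exists (iso_sym phi), nu'.
Qed.

End IsogradedSym.

Section IsogradedTrans.
Variables (k : fieldType) (L L' : zmodType) (B B' : naAlgType k).
Variables (g : grading L B) (g' : grading L' B').

Lemma centroid_comp_scalar (a : k) : centroid_comp g 0 (fun x => a *: x).
Proof.
split; first exact: centroid_scalar.
by move=> l _ [x gx <-]; rewrite add0r; apply: gcompZ.
Qed.

Lemma graded_centralP : graded_central g <->
  forall c, centroid_comp g 0 c -> exists a : k, forall x, c x = a *: x.
Proof.
split=> [h c|h]; first by rewrite h => -[a _ <-]; exists a.
apply/seteqP; split=> [c /h[a ca]|_ [a _ <-]]; last exact: centroid_comp_scalar.
by exists a => //; apply/funext => x; rewrite ca.
Qed.

Lemma centralP : central_alg B <->
  forall c : B -> B, centroid c -> exists a : k, forall x, c x = a *: x.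
Proof.
split=> [h c|h]; first by rewrite h => -[a _ <-]; exists a.
apply/seteqP; split=> [c /h[a ca]|_ [a _ <-]]; last exact: centroid_scalar.
by exists a => //; apply/funext => x; rewrite ca.
Qed.

Lemma graded_iso_centroid_support phi nu l : graded_iso g g' phi nu ->
  centroid_support g l -> centroid_support g' (nu l).
Proof.
move=> giso /centroid_supportP[c hc [x cx]]; apply/centroid_supportP.
exists (phi \o c \o iso_inv phi); first exact: (centroid_comp_conj giso).
by exists (phi x); rewrite /= iso_funK -(linear0 phi) => /iso_inj.
Qed.

End IsogradedTrans.

Section CentroidHom.
Variables (k : fieldType) (L : zmodType) (B : naAlgType k) (g : grading L B).

Lemma centroid_hom (c : {linear B -> B}) :
  (forall l l' x y, g l x -> g l' y ->
     c (x ** y) = x ** c y /\ c (x ** y) = c x ** y) -> centroid c.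
Proof.
move=> hc; apply/centroidP.
suff h x y : c (x ** y) = x ** c y /\ c (x ** y) = c x ** y.
  by split=> [a x y|x y|x y]; [exact: linearP|case: (h x y)|case: (h x y)].
elim/(gind (g := g)): x => [|x x' [h1 h2] [h1' h2']|l x gx].
- by rewrite !(namul0l, linear0).
- by rewrite !(namulDl, linearD) /= -h1 -h2 -h1' -h2'.
elim/(gind (g := g)): y => [|y y' [h1 h2] [h1' h2']|l' y gy].
- by rewrite !(namul0r, linear0).
- by rewrite !(namulDr, linearD) /= -h1 -h2 -h1' -h2'.
exact: hc gx gy.
Qed.

End CentroidHom.

Section IsogradedTransport.
Variables (k : fieldType) (L L' : zmodType) (B B' : naAlgType k).
Variables (g : grading L B) (g' : grading L' B').

Lemma graded_iso_centroid_supportE phi nu l : graded_iso g g' phi nu ->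
  centroid_support g' (nu l) <-> centroid_support g l.
Proof.
move=> giso; split; last exact: (graded_iso_centroid_support giso).
have [nu' [nuK nuK'] giso'] := graded_iso_sym giso.
by move=> /(graded_iso_centroid_support giso'); rewrite nuK.
Qed.

Lemma graded_central_simple_iso : isograded_isomorphic g g' ->
  graded_central_simple g -> graded_central_simple g'.
Proof.
move=> [phi [nu giso]] [gc gs]; have [nu' _ giso'] := graded_iso_sym giso.
have [nui nuK nuK'] := giso.1.
split.
  apply/graded_centralP => c hc.
  have := centroid_comp_conj giso' hc; rewrite raddf0.
  move=> /(graded_centralP g).1 -/(_ gc)[a ha]; exists a => x.
  have /= := ha (iso_inv phi x); rewrite iso_invK.
  by move=> /(congr1 phi); rewrite linearZ /= !iso_invK.
have [[x [y xy]] hI] := gs; split.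
  by exists (phi x), (phi y); rewrite -iso_mul -(linear0 phi) => /iso_inj.
move=> I' gI'; have idI' := gI'.1; pose I := phi @^-1` I'.
have idI : ideal I.
  split=> [|u v Iu]; last first.
    by rewrite /I /= !iso_mul; apply: idI'.2.
  split=> [|a u v]; rewrite !inE /I /=; first by rewrite linear0; apply: ideal0.
  by move=> Iu Iv; rewrite linearP; apply: idealP.
have gI : graded_ideal g I.
  apply: graded_idealI => // l u Iu; rewrite /I /=.
  suff <- : gproj g' (nu l) (phi u) = phi (gproj g l u).
    exact: graded_ideal_proj.
  have [s us [s0 uE]] := gproj_supp g u.
  rewrite {1}uE linear_sum linear_sum /=.
  have gphi i : g' (nu i) (phi (gproj g i u)).
    by apply: (graded_iso_in giso); apply: gproj_in.
  have [ls|ls] := boolP (l \in s).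
    rewrite (bigD1_seq l) //= gproj_id ?big1 ?addr0 // => i il.
    apply: gproj_other (gphi i) _; rewrite eq_sym.
    by apply: contraNneq il => /(can_inj nuK) ->.
  rewrite s0 // linear0 big_seq big1 // => i si.
  apply: gproj_other (gphi i) _.
  by apply: contraNneq ls => /(can_inj nuK) ->.
have [I0|IT] := hI I gI; [left|right]; apply/seteqP; split=> // u.
- move=> Iu; have : I (iso_inv phi u) by rewrite /I /= iso_invK.
  by rewrite I0 /= => /(congr1 phi); rewrite iso_invK linear0.
- by move=> ->; apply: ideal0.
- by move=> _; have : I (iso_inv phi u) by [rewrite IT]; rewrite /I /= iso_invK.
Qed.

End IsogradedTransport.

(** * Simultaneous eigenspaces of commuting periodic automorphisms *)

Section RootsOfUnity.
Variables (k : fieldType) (zeta : compatible_roots k).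

Lemma root_neq0 (M : nat) : (0 < M)%N -> zeta M != 0.
Proof.
move=> M0; apply/eqP => z0; have := prim_expr_order (root_of_prim zeta M0).
by rewrite z0 expr0n eqn0Ngt M0 => /eqP; rewrite eq_sym oner_eq0.
Qed.

Lemma root_expz_eq1 (M : nat) (t : int) : (0 < M)%N ->
  (zeta M ^ t == 1) = (M %| t)%Z.
Proof.
move=> M0; have z0 := root_neq0 M0; have zM := root_of_prim zeta M0.
rewrite dvdzE /=; case: t => p; first by rewrite (prim_order_dvd zM).
by rewrite NegzE abszN (prim_order_dvd zM) -exprz_inv -exprnP exprVn invr_eq1.
Qed.

Lemma root_expz_eq (M : nat) (t u : int) : (0 < M)%N ->
  (zeta M ^ t == zeta M ^ u) = (M %| t - u)%Z.
Proof.
move=> M0; have z0 := root_neq0 M0.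
rewrite -root_expz_eq1 // expfzDr // -invr_expz; apply/eqP/eqP => [->|/divr1_eq//].
by rewrite divff // expfz_neq0.
Qed.

(** Both sides are the same power of the root of order M M'; this is the use made of the
    compatibility of the roots. *)
Lemma root_expz_ratio (M M' : nat) (a b : int) : (0 < M)%N -> (0 < M')%N ->
  a * M' = b * M -> zeta M ^ a = zeta M' ^ b.
Proof.
move=> M0 M'0 ab; have := root_of_compat zeta M0 M'0.
have := root_of_compat zeta M'0 M0.
rewrite mulnC => <- <-; rewrite !exprnP !exprz_exp mulrC ab mulrC //.
Qed.

End RootsOfUnity.

Section Eigen.
Variables (k : fieldType) (char0 : [pchar k] =i pred0) (zeta : compatible_roots k).
Variables (n : nat) (A : naAlgType k) (m : 'I_n -> nat).
Hypothesis m_gt0 : forall i, (0 < m i)%N.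
Variable sg : 'I_n -> alg_iso A A.
Hypothesis per : commuting_periods m sg.
Implicit Types (i j : 'I_n) (t : int) (u v : A) (l : 'rV[int]_n).

(** The averaging projector onto the eigenspace of [sg i] for the eigenvalue zeta^t, attached to a
    character of the cyclic group of order [m i]. It is a projector because [m i] is invertible in
    characteristic 0. *)
Definition eigenproj1 i t u : A :=
  (m i)%:R^-1 *: \sum_(a < m i) zeta (m i) ^ (- (t * a)) *: iter a (sg i) u.

Fact eigenproj1_linear i t : linear (eigenproj1 i t).
Proof.
move=> b u v; rewrite /eigenproj1 scalerA mulrC -scalerA -scalerDr; congr (_ *: _).
rewrite scaler_sumr -big_split; apply: eq_bigr => a _ /=.
by rewrite iter_linear scalerDr !scalerA [b * _]mulrC.
Qed.

HB.instance Definition _ i t :=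
  GRing.isLinear.Build k A A _ (eigenproj1 i t) (eigenproj1_linear i t).

Lemma eigenproj1_comm i t j u : sg j (eigenproj1 i t u) = eigenproj1 i t (sg j u).
Proof.
rewrite linearZ linear_sum; congr (_ *: _); apply: eq_bigr => a _.
rewrite linearZ /=; congr (_ *: _); elim: (a : nat) => //= b <-.
exact: per.1.
Qed.

Lemma m_unit i : (m i)%:R != 0 :> k.
Proof. by have /pcharf0P -> := char0; rewrite -lt0n. Qed.

(** Applying [sg i] shifts the sum by one place; the last term wraps around to the first because
    both [sg i] and the root of unity have period [m i]. *)
Lemma eigenproj1_eigen i t u :
  sg i (eigenproj1 i t u) = zeta (m i) ^ t *: eigenproj1 i t u.
Proof.
rewrite linearZ scalerA mulrC -scalerA; congr (_ *: _).
rewrite linear_sum scaler_sumr; have := m_gt0 i; have := per.2 i.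
have := root_of_prim zeta (m_gt0 i); have := root_neq0 zeta (m_gt0 i).
case: (m i) => // M z0 zM perM _; rewrite big_ord_recr big_ord_recl /= addrC.
congr (_ + _).
  rewrite linearZ /= -iterS perM mulr0 oppr0 expr0z scale1r; congr (_ *: _).
  rewrite (_ : - (t * M) = t - t * M.+1); last first.
    by rewrite -addn1 PoszD mulrDr mulr1 opprD addrCA subrr addr0.
  have -> : - (t * M.+1) = (M.+1)%:Z * - t by rewrite mulrN mulrC.
  by rewrite expfzDr // -exprz_exp -exprnP prim_expr_order // exp1rz mulr1.
apply: eq_bigr => a _; rewrite linearZ /= scalerA /bump /= -expfzDr //.
by rewrite PoszD mulrDr mulr1 opprD addNKr.
Qed.

(** On an eigenvector the average becomes a geometric sum in w = zeta^(t' - t), which is [m i] if w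
    = 1 and 0 otherwise, as w^(m i) = 1. *)
Lemma eigenproj1_on_eigen i t t' v : sg i v = zeta (m i) ^ t' *: v ->
  eigenproj1 i t v = if (m i %| t' - t)%Z then v else 0.
Proof.
move=> vE; have z0 := root_neq0 zeta (m_gt0 i).
have iterE a : iter a (sg i) v = zeta (m i) ^ (t' * a) *: v.
  elim: a => [|a IH]; first by rewrite mulr0 expr0z scale1r.
  by rewrite iterS IH linearZ /= vE scalerA -expfzDr // -addn1 PoszD mulrDr mulr1.
rewrite /eigenproj1; set w := zeta (m i) ^ (t' - t).
have -> : \sum_(a < m i) zeta (m i) ^ (- (t * a)) *: iter a (sg i) v =
    (\sum_(a < m i) w ^+ a) *: v.
  rewrite scaler_suml; apply: eq_bigr => a _.
  by rewrite iterE scalerA -expfzDr // addrC -mulNr -mulrDl -exprz_exp.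
rewrite -(root_expz_eq1 zeta _ (m_gt0 i)) -/w scalerA; case: eqP => [->|/eqP w1].
  rewrite (eq_bigr (fun=> 1)) => [|a _]; last by rewrite expr1n.
  by rewrite sumr_const card_ord mulVf ?scale1r // m_unit.
have : (w - 1) * (\sum_(a < m i) w ^+ a) = 0.
  rewrite -subrX1 /w exprnP exprzAC -exprnP prim_expr_order ?exp1rz ?subrr //.
  exact: root_of_prim.
by move=> /eqP; rewrite mulf_eq0 subr_eq0 (negbTE w1) => /eqP ->; rewrite mulr0 scale0r.
Qed.

(** After exchanging the sums, the geometric sum over [t] kills every power of [sg i] except the
    power 0. *)
Lemma eigenproj1_sum i u : u = \sum_(t < m i) eigenproj1 i t u.
Proof.
have z0 := root_neq0 zeta (m_gt0 i).
rewrite /eigenproj1 -scaler_sumr exchange_big /=.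
rewrite (bigD1 (Ordinal (m_gt0 i))) //= [X in _ + X]big1 => [|a a0].
  rewrite (eq_bigr (fun=> u)) => [|t _]; last by rewrite mulr0 expr0z scale1r.
  by rewrite sumr_const card_ord addr0 -[u *+ _]scaler_nat scalerA mulVf ?scale1r ?m_unit.
rewrite -scaler_suml; set w := zeta (m i) ^ (- (a : nat)%:Z).
have -> : \sum_(t < m i) zeta (m i) ^ (- ((t : nat)%:Z * (a : nat)%:Z)) =
    \sum_(t < m i) w ^+ t.
  by apply: eq_bigr => t _; rewrite -mulrN mulrC -exprz_exp.
have w1 : w != 1.
  rewrite root_expz_eq1 // dvdzE /= abszN absz_nat.
  by apply: contraNN a0 => /dvdnP[[|q] aE]; apply/eqP/val_inj => //=;
    have := ltn_ord a; rewrite aE mulSn ltnNge leq_addr.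
have : (w - 1) * (\sum_(a < m i) w ^+ a) = 0.
  rewrite -subrX1 /w exprnP exprzAC -exprnP prim_expr_order ?exp1rz ?subrr //.
  exact: root_of_prim.
by move=> /eqP; rewrite mulf_eq0 subr_eq0 (negbTE w1) => /eqP ->; rewrite scale0r.
Qed.

(** Equality of the images in the finite group grading [A]; [cong m d 0] says that [d] lies in the
    lattice diag(m) Z^n. *)
Definition cong l l' : bool := [forall i, (m i %| l 0%R i - l' 0%R i)%Z].

Lemma congP l l' : reflect (forall i, (m i %| l 0%R i - l' 0%R i)%Z) (cong l l').
Proof. exact: forallP. Qed.

Lemma cong_refl l : cong l l.
Proof. by apply/congP => i; rewrite subrr dvdz0. Qed.

Lemma cong_sym l l' : cong l l' = cong l' l.
Proof. by apply/congP/congP => h i; rewrite -opprB rpredN; apply: h. Qed.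

Lemma cong_trans l l' l'' : cong l l' -> cong l' l'' -> cong l l''.
Proof.
move=> /congP h /congP h'; apply/congP => i.
by rewrite -[l 0 i](subrK (l' 0 i)) -addrA rpredD.
Qed.

Lemma congB l l' : cong l l' = cong (l - l') 0.
Proof. by apply: eq_forallb => i; rewrite !mxE subr0. Qed.

Lemma eigencomp_cong l l' u : cong l l' ->
  u \in eigencomp zeta m sg l -> u \in eigencomp zeta m sg l'.
Proof.
move=> /congP h /eigencompP hu; apply/eigencompP => j; rewrite hu.
by congr (_ *: _); apply/eqP; rewrite root_expz_eq.
Qed.

(** The composite of the commuting projectors of the single automorphisms, folded over the list of
    indices so that its properties follow by induction on that list. *)
Definition eigenproj l u : A :=
  foldr (fun i => eigenproj1 i (l 0 i)) u (enum 'I_n).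

Fact eigenproj_linear l : linear (eigenproj l).
Proof. by move=> b u v; rewrite /eigenproj; elim: (enum 'I_n) => //= i s ->; rewrite linearP. Qed.

HB.instance Definition _ l :=
  GRing.isLinear.Build k A A _ (eigenproj l) (eigenproj_linear l).

Lemma eigenproj_in l u : eigenproj l u \in eigencomp zeta m sg l.
Proof.
apply/eigencompP => j; have : j \in enum 'I_n by rewrite mem_enum.
rewrite /eigenproj; elim: (enum 'I_n) => //= i s IH; rewrite inE => /predU1P[->|/IH js].
  exact: eigenproj1_eigen.
by rewrite eigenproj1_comm js linearZ.
Qed.

Lemma eigenproj_on_eigen l l' v : v \in eigencomp zeta m sg l' ->
  eigenproj l v = if cong l' l then v else 0.
Proof.
move=> /eigencompP hv; rewrite /eigenproj /cong.
have -> : [forall i, (m i %| l' 0%R i - l 0%R i)%Z] =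
    all (fun i => (m i %| l' 0%R i - l 0%R i)%Z) (enum 'I_n).
  by apply/forallP/allP => [h i _|h i]; last apply: h; rewrite ?mem_enum.
elim: (enum 'I_n) => //= i s ->; case: (all _ s); rewrite ?andbT ?andbF ?linear0 //.
exact: eigenproj1_on_eigen.
Qed.

Lemma eigenproj_id l v : v \in eigencomp zeta m sg l -> eigenproj l v = v.
Proof. by move/eigenproj_on_eigen->; rewrite cong_refl. Qed.

Lemma eigen_ind (P : A -> Prop) : P 0 -> (forall u v, P u -> P v -> P (u + v)) ->
  (forall l u, u \in eigencomp zeta m sg l -> P u) -> forall u, P u.
Proof.
move=> P0 PD Ph.
(* The list [s] holds the automorphisms for which [u] need not be an eigenvector yet. Splitting [u]
   by [eigenproj1_sum] removes one of them and keeps the eigenvalues already obtained, because the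
   projectors commute with the other automorphisms. *)
suff : forall (s : seq 'I_n) u, (forall j, j \notin s ->
    exists t : int, sg j u = zeta (m j) ^ t *: u) -> P u.
  by move=> h u; apply: (h (enum 'I_n)) => j; rewrite mem_enum.
elim=> [|i s IH] u hu.
  pose t j := projT1 (cid (hu j isT)).
  apply: (Ph (\row_j t j)); apply/eigencompP => j; rewrite mxE /t.
  by case: cid.
rewrite (eigenproj1_sum i u); elim/big_ind: _ => // t _; apply: IH => j js.
have [->|ji] := eqVneq j i; first by exists t; exact: eigenproj1_eigen.
have [|t' ut'] := hu j; first by rewrite inE negb_or ji.
by exists t'; rewrite eigenproj1_comm ut' linearZ.
Qed.

(** One representative of each class modulo [m]. *)
Definition box : seq 'rV[int]_n :=
  [seq \row_i (f i : nat)%:Z |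
    f : {dffun forall i : 'I_n, 'I_(m i)} <- enum {dffun forall i : 'I_n, 'I_(m i)}].

Lemma boxP l : reflect (forall i, 0 <= l 0 i < m i) (l \in box).
Proof.
apply: (iffP mapP) => [[f _ ->] i|h]; first by rewrite mxE ltz_nat ltn_ord.
have hl i : (`|l 0%R i| < m i)%N by have /andP[p q] := h i; rewrite -ltz_nat gez0_abs.
exists (finfun (fun i => Ordinal (hl i)) : {dffun forall i, 'I_(m i)}).
  by rewrite mem_enum.
apply/rowP => i; rewrite mxE ffunE /=.
by have /andP[p q] := h i; rewrite gez0_abs.
Qed.

Lemma box_uniq : uniq box.
Proof.
rewrite map_inj_uniq ?enum_uniq // => f f' /rowP ff'; apply/ffunP => i.
by apply: val_inj; have := ff' i; rewrite !mxE => -[].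
Qed.

Definition rmod l : 'rV[int]_n := \row_i (l 0%R i %% m i)%Z.

Lemma rmod_box l : rmod l \in box.
Proof. by apply/boxP => i; rewrite mxE modz_ge0 ?ltz_pmod ?ltz_nat ?eqz_nat -?lt0n. Qed.

Lemma rmod_cong l : cong l (rmod l).
Proof. by apply/congP => i; rewrite mxE {1}(divz_eq (l 0 i) (m i)) addrK dvdz_mull. Qed.

Lemma cong_rmod l l' : cong l l' = (rmod l == rmod l').
Proof.
apply/congP/eqP => [h|/rowP h i].
  by apply/rowP => i; rewrite !mxE; apply/eqP; rewrite eqz_mod_dvd.
by have := h i; rewrite !mxE => /eqP; rewrite eqz_mod_dvd.
Qed.

Lemma rmod_id l : l \in box -> rmod l = l.
Proof. by move=> /boxP h; apply/rowP => i; rewrite mxE modz_small. Qed.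

Lemma cong_subr l l' d : cong (l - d) l' = cong l (l' + d).
Proof. by apply: eq_forallb => i; rewrite !mxE opprD addrAC addrA. Qed.

(** Any translate of the box again represents each class exactly once, so exactly one projector
    fixes a given eigenvector and the others kill it. *)
Lemma eigenproj_sum l u : u = \sum_(b <- box) eigenproj (b + l) u.
Proof.
elim/eigen_ind: u => [|u v hu hv|p u hu].
- by rewrite big1 // => b _; rewrite linear0.
- rewrite {1}hu {1}hv -big_split; apply: eq_bigr => b _.
  by rewrite linearD.
rewrite (bigD1_seq (rmod (p - l))) ?box_uniq ?rmod_box //= big_seq_cond big1.
  by rewrite (eigenproj_on_eigen _ hu) addr0 -cong_subr rmod_cong.
move=> b /andP[bb bp]; rewrite (eigenproj_on_eigen _ hu) ifN //.
by apply: contraNN bp; rewrite -cong_subr cong_rmod (rmod_id bb) eq_sym.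
Qed.

End Eigen.

(** * Multiloop algebras of central-simple algebras *)

Section Multiloop.
Variables (k : fieldType) (char0 : [pchar k] =i pred0) (zeta : compatible_roots k).
Variables (n : nat) (A : naAlgType k) (m : 'I_n -> nat).
Hypothesis m_gt0 : forall i, (0 < m i)%N.
Variable sg : 'I_n -> alg_iso A A.
Hypothesis per : commuting_periods m sg.
Implicit Types (u v : A) (l : 'rV[int]_n).

Local Notation M := (multiloop zeta sg m_gt0).
Local Notation gM := (multiloop_grading zeta m_gt0 sg).
Local Notation pr := (eigenproj zeta m sg).
Local Notation eigen := (eigencomp zeta m sg).
Local Notation cong := (cong m).
Local Notation box := (box m).
Implicit Types (f h : M).

Definition mcoef l (f : M) : A := (multiloop_val f)@_l.

Fact mcoef_linear l : linear (mcoef l).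
Proof. by move=> a f h; rewrite /mcoef /= mcoeffD laurentZE. Qed.

HB.instance Definition _ l := GRing.isLinear.Build k M A _ (mcoef l) (mcoef_linear l).

(** The substitution z_i = 1. It is injective on each homogeneous component, though not on [M]. *)
Definition ev : M -> A := gext gM (fun l => mcoef l).

HB.instance Definition _ := GRing.Linear.on ev.

Fact mlift_subproof l u : << pr l u *g l >> \in multiloop_pred zeta m sg.
Proof.
apply/multiloopP => l'; rewrite mcoeffU; have [<-|_] := eqVneq l l'.
  exact: eigenproj_in.
by case: (eigencomp_submod zeta m sg l').
Qed.

(** The part of [u] in the class of [l], placed in degree [l]. On the component of degree [l] it is
    the inverse of [ev]. *)
Definition mlift l u : M := MultiloopSpace (mlift_subproof l u).

Lemma mcoef_mlift l l' u : mcoef l' (mlift l u) = pr l u *+ (l == l').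
Proof. by rewrite /mcoef /= mcoeffU. Qed.

Lemma mcoef_inj f h : (forall l, mcoef l f = mcoef l h) -> f = h.
Proof. by move=> fh; apply: val_inj; apply/malgP. Qed.

Fact mlift_linear l : linear (mlift l).
Proof.
move=> a u v; apply: mcoef_inj => l'; rewrite mcoef_linear !mcoef_mlift.
rewrite (eigenproj_linear zeta m sg l).
by case: eqP; rewrite ?mulr1n ?mulr0n // scaler0 addr0.
Qed.

HB.instance Definition _ l := GRing.isLinear.Build k A M _ (mlift l) (mlift_linear l).

Lemma mlift_in l u : gM l (mlift l u).
Proof. by exists (pr l u) => //; apply: eigenproj_in. Qed.

Lemma ev_hom l f : gM l f -> ev f = mcoef l f.
Proof. exact: gext_hom. Qed.

Lemma ev_in l f : gM l f -> ev f \in eigen l.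
Proof. by move=> gf; rewrite (ev_hom gf); apply: multiloop_coef. Qed.

Lemma ev_mlift l u : ev (mlift l u) = pr l u.
Proof. by rewrite (ev_hom (mlift_in l u)) /mcoef /= mcoeffU eqxx. Qed.

Lemma mlift_ev l f : gM l f -> mlift l (ev f) = f.
Proof.
move=> gf; apply: val_inj; apply/malgP => l' /=; rewrite (eigenproj_id _ _ (ev_in gf)) //.
rewrite (ev_hom gf) mcoeffU /mcoef; case: eqP => [->//|/eqP ll'].
by rewrite mulr0n; have /multiloop_compP/(_ l') -> := gf; rewrite // eq_sym.
Qed.

Lemma ev_mlift_ev l l' f : gM l f -> cong l l' -> ev (mlift l' (ev f)) = ev f.
Proof.
move=> gf c; rewrite ev_mlift; apply: eigenproj_id => //.
exact: eigencomp_cong c (ev_in gf).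
Qed.

Lemma mlift_ev_neq l l' f : gM l f -> ~~ cong l l' -> mlift l' (ev f) = 0.
Proof.
move=> gf c; apply: val_inj; apply/malgP => a /=.
by rewrite (eigenproj_on_eigen _ _ _ (ev_in gf)) // ifN // mcoeffU mcoeff0 mul0rn.
Qed.

Lemma ev_mul : {morph ev : f h / f ** h}.
Proof.
apply: (mul_hom (g := gM)) => l l' f h gf gh /=.
rewrite (ev_hom gf) (ev_hom gh) (ev_hom (gcomp_mul gf gh)) /mcoef.
rewrite [multiloop_val _]/(laurent_mul f h).
have [u _ fE] := gf.
rewrite (@laurent_mulwE _ _ _ [fset l]%fset); last by rewrite fE msuppU_le.
by rewrite big_seq_fset1 addrAC subrr add0r.
Qed.

Lemma alg_ind (P : A -> Prop) : P 0 -> (forall u v, P u -> P v -> P (u + v)) ->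
  (forall l f, gM l f -> P (ev f)) -> forall u, P u.
Proof.
move=> P0 PD Ph; apply: (eigen_ind char0 (zeta:=zeta) m_gt0 per (P:=P)) => // l u hu.
by rewrite -(eigenproj_id char0 m_gt0 hu) -ev_mlift; apply: (Ph l); apply: mlift_in.
Qed.

(** A linear section of [ev]: each class modulo [m] is placed in the degree of its representative in
    the box. It is not multiplicative. *)
Definition msec u : M := \sum_(b <- box) mlift b u.

Fact msec_linear : linear msec.
Proof.
by move=> a u v; rewrite /msec scaler_sumr -big_split; apply: eq_bigr => b _; rewrite linearP.
Qed.

HB.instance Definition _ := GRing.isLinear.Build k A M _ msec msec_linear.

Lemma msecK : cancel msec ev.
Proof.
move=> u; rewrite linear_sum [RHS](eigenproj_sum char0 zeta m_gt0 per 0).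
by apply: eq_bigr => b _; rewrite /= ev_mlift addr0.
Qed.

Lemma mlift_eq0 u l : (forall b, b \in box -> mlift (b + l) u = 0) -> u = 0.
Proof.
move=> h; rewrite (eigenproj_sum char0 zeta m_gt0 per l u) big_seq big1 // => b bb.
by rewrite -ev_mlift h // linear0.
Qed.

(** Multiplication by [ev h] moves every class by [p], so it matches multiplication by [h] in the
    multiloop algebra. Ideals and centroid elements pass between the two algebras through this
    identity and its right-handed version. *)
Lemma mlift_mull p l h u : gM p h -> mlift l (ev h ** u) = h ** mlift (l - p) u.
Proof.
move=> gh; elim/alg_ind: u => [|u v hu hv|q f gf].
- by rewrite namul0r !linear0 namul0r.
- by rewrite namulDr !linearD /= hu hv namulDr.
have ghf := gcomp_mul gh gf; rewrite -ev_mul.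
have [c|c] := boolP (cong (p + q) l); last first.
  rewrite (mlift_ev_neq ghf c) (mlift_ev_neq gf) ?namul0r //.
  by apply: contraNN c; rewrite cong_sym cong_subr addrC cong_sym.
have gh' : gM l (h ** mlift (l - p) (ev f)).
  by rewrite -[l](subrK p) addrC [p + _ - p]addrC addKr; apply: gcomp_mul (mlift_in _ _).
rewrite -(mlift_ev gh') !ev_mul (ev_mlift_ev gf) //.
by rewrite cong_sym cong_subr addrC cong_sym.
Qed.

Lemma mlift_mulr p l h u : gM p h -> mlift l (u ** ev h) = mlift (l - p) u ** h.
Proof.
move=> gh; elim/alg_ind: u => [|u v hu hv|q f gf].
- by rewrite namul0l !linear0 namul0l.
- by rewrite namulDl !linearD /= hu hv namulDl.
have ghf := gcomp_mul gf gh; rewrite -ev_mul.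
have [c|c] := boolP (cong (q + p) l); last first.
  rewrite (mlift_ev_neq ghf c) (mlift_ev_neq gf) ?namul0l //.
  by apply: contraNN c; rewrite cong_sym cong_subr cong_sym.
have gh' : gM l (mlift (l - p) (ev f) ** h).
  by rewrite -[X in gM X](subrK p); apply: gcomp_mul (mlift_in _ _) gh.
rewrite -(mlift_ev gh') !ev_mul (ev_mlift_ev gf) //.
by rewrite cong_sym cong_subr cong_sym.
Qed.

Lemma mlift_ev_mlift p l u : cong p l -> mlift l (ev (mlift p u)) = mlift l u.
Proof.
move=> c; elim/alg_ind: u => [|u v hu hv|q f gf]; first by rewrite !linear0.
  by rewrite !linearD /= hu hv.
have [c'|c'] := boolP (cong q p); first by rewrite (ev_mlift_ev gf).
rewrite (mlift_ev_neq gf c') !linear0 (mlift_ev_neq gf) //.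
by apply: contraNN c' => /cong_trans; apply; rewrite cong_sym.
Qed.

(** When [cong m d 0] holds, this is multiplication by the monomial z^d. *)
Definition mshift d : M -> M := gext gM (fun l => mlift (l + d) \o ev).

HB.instance Definition _ d := GRing.Linear.on (mshift d).

Lemma mshift_hom d l f : gM l f -> mshift d f = mlift (l + d) (ev f).
Proof. exact: gext_hom. Qed.

Lemma mshift_centroid d : cong d 0 -> centroid_comp gM d (mshift d).
Proof.
move=> c; split; last first.
  by move=> l _ [f gf <-]; rewrite (mshift_hom d gf) addrC; apply: mlift_in.
have cl l : cong l (l + d).
  by rewrite [l + d]addrC -cong_subr subrr cong_sym.
apply/(centroid_hom (g := gM)) => l l' f h gf gh /=.
rewrite (mshift_hom d (gcomp_mul gf gh)) ev_mul (mshift_hom d gf) (mshift_hom d gh).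
rewrite {1}(mlift_mull _ _ gf) (mlift_mulr _ _ gh).
have -> : l + l' + d - l = l' + d by rewrite -(addrA l) [_ - l]addrC addKr.
by have -> : l + l' + d - l' = l + d by rewrite addrAC addrK.
Qed.

Section CentralSimple.
Hypothesis csA : central_simple A.

Let annA : @annihilator k A `<=` [set 0].
Proof. exact: simple_annihilator csA.2. Qed.

(* u ** ev (c f) = ev (c (msec u)) ** ev f depends on f only through ev f. *)
Lemma centroid_descends (c : M -> M) : centroid c ->
  exists a : k, forall f, ev (c f) = a *: ev f.
Proof.
move=> /centroidP[lc cl cr]; pose c' u := ev (c (msec u)).
have c'E f : c' (ev f) = ev (c f).
  apply/eqP; rewrite -subr_eq0; apply/eqP/annA => u.
  split; apply/eqP; [rewrite namulBl|rewrite namulBr]; rewrite subr_eq0 /c' -(msecK u).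
    by rewrite -!ev_mul -!cr !cl !ev_mul msecK.
  by rewrite -!ev_mul -!cl !cr !ev_mul msecK.
suff : centroid c'.
  by move=> /(centralP A).1 -/(_ csA.1)[a ha]; exists a => f; rewrite -c'E ha.
apply/centroidP; split=> [a u v|u v|u v].
- by rewrite /c' linearP lc linearP.
- by rewrite -{1}(msecK u) -{1}(msecK v) -ev_mul c'E cl ev_mul msecK.
- by rewrite -{1}(msecK u) -{1}(msecK v) -ev_mul c'E cr ev_mul msecK.
Qed.

(** The generators are the lifts of a spanning family of [A] to the degrees of the box. An element
    of degree [l] is the image under the shift of degree [l - rmod m l] of an element whose degree
    is in the box. *)
Lemma finite_dimensional_fgc : finite_dimensional A -> fgc M.
Proof.
move=> [d [b hb]]; pose T : finType := ('I_(size box) * 'I_d)%type.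
pose gen (t : T) : M := mlift (nth 0 box t.1) (b t.2).
exists #|T|, (fun j : 'I_#|T| => gen (enum_val j)).
suff h (x : M) : exists2 c : T -> M -> M,
    (forall t : T, centroid (c t)) & x = \sum_(t : T) c t (gen t).
  move=> x; have [c hc ->] := h x; exists (fun j => c (enum_val j)) => //.
  by rewrite (reindex _ (onW_bij _ (enum_val_bij T))).
elim/(gind (g := gM)): x => [|x y [c hc ->] [c' hc' ->]|l f gf].
- exists (fun _ _ => 0); last by rewrite big1.
  by move=> t; have [] := centroid_comp0 gM 0.
- exists (fun (t : T) x => c t x + c' t x); last by rewrite big_split.
  move=> t; have /centroidP[lc cl cr] := hc t; have /centroidP[lc' cl' cr'] := hc' t.
  apply/centroidP; split=> [a u v|u v|u v].
  + by rewrite lc lc' scalerDr addrACA.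
  + by rewrite cl cl' namulDr.
  + by rewrite cr cr' namulDl.
have [a fE] := hb (ev f).
have ib : (index (rmod m l) box < size box)%N by rewrite index_mem rmod_box.
pose p0 := Ordinal ib; pose dl := l - rmod m l.
have cdl : cong dl 0 by rewrite -congB rmod_cong.
exists (fun t : T => if t.1 == p0 then (fun x => a t.2 *: x) \o mshift dl else fun=> 0).
  move=> t; case: eqP => _; last by have [] := centroid_comp0 gM 0.
  by apply: centroid_comp_fun; [apply: centroid_scalar|case: (mshift_centroid cdl)].
rewrite -(pair_bigA _ (fun p i => (if p == p0 then (fun x => a i *: x) \o mshift dl
  else fun=> 0) (mlift (nth 0 box p) (b i)))) /= (bigD1 p0) //= eqxx.
rewrite [X in _ + X]big1 ?addr0 => [|p /negbTE ->]; last by rewrite big1.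
rewrite nth_index ?rmod_box // -{1}(mlift_ev gf) fE linear_sum; apply: eq_bigr => i _.
rewrite linearZ /= (mshift_hom _ (mlift_in _ _)) addrC subrK mlift_ev_mlift //.
by rewrite cong_sym rmod_cong.
Qed.

(** Under [ev] the centroid acts by scalars, so centroid coefficients become scalar coefficients. *)
Lemma fgc_finite_dimensional : fgc M -> finite_dimensional A.
Proof.
move=> [d [b hb]]; exists d, (ev \o b) => u.
have [c hc uE] := hb (msec u).
exists (fun i : 'I_d => projT1 (cid (centroid_descends (hc i)))).
rewrite -{1}(msecK u) uE linear_sum; apply: eq_bigr => i _ /=.
by case: cid.
Qed.

Lemma multiloop_graded_simple : graded_simple gM.
Proof.
have [[x [y xy]] simpA] := csA.2; split.
  exists (msec x), (msec y) => h0; apply: xy.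
  by rewrite -(msecK x) -(msecK y) -ev_mul h0 linear0.
move=> I gI; have idI := gI.1.
have [->|/eqP/eqP I0] := pselect (I = [set 0]); first by left.
right; have [f If f0] := setP0 (ideal0 idI) I0.
have [l gf0] : exists l, gproj gM l f <> 0.
  apply: contrapT => hn; apply/f0/(gproj_eq0 (g := gM)) => l.
  by apply: contrapT => h; apply: hn; exists l.
have {}If := graded_ideal_proj l gI If; have gf := gproj_in gM l f.
set f1 := gproj gM l f in gf0 If gf.
(* [J] is an ideal of [A] that contains all products with [ev f1]. Were it zero, [ev f1] would
   annihilate [A], against [f1 <> 0]; hence it is all of [A], and every homogeneous element is the
   lift of an element of [J]. *)
pose J : set A := [set u | forall p, I (mlift p u)].
have idJ : ideal J.
  split=> [|u v Ju].
    split=> [|a u v]; rewrite !inE; first by move=> p; rewrite linear0; apply: ideal0.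
    by move=> Ju Jv p; rewrite linearP; apply: (idealP idI); [apply: Ju|apply: Jv].
  suff h w p : I (mlift p (u ** w)) /\ I (mlift p (w ** u)).
    by split=> p; case: (h v p).
  elim/alg_ind: w => [|w w' [h1 h2] [h1' h2']|q h gh].
  - by rewrite namul0l namul0r linear0; split; apply: ideal0.
  - by rewrite namulDl namulDr !linearD; split; apply: idealD.
  - rewrite (mlift_mull _ _ gh) (mlift_mulr _ _ gh).
    by split; [apply: idealMr|apply: idealMl].
have f1J u p : I (mlift p (u ** ev f1)) /\ I (mlift p (ev f1 ** u)).
  rewrite (mlift_mull _ _ gf) (mlift_mulr _ _ gf).
  by split; [apply: idealMl|apply: idealMr].
have [J0|JT] := simpA J idJ.
  exfalso; apply: gf0; rewrite -(mlift_ev gf).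
  suff -> : ev f1 = 0 by rewrite linear0.
  apply: annA => u; have JE v : J v -> v = 0 by rewrite J0.
  by split; apply: JE => p; case: (f1J u p).
apply/seteqP; split=> // z _; elim/(gind (g := gM)): z => [|z z1|p h gh].
- exact: ideal0.
- exact: idealD.
- by rewrite -(mlift_ev gh); have : J (ev h) by [rewrite JT]; apply.
Qed.

Lemma multiloop_centroid_comp d c : centroid_comp gM d c ->
  exists a : k, forall l f, gM l f -> c f = a *: mlift (d + l) (ev f).
Proof.
move=> [cc hc]; have [a ha] := centroid_descends cc; exists a => l f gf.
have gcf : gM (d + l) (c f) by apply: hc; exists f.
by rewrite -(mlift_ev gcf) ha linearZ.
Qed.

Lemma multiloop_graded_central_simple : graded_central_simple gM.
Proof.
split; last exact: multiloop_graded_simple.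
apply/graded_centralP => c hc; have [a ha] := multiloop_centroid_comp hc.
have [/centroidP[lc _ _] _] := hc; exists a; apply: (gind (g := gM)) => [|x y hx hy|l f gf].
- by rewrite lin_0 // scaler0.
- by rewrite lin_D // hx hy scalerDr.
- by rewrite (ha l) // add0r (mlift_ev gf).
Qed.

(** On degree [l], a centroid element of degree [d] is a multiple of the lift to degree [d + l],
    which vanishes unless [l] and [d + l] are in the same class. Conversely the shift of degree [d]
    is nonzero. *)
Lemma multiloop_centroid_support d : centroid_support gM d <-> cong d 0.
Proof.
split=> [/centroid_supportP[c hc [x cx]]|cd0].
  have [a ha] := multiloop_centroid_comp hc.
  apply: contrapT => /negP nd; apply: cx; elim/(gind (g := gM)): x => [|x y hx hy|l f gf].
  - by case: hc => /centroidP[lc _ _] _; apply: lin_0.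
  - by case: hc => /centroidP[lc _ _] _; rewrite lin_D // hx hy addr0.
  by rewrite (ha l) // (mlift_ev_neq gf) ?scaler0 // -cong_subr subrr cong_sym.
apply/centroid_supportP; exists (mshift d); first exact: mshift_centroid.
have [[x [y xy]] _] := csA.2.
have [b b0] : exists b, mlift b x <> 0.
  apply: contrapT => hn; apply: xy; suff -> : x = 0 by rewrite namul0l.
  apply: (@mlift_eq0 _ 0) => b _; apply: contrapT => h; apply: hn.
  by exists (b + 0).
exists (mlift b x); rewrite (mshift_hom _ (mlift_in _ _)) => /(congr1 ev).
rewrite (ev_mlift_ev (mlift_in _ _)) ?linear0 => [h|].
  by apply: b0; rewrite -(mlift_ev (mlift_in b x)) h linear0.
by rewrite [b + d]addrC -cong_subr subrr cong_sym.
Qed.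

End CentralSimple.
End Multiloop.

(** * Simplicity and centrality of the algebra being looped *)

Lemma linear_pack (k : fieldType) (V W : lmodType k) (c : V -> W) :
  linear c -> exists c' : {linear V -> W}, c = c'.
Proof.
move=> lc; pose mx := GRing.isLinear.Build k V W *:%R c lc.
by pose c' : {linear V -> W} := HB.pack c mx; exists c'.
Qed.

Lemma gcomp_proj (k : fieldType) (L : zmodType) (B : naAlgType k) (g : grading L B) l x :
  (forall p, p != l -> gproj g p x = 0) -> g l x.
Proof.
move=> h; suff -> : x = gproj g l x by apply: gproj_in.
apply: (gproj_inj (g := g)) => p; have gx := gproj_in g l x.
have [->|pl] := eqVneq p l; first by rewrite (gproj_id gx).
by rewrite (gproj_other gx pl) h.
Qed.

Section Converse.
Variables (k : fieldType) (char0 : [pchar k] =i pred0) (zeta : compatible_roots k).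
Variables (n : nat) (A : naAlgType k) (m : 'I_n -> nat).
Hypothesis m_gt0 : forall i, (0 < m i)%N.
Variable sg : 'I_n -> alg_iso A A.
Hypothesis per : commuting_periods m sg.
Implicit Types (u v w : A) (l : 'rV[int]_n).

Local Notation M := (multiloop zeta sg m_gt0).
Local Notation gM := (multiloop_grading zeta m_gt0 sg).
Local Notation cong := (cong m).
Local Notation box := (box m).
Local Notation mlift := (mlift zeta m_gt0 per).
Local Notation ev := (@ev k zeta n A m m_gt0 sg).
Implicit Types (f h : M).

Hypothesis gcsM : graded_central_simple gM.
Hypothesis suppM : forall d, centroid_support gM d -> cong d 0.

Lemma rmod0 : rmod m 0 = 0.
Proof. by apply/rowP => i; rewrite !mxE mod0z. Qed.

Lemma box_cong0 b : b \in box -> cong b 0 -> b = 0.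
Proof. by move=> bb; rewrite cong_rmod (rmod_id bb) rmod0 => /eqP. Qed.

Lemma box0 : 0 \in box.
Proof. by rewrite -rmod0 rmod_box. Qed.

Lemma ev_mlift_sum l u : u = \sum_(b <- box) ev (mlift (b + l) u).
Proof.
rewrite {1}(eigenproj_sum char0 zeta m_gt0 per l u); apply: eq_bigr => b _.
by rewrite ev_mlift.
Qed.

(** Degree by degree this keeps the part of [c] that moves classes by [d], so a centroid element of
    [A] is cut into homogeneous centroid elements of [M]. *)
Lemma centroid_comp_multiloop (c : {linear A -> A}) d : centroid c ->
  centroid_comp gM d (gext gM (fun l => mlift (l + d) \o c \o ev)).
Proof.
move=> /centroidP[lc cl cr].
have cE l f : gM l f -> gext gM (fun l => mlift (l + d) \o c \o ev) f
  = mlift (l + d) (c (ev f)) by apply: gext_hom.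
split; last first.
  by move=> l _ [f gf <-]; rewrite (cE _ _ gf) addrC; apply: mlift_in.
apply/(centroid_hom (g := gM)) => l l' f h gf gh /=.
rewrite (cE _ _ (gcomp_mul gf gh)) ev_mul (cE _ _ gf) (cE _ _ gh).
rewrite {1}cl cr (mlift_mull char0 per _ _ gf) (mlift_mulr char0 per _ _ gh).
have -> : l + l' + d - l = l' + d by rewrite -(addrA l) [_ - l]addrC addKr.
by have -> : l + l' + d - l' = l + d by rewrite addrAC addrK.
Qed.

(** The part of degree 0 is a scalar by graded centrality, and the part of degree [b], for a nonzero
    [b] in the box, vanishes because [b] lies outside the centroid support. *)
Lemma multiloop_central : central_alg A.
Proof.
apply/centralP => c hc; have [lc _] := hc; have [c' cE] := linear_pack lc.
rewrite {}cE {c lc} in hc *.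
have [a ha] := (graded_centralP gM).1 gcsM.1 _ (centroid_comp_multiloop 0 hc).
exists a; elim/(alg_ind char0 (zeta := zeta) (m_gt0 := m_gt0) per) => [|u v hu hv|l f gf].
- by rewrite linear0 scaler0.
- by rewrite linearD /= hu hv scalerDr.
rewrite (ev_mlift_sum l (c' (ev f))) (bigD1_seq 0) ?box0 ?box_uniq //=.
rewrite big_seq_cond big1 => [|b /andP[bb b0]].
  have := congr1 ev (ha f); rewrite (gext_hom _ gf) /= addr0 linearZ /= => <-.
  by rewrite addr0 add0r.
suff h0 : gext gM (fun l => mlift (l + b) \o c' \o ev) f = 0.
  by rewrite addrC -[mlift _ _](gext_hom (fun l => mlift (l + b) \o c' \o ev) gf) h0 linear0.
apply: contrapT => h0; have /negP := b0; apply; apply/eqP/(box_cong0 bb)/suppM.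
apply/centroid_supportP; exists (gext gM (fun l => mlift (l + b) \o c' \o ev)).
  exact: centroid_comp_multiloop.
by exists f.
Qed.

Section Ideal.
(* x0 is an element of J with the fewest homogeneous components: minN also
   ranges over the translates box + t of the set of representatives, which
   spares a proof that the number of components does not depend on t. *)
Variables (J : set A) (x0 : A) (t0 b0 : 'rV[int]_n).
Hypotheses (idJ : ideal J) (Jx0 : J x0) (b0box : b0 \in box).

Let N t u := count (fun b => mlift (b + t) u != 0) box.

Hypothesis minN : forall t u, J u -> u <> 0 -> (N t0 x0 <= N t u)%N.

Let r0 := b0 + t0.

Hypothesis r0x0 : mlift r0 x0 <> 0.

(** The components of [u] lie in the translate by [s] of the support of [x0]. *)
Definition supported s u : Prop :=
  forall p, mlift p x0 = 0 -> mlift (p + s) u = 0.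

(** If [u] also misses one degree of the translated support, it has strictly fewer components than
    [x0], and minimality leaves only 0. *)
Lemma supported_eq0 b s u : b \in box -> J u -> supported s u ->
  mlift (b + t0) x0 <> 0 -> mlift (b + t0 + s) u = 0 -> u = 0.
Proof.
move=> bb Ju su bx bu; apply: contrapT => u0.
have := minN (t0 + s) Ju u0; apply/negP; rewrite -ltnNge /N.
have cb : count (pred1 b) box = 1%N by rewrite count_uniq_mem ?box_uniq // bb.
rewrite -addn1 -[X in (_ + X <= _)%N]cb -count_predUI.
rewrite [X in (_ + X)%N](_ : _ = 0%N) ?addn0; last first.
  rewrite (@eq_count _ _ pred0) ?count_pred0 // => b' /=.
  by case: (b' =P b) => [->|_]; rewrite ?andbF // addrA bu eqxx.
apply: sub_count => b' /= /orP[|/eqP ->]; last exact/eqP.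
by apply: contraNN => /eqP/su h; rewrite addrA; apply/eqP.
Qed.

Section Step.
Variable b1 : 'rV[int]_n.
Let r1 := b1 + t0.
Hypothesis r1x0 : mlift r1 x0 <> 0.
Let d := r1 - r0.

(* The graph of a centroid element of degree d = r1 - r0: it sends the component
   of degree l of an element u of J, supported on the translate by l - r0 of the
   support of x0, to the component of u of degree l + d. *)
Definition step_rel f h : Prop := forall l, exists u,
  [/\ J u, supported (l - r0) u, mlift l u = gproj gM l f
    & mlift (l + d) u = gproj gM (l + d) h].

Lemma step_relP a f f' h h' : step_rel f h -> step_rel f' h' ->
  step_rel (a *: f + f') (a *: h + h').
Proof.
move=> r r' l; have [u [Ju su uf uh]] := r l; have [u' [Ju' su' uf' uh']] := r' l.
exists (a *: u + u'); split; first exact: idealP.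
- by move=> p px; rewrite linearP /= su // su' // scaler0 addr0.
- by rewrite !linearP /= uf uf'.
- by rewrite !linearP /= uh uh'.
Qed.

Lemma step_rel0 : step_rel 0 0.
Proof.
move=> l; exists 0; split; first exact: ideal0.
- by move=> p _; rewrite linear0.
- by rewrite !linear0.
- by rewrite !linear0.
Qed.

(** For homogeneous [e] of degree [q], the witness in degree [l - q] multiplied by [ev e] stays in
    [J], and all its components move by [q]. *)
Lemma step_relM e f h : step_rel f h ->
  step_rel (e ** f) (e ** h) /\ step_rel (f ** e) (h ** e).
Proof.
move=> r; elim/(gind (g := gM)): e => [|e e' [q1 q2] [q1' q2']|q e ge].
- by rewrite !namul0l !namul0r; split; apply: step_rel0.
- rewrite !namulDl !namulDr -[e ** f]scale1r -[e ** h]scale1r -[f ** e]scale1r.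
  by rewrite -[h ** e]scale1r; split; apply: step_relP.
have aux l p : p + (l - r0) - q = p + (l - q - r0).
  by rewrite -addrA -!(addrA l) [- r0 - q]addrC.
have aux' l : l + d - q = l - q + d by rewrite addrAC.
split=> l; have [u [Ju su uf uh]] := r (l - q).
  exists (ev e ** u); split; first exact: idealMl.
  - by move=> p px; rewrite (mlift_mull char0 per _ _ ge) aux su // namul0r.
  - by rewrite (mlift_mull char0 per _ _ ge) uf (gproj_mull _ _ ge).
  - by rewrite (mlift_mull char0 per _ _ ge) (gproj_mull _ _ ge) aux' uh.
exists (u ** ev e); split; first exact: idealMr.
- by move=> p px; rewrite (mlift_mulr char0 per _ _ ge) aux su // namul0l.
- by rewrite (mlift_mulr char0 per _ _ ge) uf (gproj_mulr _ _ ge).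
- by rewrite (mlift_mulr char0 per _ _ ge) (gproj_mulr _ _ ge) aux' uh.
Qed.

Lemma step_rel_proj l f h : step_rel f h ->
  step_rel (gproj gM l f) (gproj gM (l + d) h).
Proof.
move=> r p; have gf := gproj_in gM l f; have gh := gproj_in gM (l + d) h.
have [->|pl] := eqVneq p l.
  by rewrite (gproj_id gf) (gproj_id gh); apply: r.
exists 0; split; first exact: ideal0.
- by move=> q _; rewrite linear0.
- by rewrite linear0 (gproj_other gf).
- by rewrite linear0 (gproj_other gh) // (inj_eq (addIr d)).
Qed.

Lemma step_rel_x0 : step_rel (mlift r0 x0) (mlift r1 x0).
Proof.
have r0d : r0 + d = r1 by rewrite addrC subrK.
move=> l; have [->|lr0] := eqVneq l r0.
  exists x0; split=> //; first by move=> p; rewrite subrr addr0.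
    by rewrite (gproj_id (mlift_in _ _ _ _ _)).
  by rewrite r0d (gproj_id (mlift_in _ _ _ _ _)).
exists 0; split; first exact: ideal0.
- by move=> q _; rewrite linear0.
- by rewrite linear0 (gproj_other (mlift_in _ _ _ _ _)).
- by rewrite linear0 (gproj_other (mlift_in _ _ _ _ _)) // -r0d (inj_eq (addIr d)).
Qed.

(** The domain of the relation is a graded ideal, and it is nonzero because it contains the
    component of [x0] in degree [r0]. *)
Lemma step_rel_total f : exists h, step_rel f h.
Proof.
pose I : set M := [set f | exists h, step_rel f h].
have idI : ideal I.
  split=> [|f1 f2 [h r]]; last first.
    split; [exists (h ** f2)|exists (f2 ** h)].
      exact: (step_relM f2 r).2.
    exact: (step_relM f2 r).1.
  split=> [|a f1 f2]; rewrite !inE; first by exists 0; apply: step_rel0.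
  by move=> [h1 r1'] [h2 r2']; exists (a *: h1 + h2); apply: step_relP.
have gI : graded_ideal gM I.
  apply: graded_idealI => // l f1 [h r].
  by exists (gproj gM (l + d) h); apply: step_rel_proj.
have [_ gsM] := gcsM; have [I0|IT] := gsM.2 I gI; last first.
  by have : I f by rewrite IT.
exfalso; apply: r0x0; have : I (mlift r0 x0) by exists (mlift r1 x0); apply: step_rel_x0.
by rewrite I0.
Qed.

Lemma step_eq0 l u : J u -> supported (l - r0) u -> mlift l u = 0 -> u = 0.
Proof.
move=> Ju su lu; apply: (supported_eq0 b0box Ju su r0x0).
by rewrite addrC subrK.
Qed.

(** This is where minimality enters: a witness over 0 misses a degree of its allowed support, so it
    is 0. *)
Lemma step_rel_fun h : step_rel 0 h -> h = 0.
Proof.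
move=> r; apply: (gproj_eq0 (g := gM)) => p.
have [u [Ju su uf uh]] := r (p - d); move: uh; rewrite subrK => <-.
by rewrite (step_eq0 Ju su) ?linear0 // uf linear0.
Qed.

(** Being total and single-valued, the relation is the graph of a map, which is a nonzero centroid
    element of degree r1 - r0; [suppM] then constrains that degree. *)
Lemma step_cong : cong r1 r0.
Proof.
pose c f := projT1 (cid (step_rel_total f)).
have cP f : step_rel f (c f) by rewrite /c; case: cid.
have cU f h : step_rel f h -> c f = h.
  move=> r; apply/eqP; rewrite -subr_eq0; apply/eqP/step_rel_fun.
  by have := step_relP (-1) r (cP f); rewrite !scaleN1r addNr addrC.
have cc : centroid c.
  apply/centroidP; split=> [a f h|f h|f h]; apply: cU.
  - exact: step_relP.
  - exact: (step_relM _ (cP h)).1.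
  - exact: (step_relM _ (cP f)).2.
rewrite congB; apply: suppM; apply/centroid_supportP; exists c; last first.
  by exists (mlift r0 x0); rewrite (cU _ _ step_rel_x0).
split=> // l _ [f gf <-]; apply: gcomp_proj => p pl.
have [u [Ju su uf uh]] := cP f (p - d); move: uh; rewrite subrK => <-.
rewrite (step_eq0 Ju su) ?linear0 // uf (gproj_other gf) //.
by apply: contraNneq pl => <-; rewrite addrC subrK.
Qed.

End Step.

Lemma x0_homogeneous p : ~~ cong p r0 -> mlift p x0 = 0.
Proof.
move=> np; apply: contrapT => px0; move: np; apply/negP; rewrite negbK.
pose b := rmod m (p - t0).
have pb : cong p (b + t0) by rewrite -cong_subr rmod_cong.
apply: (cong_trans pb); apply: step_cong => h; apply: px0.
rewrite cong_sym in pb; rewrite -(mlift_ev_mlift char0 zeta m_gt0 per _ pb) h !linear0 //.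
Qed.

Lemma supported_homogeneous l v : supported (l - r0) v -> ev (mlift l v) = v.
Proof.
move=> sv; rewrite [RHS](ev_mlift_sum l) (bigD1_seq 0) ?box0 ?box_uniq //= add0r.
rewrite big_seq_cond big1 ?addr0 // => b' /andP[bb' b'0].
have -> : b' + l = b' + r0 + (l - r0) by rewrite addrACA subrr addr0.
rewrite sv ?linear0 //; apply: x0_homogeneous.
apply: contraNN b'0 => c; apply/eqP/box_cong0 => //.
by move: c; rewrite congB addrK.
Qed.

(** Totality of the relation with r1 = r0 makes each component of [u] a component of some [v] in [J]
    supported on a translate of the support of [x0]. Such a [v] is concentrated in a single class,
    so the component of [u] specializes to [v] itself. *)
Lemma minimal_ideal_full : J = setT.
Proof.
apply/seteqP; split=> // u _; rewrite (ev_mlift_sum 0 u); apply: ideal_sum => // b _.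
set l := b + 0; have [h r] := step_rel_total b0 (mlift l u).
have [v [Jv sv vf _]] := r l; rewrite (gproj_id (mlift_in _ _ _ _ _)) in vf.
by rewrite -vf supported_homogeneous.
Qed.

End Ideal.

Lemma multiloop_simple : simple_alg A.
Proof.
have [_ [[f0 [h0 fh0]] _]] := gcsM; split.
  apply: contrapT => hn; apply: fh0; have uv0 (u v : A) : u ** v = 0.
    by apply: contrapT => uv; apply: hn; exists u, v.
  elim/(gind (g := gM)): f0 => [|f f' h1 h2|l f gf]; first by rewrite namul0l.
    by rewrite namulDl h1 h2 addr0.
  elim/(gind (g := gM)): h0 => [|h h' h1 h2|l' h gh]; first by rewrite namul0r.
    by rewrite namulDr h1 h2 addr0.
  by rewrite -(mlift_ev char0 per (gcomp_mul gf gh)) ev_mul uv0 linear0.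
move=> J idJ; have [->|/eqP/eqP J0] := pselect (J = [set 0]); first by left.
have [x Jx x0] := setP0 (ideal0 idJ) J0; right.
pose N t u := count (fun b => mlift (b + t) u != 0) box.
pose P (q : nat) := `[< exists u t, [/\ J u, u <> 0 & N t u = q] >].
have exP : exists q, P q by exists (N 0 x); apply/asboolP; exists x, 0.
have [q /asboolP[x1 [t1 [Jx1 x10 <-]]] minq] := ex_minnP exP.
have minN t u : J u -> u <> 0 -> (N t1 x1 <= N t u)%N.
  by move=> Ju u0; apply: minq; apply/asboolP; exists u, t.
have [b bb bx] : exists2 b, b \in box & mlift (b + t1) x1 <> 0.
  apply: contrapT => hn; apply: x10.
  apply: (@mlift_eq0 _ char0 zeta _ _ _ m_gt0 _ per _ t1) => b bb.
  by apply: contrapT => h; apply: hn; exists b.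
exact: (minimal_ideal_full idJ Jx1 bb minN bx).
Qed.

End Converse.

(** * Shifts by homogeneous centroid elements *)

Section HomogeneousCentroid.
Variables (k : fieldType) (L : zmodType) (B : naAlgType k) (g : grading L B).

Lemma centroid_comp_in d c l x : centroid_comp g d c -> g l x -> g (d + l) (c x).
Proof. by move=> [_ h] gx; apply: h; exists x. Qed.

Lemma centroid_comp_id : centroid_comp g 0 id.
Proof.
split; first by apply/centroidP.
by move=> l _ [x gx <-]; rewrite add0r.
Qed.

Lemma centroid_compM d d' c c' : centroid_comp g d c -> centroid_comp g d' c' ->
  centroid_comp g (d + d') (c \o c').
Proof.
move=> hc hc'; split; first exact: centroid_comp_fun hc.1 hc'.1.
by move=> l _ [x gx <-] /=; rewrite -addrA; do 2!apply: centroid_comp_in => //.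
Qed.

Lemma gproj_centroid_comp d c l x : centroid_comp g d c ->
  gproj g l (c x) = c (gproj g (l - d) x).
Proof.
move=> hc; have [/centroidP[lc _ _] _] := hc.
elim/(gind (g := g)): x => [|x y hx hy|l' x gx].
- by rewrite lin_0 // !linear0 lin_0.
- by rewrite lin_D // !linearD /= hx hy lin_D.
have gcx := centroid_comp_in hc gx.
have [->|ll'] := eqVneq l (d + l'); first by rewrite (gproj_id gcx) [d + l']addrC addrK gproj_id.
rewrite (gproj_other gcx ll') (gproj_other gx) ?lin_0 //.
by apply: contraNneq ll' => <-; rewrite addrC subrK.
Qed.

(** Graded form of Schur's lemma: the kernel and the range of a homogeneous centroid element are
    graded ideals. *)
Lemma centroid_comp_inv d c : graded_simple g -> centroid_comp g d c ->
  (exists x, c x <> 0) ->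
  exists c', [/\ centroid_comp g (- d) c', cancel c c' & cancel c' c].
Proof.
move=> gs hc [x0 cx0]; have [cc _] := hc; have /centroidP[lc cl cr] := cc.
have gproj_c := gproj_centroid_comp _ _ hc.
have ker0 : forall x, c x = 0 -> x = 0.
  have idK : ideal [set x | c x = 0].
    split=> [|x y /= x0' ]; last by rewrite cr cl x0' namul0l namul0r.
    split=> [|a x y]; rewrite !inE /=; first by rewrite lin_0.
    by move=> hx hy; rewrite lc hx hy scaler0 addr0.
  have [|KE|KT] := gs.2 [set x | c x = 0].
  - apply: graded_idealI => // l x /= hx.
    by rewrite -[l](addrK d) -gproj_c hx linear0.
  - by move=> x hx; have : [set x | c x = 0] x by []; rewrite KE.
  - by exfalso; apply: cx0; have : [set x | c x = 0] x0 by [rewrite KT].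
have ci : injective c.
  move=> x y cxy; apply/eqP; rewrite -subr_eq0; apply/eqP/ker0.
  by rewrite lin_B // cxy subrr.
have surj : forall y, exists x, c x = y.
  have idI : ideal (range c).
    split=> [|_ y [x _ <-]]; last first.
      by split; [exists (x ** y) => //; rewrite cr|exists (y ** x) => //; rewrite cl].
    split=> [|a x y]; rewrite !inE; first by exists 0 => //; rewrite lin_0.
    by move=> [x' _ <-] [y' _ <-]; exists (a *: x' + y') => //; rewrite lc.
  have [|IE|IT] := gs.2 (range c).
  - apply: graded_idealI => // l _ [x _ <-].
    by exists (gproj g (l - d) x) => //; rewrite gproj_c.
  - by exfalso; apply: cx0; have : range c (c x0) by [exists x0]; rewrite IE.
  - by move=> y; have [x _ <-] : range c y by [rewrite IT]; exists x.
pose c' y := projT1 (cid (surj y)).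
have c'K : cancel c' c by move=> y; rewrite /c'; case: cid.
have cK : cancel c c' by move=> x; apply: ci; rewrite c'K.
exists c'; split=> //; split; first exact: centroid_inv cc cK c'K.
move=> l _ [y gy <-]; apply: gcomp_proj => p pl; apply: ci.
rewrite -[p](addrK d) -gproj_c c'K lin_0 // (gproj_other gy) //.
by apply: contraNneq pl => <-; rewrite addrC addrK.
Qed.

Lemma graded_simple_neq0 : graded_simple g -> exists x : B, x <> 0.
Proof.
by move=> [[x [y xy]] _]; exists x => x0; apply: xy; rewrite x0 namul0l.
Qed.

Lemma centroid_supportB d d' : graded_simple g ->
  centroid_support g d -> centroid_support g d' -> centroid_support g (d - d').
Proof.
move=> gs /centroid_supportP[c hc cn] /centroid_supportP[e he en].
have [e' [he' eK e'K]] := centroid_comp_inv gs he en.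
have [c' [_ cK c'K]] := centroid_comp_inv gs hc cn.
apply/centroid_supportP; exists (c \o e'); first exact: centroid_compM.
have [x x0] := graded_simple_neq0 gs; exists (e x); rewrite /= eK => cx0.
by apply: x0; apply: (can_inj cK); rewrite cx0; case: hc => /centroidP[/lin_0 -> _ _] _.
Qed.

Lemma centroid_support0 : graded_simple g -> centroid_support g 0.
Proof.
move=> gs; apply/centroid_supportP; exists id; first exact: centroid_comp_id.
exact: graded_simple_neq0.
Qed.

End HomogeneousCentroid.

(** Integer powers, with [c'] in the role of the inverse of [c]. *)
Definition iterz (T : Type) (c c' : T -> T) (z : int) : T -> T :=
  match z with Posz q => iter q c | Negz q => iter q.+1 c' end.

Section Iterz.
Variables (T : Type) (c c' : T -> T).
Hypotheses (cK : cancel c c') (c'K : cancel c' c).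

Lemma iterzS z x : iterz c c' (z + 1) x = c (iterz c c' z x).
Proof.
case: z => [q|[|q]] /=; first by rewrite ?addn1.
  by rewrite c'K.
by rewrite subn1 /= c'K.
Qed.

Lemma iterzP z x : iterz c c' (z - 1) x = c' (iterz c c' z x).
Proof. by apply: (can_inj cK); rewrite -iterzS subrK c'K. Qed.

Lemma iterzD a b x : iterz c c' (a + b) x = iterz c c' a (iterz c c' b x).
Proof.
elim/int_ind: a => [|a IH|a IH]; first by rewrite add0r.
  by rewrite -addn1 PoszD addrAC !iterzS IH.
by rewrite -addn1 PoszD opprD addrAC !iterzP IH.
Qed.

End Iterz.

Section Torus.
Variables (k : fieldType) (n : nat) (B : naAlgType k).
Variable g : grading 'rV[int]_n B.
Variable m : 'I_n -> nat.

Definition dil (q : 'rV[int]_n) : 'rV[int]_n := \row_i (q 0%R i * m i)%R.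

Lemma centroid_iterz d c c' z : centroid_comp g d c -> centroid_comp g (- d) c' ->
  centroid_comp g (d *~ z) (iterz c c' z).
Proof.
move=> hc hc'; have aux q e f : centroid_comp g e f -> centroid_comp g (e *+ q) (iter q f).
  move=> hf; elim: q => [|q IH]; first by rewrite mulr0n; apply: centroid_comp_id.
  by rewrite mulrS; apply: centroid_compM.
by case: z => q; [exact: aux|rewrite NegzE mulrNz -mulNrz; exact: aux].
Qed.

(** An invertible centroid element is chosen for each m_i e_i, and [T q] is the product of their
    powers. It is additive in [q] because the centroid is commutative, the annihilator being
    zero. *)
Lemma centroid_torus : graded_simple g ->
  (forall q, centroid_support g (dil q)) ->
  exists T : 'rV[int]_n -> {linear B -> B},
    [/\ forall q, centroid_comp g (dil q) (T q), forall x, T 0 x = x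
      & forall q q' x, T (q + q') x = T q (T q' x)].
Proof.
move=> gs hd; have ann := graded_simple_annihilator gs.
have hc i : exists cc : (B -> B) * (B -> B),
    [/\ centroid_comp g (dil (delta_mx 0 i)) cc.1,
        centroid_comp g (- dil (delta_mx 0 i)) cc.2,
        cancel cc.1 cc.2 & cancel cc.2 cc.1].
  have /centroid_supportP[c hc cn] := hd (delta_mx 0 i).
  by have [c' [hc' cK c'K]] := centroid_comp_inv gs hc cn; exists (c, c').
pose c i := projT1 (cid (hc i)).
pose F (q : 'rV[int]_n) (s : seq 'I_n) x := foldr (fun i y => iterz (c i).1 (c i).2 (q 0 i) y) x s.
have cz i z : centroid_comp g (dil (delta_mx 0 i) *~ z) (iterz (c i).1 (c i).2 z).
  by rewrite /c; have [h1 h2 _ _] := projT2 (cid (hc i)); apply: centroid_iterz.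
have hF (q : 'rV[int]_n) s : centroid_comp g (\sum_(i <- s) dil (delta_mx 0 i) *~ (q 0 i)) (F q s).
  elim: s => [|i s IH]; first by rewrite big_nil; apply: centroid_comp_id.
  by rewrite big_cons; apply: centroid_compM.
have dilE (q : 'rV[int]_n) : \sum_(i <- enum 'I_n) dil (delta_mx 0 i) *~ (q 0 i) = dil q.
  apply/rowP => j; rewrite big_enum summxE (bigD1 j) //= big1 => [|i ij].
    by rewrite addr0 -scaler_int !mxE !eqxx mul1r intz.
  by rewrite -scaler_int !mxE eqxx eq_sym (negbTE ij) mul0r mulr0.
have lF q : linear (F q (enum 'I_n)) by case: (hF q (enum 'I_n)) => -[].
pose T q := projT1 (cid (linear_pack (lF q))).
have TE q : F q (enum 'I_n) = T q by rewrite /T; case: cid.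
exists T; split=> [q|x|q q' x]; rewrite -?TE.
- by rewrite -[X in centroid_comp g X]dilE; apply: hF.
- by rewrite /F; elim: (enum 'I_n) => //= i s ->; rewrite mxE.
rewrite /F; elim: (enum 'I_n) => //= i s ->; rewrite -/(F q s) -/(F q' s) mxE.
have [_ _ c1K c2K] := projT2 (cid (hc i)); rewrite (iterzD c1K c2K).
congr (iterz _ _ _ _).
have := centroid_commute ann (cz i (q' 0 i)).1 (hF q s).1.
by move=> /(congr1 (fun h => h (F q' s x))).
Qed.

End Torus.

(** * Specialization of a graded-central-simple algebra *)

Section Specialization.
Variables (k : fieldType) (char0 : [pchar k] =i pred0) (zeta : compatible_roots k).
Variables (n : nat) (B : naAlgType k) (g : grading 'rV[int]_n B).
Variable m : 'I_n -> nat.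
Hypothesis m_gt0 : forall i, (0 < m i)%N.
Variable T : 'rV[int]_n -> {linear B -> B}.
Hypothesis T_comp : forall q, centroid_comp g (dil m q) (T q).
Hypothesis T0 : forall x, T 0 x = x.
Hypothesis TD : forall q q' x, T (q + q') x = T q (T q' x).
Implicit Types (x y : B) (l q : 'rV[int]_n).

Definition quo l : 'rV[int]_n := \row_i (l 0%R i %/ m i)%Z.

Lemma quo_rmod l : l = dil m (quo l) + rmod m l.
Proof. by apply/rowP => i; rewrite !mxE -divz_eq. Qed.

Lemma quoD q l : quo (dil m q + l) = q + quo l.
Proof.
apply/rowP => i; rewrite !mxE divzMDl //.
by rewrite eqz_nat -lt0n.
Qed.

Lemma rmod_idem l : rmod m (rmod m l) = rmod m l.
Proof. by apply/rowP => i; rewrite !mxE modz_mod. Qed.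

(* The image of spec, the span of the components whose degree is reduced modulo
   m, represents the quotient of B by all T q x - x. *)
Definition spec : B -> B := gext g (fun l => T (- quo l)).

HB.instance Definition _ := GRing.Linear.on spec.

Lemma spec_hom l x : g l x -> spec x = T (- quo l) x.
Proof. exact: gext_hom. Qed.

Lemma T_in q l x : g l x -> g (dil m q + l) (T q x).
Proof. exact: centroid_comp_in. Qed.

Lemma T_mull q x y : T q (x ** y) = T q x ** y.
Proof. by have [/centroidP[_ _ ->]] := T_comp q. Qed.

Lemma T_mulr q x y : T q (x ** y) = x ** T q y.
Proof. by have [/centroidP[_ -> _]] := T_comp q. Qed.

Lemma TK q x : T (- q) (T q x) = x.
Proof. by rewrite -TD addNr T0. Qed.

Lemma TVK q x : T q (T (- q) x) = x.
Proof. by rewrite -TD subrr T0. Qed.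

Lemma spec_in l x : g l x -> g (rmod m l) (spec x).
Proof.
move=> gx; rewrite (spec_hom gx).
suff -> : rmod m l = dil m (- quo l) + l by apply: T_in.
rewrite {3}[l]quo_rmod addrA (_ : dil m (- quo l) + dil m (quo l) = 0) ?add0r //.
by apply/rowP => i; rewrite !mxE mulNr addNr.
Qed.

Lemma spec_T q x : spec (T q x) = spec x.
Proof.
move: x; apply: (gind (g := g)) => [|x y hx hy|l x gx]; first by rewrite !linear0.
  by rewrite !linearD /= hx hy.
rewrite (spec_hom (T_in q gx)) (spec_hom gx) quoD opprD addrC TD.
by rewrite TK.
Qed.

Lemma spec_idem x : spec (spec x) = spec x.
Proof.
move: x; apply: (gind (g := g)) => [|x y hx hy|l x gx]; first by rewrite !linear0.
  by rewrite !linearD /= hx hy.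
by rewrite {1}(spec_hom gx) spec_T.
Qed.

Lemma spec_mull x y : spec (spec x ** y) = spec (x ** y).
Proof.
move: x; apply: (gind (g := g)) => [|x x' hx hx'|l x gx].
- by rewrite !(linear0, namul0l).
- by rewrite !(linearD, namulDl) /= hx hx'.
by rewrite (spec_hom gx) -T_mull spec_T.
Qed.

Lemma spec_mulr x y : spec (x ** spec y) = spec (x ** y).
Proof.
move: y; apply: (gind (g := g)) => [|y y' hy hy'|l y gy].
- by rewrite !(linear0, namul0r).
- by rewrite !(linearD, namulDr) /= hy hy'.
by rewrite (spec_hom gy) -T_mulr spec_T.
Qed.

Lemma gproj_spec p x : p != rmod m p -> gproj g p (spec x) = 0.
Proof.
move=> pp; move: x; apply: (gind (g := g)) => [|x y hx hy|l x gx].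
- by rewrite !linear0.
- by rewrite !linearD /= hx hy addr0.
apply: gproj_other (spec_in gx) _.
by apply: contraNneq pp => ->; rewrite rmod_idem.
Qed.

Definition spec_pred : {pred B} := [pred x | spec x == x].

Fact spec_submod : submod_closed spec_pred.
Proof.
split; first by rewrite inE linear0.
by move=> a x y; rewrite !inE => /eqP hx /eqP hy; rewrite linearP /= hx hy.
Qed.

HB.instance Definition _ := GRing.isSubmodClosed.Build k B spec_pred spec_submod.

Record spec_alg := SpecAlg { spec_val :> B; spec_valP : spec_val \in spec_pred }.

HB.instance Definition _ := [isSub for spec_val].
HB.instance Definition _ := [Choice of spec_alg by <:].
HB.instance Definition _ := [SubChoice_isSubLmodule of spec_alg by <:].

Fact spec_in_pred x : spec x \in spec_pred.
Proof. by rewrite inE spec_idem. Qed.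

Definition to_spec x : spec_alg := SpecAlg (spec_in_pred x).

Fact to_spec_linear : linear to_spec.
Proof. by move=> a x y; apply: val_inj; rewrite /= linearP. Qed.

HB.instance Definition _ := GRing.isLinear.Build k B spec_alg _ to_spec to_spec_linear.

Lemma spec_valK u : spec (spec_val u) = spec_val u.
Proof. by have := spec_valP u; rewrite inE => /eqP. Qed.

Lemma to_specK u : to_spec (spec_val u) = u.
Proof. by apply: val_inj; rewrite /= spec_valK. Qed.

(** The product of the quotient by all [T q x - x], read on the chosen representatives; [to_spec] is
    the quotient map. *)
Definition spec_mul (u v : spec_alg) : spec_alg := to_spec (spec_val u ** spec_val v).

Fact spec_mul_bilinear : bilinear_for *:%R *:%R spec_mul.
Proof.
split=> [v a u u'|u a v v']; apply: val_inj; rewrite /= ?linearPl ?linearPr /=.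
  by rewrite linearP.
by rewrite linearP.
Qed.

HB.instance Definition _ := Lmodule_isNAAlgebra.Build k spec_alg spec_mul_bilinear.

Lemma to_spec_mul : {morph to_spec : x y / x ** y}.
Proof. by move=> x y; apply: val_inj; rewrite /= spec_mull spec_mulr. Qed.

(** The power [e] of the automorphism of [B] that reads the [i]-th coordinate of the degree through
    a root of unity. Keeping [e] as a parameter covers its inverse and its iterates at once. *)
Definition twist (e : int) i : B -> B :=
  gext g (fun l => GRing.scale (zeta (m i) ^ (e * l 0%R i))).

HB.instance Definition _ e i := GRing.Linear.on (twist e i).

Lemma twist_hom e i l x : g l x -> twist e i x = zeta (m i) ^ (e * l 0 i) *: x.
Proof. exact: gext_hom. Qed.

Lemma twist_in e i l x : g l x -> g l (twist e i x).
Proof. by move=> gx; rewrite (twist_hom e i gx); apply: gcompZ. Qed.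

Let z0 i : zeta (m i) != 0.
Proof. exact: root_neq0. Qed.

Lemma twist_mul e i : {morph twist e i : x y / x ** y}.
Proof.
apply: (mul_hom (g := g)) => l l' x y gx gy /=.
rewrite (twist_hom _ _ gx) (twist_hom _ _ gy) (twist_hom _ _ (gcomp_mul gx gy)).
by rewrite namulZl namulZr scalerA -expfzDr // mxE mulrDr.
Qed.

Lemma twist_comm e i e' j x : twist e i (twist e' j x) = twist e' j (twist e i x).
Proof.
move: x; apply: (gind (g := g)) => [|x y hx hy|l x gx]; first by rewrite !linear0.
  by rewrite !linearD /= hx hy.
rewrite (twist_hom e i (twist_in e' j gx)) (twist_hom e' j (twist_in e i gx)).
by rewrite (twist_hom _ _ gx) (twist_hom _ _ gx) !scalerA mulrC.
Qed.

Lemma twistD e e' i x : twist (e + e') i x = twist e i (twist e' i x).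
Proof.
move: x; apply: (gind (g := g)) => [|x y hx hy|l x gx]; first by rewrite !linear0.
  by rewrite !linearD /= hx hy.
rewrite (twist_hom e i (twist_in e' i gx)) !(twist_hom _ _ gx) scalerA -expfzDr //.
by rewrite mulrDl.
Qed.

Lemma twist_dvd e i x : (m i %| e)%Z -> twist e i x = x.
Proof.
move=> me; move: x; apply: (gind (g := g)) => [|x y hx hy|l x gx].
- by rewrite !linear0.
- by rewrite !linearD /= hx hy.
rewrite (twist_hom _ _ gx) (_ : _ ^ _ = 1) ?scale1r //.
by apply/eqP; rewrite root_expz_eq1 // dvdz_mulr.
Qed.

Lemma twist_iter (q : nat) i x : iter q (twist 1 i) x = twist q i x.
Proof.
elim: q => [|q /= ->]; first by rewrite twist_dvd // dvdz0.
by rewrite -twistD.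
Qed.

Lemma twist_T e i q x : twist e i (T q x) = T q (twist e i x).
Proof.
move: x; apply: (gind (g := g)) => [|x y hx hy|l x gx]; first by rewrite !linear0.
  by rewrite !linearD /= hx hy.
rewrite (twist_hom _ _ gx) (twist_hom _ _ (T_in q gx)) linearZ; congr (_ *: _).
apply/eqP; rewrite root_expz_eq // -mulrBr dvdz_mull // !mxE addrK.
exact: dvdz_mull.
Qed.

Lemma twist_spec e i x : twist e i (spec x) = spec (twist e i x).
Proof.
move: x; apply: (gind (g := g)) => [|x y hx hy|l x gx]; first by rewrite !linear0.
  by rewrite !linearD /= hx hy.
by rewrite (spec_hom gx) (spec_hom (twist_in e i gx)) twist_T.
Qed.

Lemma gproj_twist p e i x : gproj g p (twist e i x) = zeta (m i) ^ (e * p 0 i) *: gproj g p x.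
Proof.
move: x; apply: (gind (g := g)) => [|x y hx hy|l x gx].
- by rewrite !linear0.
- by rewrite !linearD /= hx hy.
have [->|pl] := eqVneq p l; first by rewrite (twist_hom _ _ gx) linearZ.
by rewrite (gproj_other (twist_in e i gx) pl) (gproj_other gx pl) scaler0.
Qed.

Definition spec_twist e i (u : spec_alg) : spec_alg := to_spec (twist e i (spec_val u)).

Lemma spec_twistE e i u : spec_val (spec_twist e i u) = twist e i (spec_val u).
Proof. by rewrite /= -twist_spec spec_valK. Qed.

Fact spec_twist_linear e i : linear (spec_twist e i).
Proof. by move=> a u v; apply: val_inj; rewrite /= !linearP. Qed.

HB.instance Definition _ e i :=
  GRing.isLinear.Build k spec_alg spec_alg _ (spec_twist e i) (spec_twist_linear e i).

Fact spec_twist_mul e i : {morph spec_twist e i : u v / u ** v}.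
Proof.
move=> u v; rewrite /spec_twist [u ** v]/(to_spec _) -to_spec_mul -twist_mul.
by apply: val_inj; rewrite /= -!twist_spec spec_idem.
Qed.

Fact spec_twistK i : cancel (spec_twist 1 i) (spec_twist (- 1) i).
Proof.
move=> u; apply: val_inj; rewrite [LHS]spec_twistE spec_twistE -twistD addNr.
by rewrite twist_dvd ?dvdz0.
Qed.

Fact spec_twistVK i : cancel (spec_twist (- 1) i) (spec_twist 1 i).
Proof.
move=> u; apply: val_inj; rewrite [LHS]spec_twistE spec_twistE -twistD subrr.
by rewrite twist_dvd ?dvdz0.
Qed.

Definition spec_aut i : alg_iso spec_alg spec_alg :=
  @AlgIso _ _ _ (spec_twist 1 i : {linear spec_alg -> spec_alg}) (spec_twist (- 1) i)
    (spec_twist_mul 1 i) (spec_twistK i) (spec_twistVK i).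

Lemma spec_periods : commuting_periods m spec_aut.
Proof.
split=> [i j u|i u]; apply: val_inj => /=.
  by rewrite -!twist_spec twist_comm.
have -> (q : nat) : \val (iter q (spec_twist 1 i) u) = iter q (twist 1 i) (spec_val u).
  by elim: q => //= q <-; rewrite -twist_spec spec_valK.
by rewrite twist_iter twist_dvd ?dvdzz.
Qed.

(** A specialized element has components only in reduced degrees [p], on which the automorphisms act
    by the roots of unity zeta^p_i. These separate the classes modulo [m], so the eigenvalues of [l]
    leave only the degree [rmod m l]. *)
Lemma spec_eigen l u : u \in eigencomp zeta m spec_aut l <-> g (rmod m l) (spec_val u).
Proof.
split=> [/eigencompP hu|gu].
  apply: gcomp_proj => p pl; apply: contrapT => p0.
  have pb : rmod m p = p.
    by apply/eqP; rewrite eq_sym; apply: contrapT => /negP/gproj_spec h;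
      apply: p0; rewrite -spec_valK h.
  move/negP: pl; apply; rewrite -pb -cong_rmod; apply/congP => i.
  have /(congr1 (fun v : spec_alg => gproj g p (spec_val v))) := hu i.
  rewrite [LHS](congr1 _ (spec_twistE 1 i u)) /= gproj_twist linearZ mul1r.
  move=> /eqP; rewrite -subr_eq0 -scalerBl scaler_eq0 => /orP[|/eqP//].
  by rewrite subr_eq0 root_expz_eq.
apply/eigencompP => i; apply: val_inj; rewrite [LHS]spec_twistE (twist_hom _ _ gu).
rewrite mul1r [RHS]/=; congr (_ *: _); apply/eqP; rewrite root_expz_eq //.
by move: i; apply/congP; rewrite cong_rmod rmod_idem.
Qed.

Local Notation M := (multiloop zeta spec_aut m_gt0).
Local Notation gM := (multiloop_grading zeta m_gt0 spec_aut).
Local Notation mlift := (mlift zeta m_gt0 spec_periods).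

Lemma to_spec_eigen l x : g l x -> to_spec x \in eigencomp zeta m spec_aut l.
Proof. by move=> gx; apply/spec_eigen; apply: spec_in. Qed.

(** Specialization forgets the quotient of the degree by [m]; the inverse restores it by applying
    [T (quo l)] in degree [l]. *)
Lemma spec_isograded : exists phi : alg_iso B M, graded_iso g gM phi idfun.
Proof.
pose F : {linear B -> M} := gext g (fun l => mlift l \o to_spec).
pose F' : {linear M -> B} :=
  gext gM (fun l => T (quo l) \o (\val : {linear spec_alg -> B}) \o @ev _ _ _ _ _ _ _).
have FE l x : g l x -> F x = mlift l (to_spec x) by apply: gext_hom.
have F'E l f : gM l f -> F' f = T (quo l) (spec_val (ev f)) by apply: gext_hom.
have evF l x : g l x -> ev (F x) = to_spec x.
  move=> gx; rewrite (FE _ _ gx) ev_mlift eigenproj_id //; exact: to_spec_eigen.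
have FM l x : g l x -> gM l (F x) by move=> gx; rewrite (FE _ _ gx); apply: mlift_in.
have evg l f : gM l f -> g (rmod m l) (spec_val (ev f)).
  by move=> gf; apply/spec_eigen; apply: ev_in.
have F'g l f : gM l f -> g l (F' f).
  move=> gf; rewrite (F'E _ _ gf) {1}[l]quo_rmod; apply/T_in/evg/gf.
apply: (@isograded_build _ _ _ _ _ _ _ F F' (idfun : {additive _ -> _}));
  do ?[exact: FM|exact: F'g].
- by exists id.
- move=> l x gx; rewrite (F'E _ _ (FM _ _ gx)) (evF _ _ gx) /= (spec_hom gx).
  exact: TVK.
- move=> l f gf; rewrite (FE _ _ (F'g _ _ gf)) (F'E _ _ gf).
  have -> y : to_spec (T (quo l) y) = to_spec y by apply: val_inj; apply: spec_T.
  by rewrite to_specK; apply: mlift_ev.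
- move=> l l' x y gx gy; have gFF := gcomp_mul (FM _ _ gx) (FM _ _ gy).
  rewrite (FE _ _ (gcomp_mul gx gy)) to_spec_mul -(evF _ _ gx) -(evF _ _ gy) -ev_mul.
  exact: mlift_ev.
Qed.

End Specialization.

(** Central-simplicity of the specialization is not read off from [B] directly: [B] transfers its
    graded properties to the multiloop algebra over the specialization, from which they descend. *)
Lemma graded_central_simple_multiloop (k : fieldType) (char0 : [pchar k] =i pred0)
    (zeta : compatible_roots k) (n : nat) (B : naAlgType k)
    (g : grading 'rV[int]_n B) (m : 'I_n -> nat) (m_gt0 : forall i, (0 < m i)%N) :
  graded_central_simple g -> (forall d, centroid_support g d <-> cong m d 0) ->
  exists (A : naAlgType k) (sg : 'I_n -> alg_iso A A),
    [/\ central_simple A, commuting_periods m sg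
      & isograded_isomorphic g (multiloop_grading zeta m_gt0 sg)].
Proof.
move=> gcs supp; have [_ gs] := gcs.
have [|T [Tc T0 TD]] := centroid_torus (m := m) gs.
  by move=> q; apply/supp/congP => i; rewrite !mxE subr0 dvdz_mull.
have per := spec_periods zeta m_gt0 Tc T0 TD.
have iso := spec_isograded char0 zeta m_gt0 Tc T0 TD.
have [phi giso] := iso.
have gcsM : graded_central_simple (multiloop_grading zeta m_gt0
    (spec_aut zeta m_gt0 Tc T0 TD)).
  by apply: graded_central_simple_iso gcs; exists phi, idfun.
exists (spec_alg g m T), (spec_aut zeta m_gt0 Tc T0 TD); split=> //.
  have suppM d : centroid_support (multiloop_grading zeta m_gt0
      (spec_aut zeta m_gt0 Tc T0 TD)) d -> cong m d 0.
    by move=> h; apply/supp/(graded_iso_centroid_supportE _ giso).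
  by split; [exact: multiloop_central gcsM suppM|exact: multiloop_simple gcsM suppM].
by exists phi, idfun.
Qed.

(** * Subgroups of finite index and the realization theorem *)

Section FiniteIndex.
Variables (n : nat) (H : set 'rV[int]_n).
Hypotheses (H0 : H 0) (HB : forall x y, H x -> H y -> H (x - y)).
Hypothesis finH : finite_index H.
Implicit Types (x y l : 'rV[int]_n).

Let HN x : H x -> H (- x).
Proof. by move=> hx; rewrite -sub0r; apply: HB. Qed.

Let HD x y : H x -> H y -> H (x + y).
Proof. by move=> hx hy; rewrite -[y]opprK; apply: HB => //; apply: HN. Qed.

Let HZ x (z : int) : H x -> H (x *~ z).
Proof.
move=> hx; have hn (q : nat) : H (x *+ q).
  by elim: q => [|q IH]; rewrite ?mulr0n // mulrS; apply: HD.
by case: z => q; [exact: hn|rewrite NegzE mulrNz; apply/HN/hn].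
Qed.

Let Hsum (I : Type) (s : seq I) (F : I -> 'rV[int]_n) :
  (forall i, H (F i)) -> H (\sum_(i <- s) F i).
Proof. by move=> hF; elim/big_ind: _. Qed.

(** Pigeonhole principle: two of the cosets of the multiples of [x] coincide. *)
Lemma finite_index_mul x : exists2 N : nat, (0 < N)%N & H (x *+ N).
Proof.
pose f (j : nat) : set 'rV[int]_n := [set x *+ j + h | h in H].
have : exists i j : nat, (i < j)%N /\ f i = f j.
  apply: contrapT => hn; apply: infinite_nat.
  have -> : setT = f @^-1` range (fun l => [set l + h | h in H]).
    by apply/seteqP; split=> // j _; exists (x *+ j).
  apply: finite_preimage finH => i j _ _ fij.
  by have [ij|ij|//] := ltngtP i j; exfalso; apply: hn; [exists i, j|exists j, i].
move=> [i [j [ij fij]]]; exists (j - i)%N; first by rewrite subn_gt0.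
have : f j (x *+ j) by exists 0 => //; rewrite addr0.
rewrite -fij => -[h hh xE]; rewrite mulrnBr ?(ltnW ij) // -xE addrC addKr //.
Qed.

Lemma finite_index_exponent : exists2 N : nat, (0 < N)%N & forall x, H (x *+ N).
Proof.
have hN i := finite_index_mul (delta_mx 0 i).
pose N i := s2val (cid2 (hN i)); pose NN := (\prod_i N i)%N.
have N0 i : (0 < N i)%N by rewrite /N; case: cid2.
exists NN; first by apply: prodn_gt0.
move=> x; rewrite [x]row_sum_delta -sumrMnl; apply: Hsum => i.
pose q := (NN %/ N i)%N.
have NNq : NN = (N i * q)%N by rewrite mulnC divnK // /NN (bigD1 i) //= dvdn_mulr.
have -> : (x 0 i *: (delta_mx 0 i : 'rV[int]_n)) *+ NN =
    ((delta_mx 0 i : 'rV[int]_n) *+ N i) *~ (x 0 i * q).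
  have hz (v : 'rV[int]_n) (z : int) : v *~ z = z *: v by rewrite -scaler_int intz.
  rewrite NNq hz -!scaler_nat !scalerA; congr (_ *: _).
  by rewrite !natz PoszM mulrC mulrA mulrAC.
by apply: HZ; rewrite /N; case: cid2.
Qed.

Lemma adapted_basis : exists (R : 'M[int]_n) (m : 'I_n -> nat),
  [/\ R \in unitmx, forall i, (0 < m i)%N & forall l, H l <-> cong m (l *m R) 0].
Proof.
have [N N0 HN'] := finite_index_exponent.
(* As N Z^n lies in [H], the vectors N e_i and the elements of [H] with coordinates in [0, N)
   generate [H]. Coordinate vectors outside [H] contribute 0, so that the index type is a plain
   finite type. *)
pose T : finType := ({ffun 'I_n -> 'I_N} + 'I_n)%type.
pose val_row (f : {ffun 'I_n -> 'I_N}) : 'rV[int]_n := \row_i (f i : nat)%:Z.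
pose gen (t : T) : 'rV[int]_n := match t with
  | inl f => if `[< H (val_row f) >] then val_row f else 0
  | inr i => 'e_i *+ N end.
have Hgen t : H (gen t) by case: t => [f|i] /=; [case: asboolP|].
pose G : 'M[int]_(#|T|, n) := \matrix_(j < #|T|) gen (enum_val j).
have HG l : H l <-> exists w : 'rV_#|T|, l = w *m G.
  split=> [Hl|[w ->]]; last first.
    rewrite mulmx_sum_row; apply: Hsum => j; rewrite rowK -[w 0 j]intz scaler_int.
    exact: HZ.
  have Nn0 : N%:Z != 0 by rewrite eqz_nat -lt0n.
  have fP i : (`|(l 0%R i %% N)%Z| < N)%N.
    by rewrite -ltz_nat gez0_abs ?modz_ge0 // ltz_pmod ?ltz_nat.
  pose f : {ffun 'I_n -> 'I_N} := [ffun i => Ordinal (fP i)].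
  pose q : 'rV[int]_n := \row_i (l 0%R i %/ N)%Z.
  have lE : l = val_row f + q *+ N.
    apply/rowP => i; rewrite -scaler_nat !mxE ffunE /= gez0_abs ?modz_ge0 //.
    by rewrite natz {1}(divz_eq (l 0 i) N) addrC [_ * N%:Z]mulrC.
  have Hf : H (val_row f).
    have <- : l - q *+ N = val_row f by rewrite {1}lE addrK.
    exact: HB.
  have spanD u v : (exists w : 'rV_#|T|, u = w *m G) -> (exists w : 'rV_#|T|, v = w *m G) ->
      exists w : 'rV_#|T|, u + v = w *m G.
    by move=> [w ->] [w' ->]; exists (w + w'); rewrite mulmxDl.
  have spang t z : exists w : 'rV_#|T|, z *: gen t = w *m G.
    by exists (z *: 'e_(enum_rank t)); rewrite -scalemxAl -rowE rowK enum_rankK.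
  rewrite lE; apply: (spanD).
    by have := spang (inl f) 1; rewrite scale1r /= asboolT.
  rewrite [q]row_sum_delta -sumrMnl.
  apply: (big_ind (fun u : 'rV[int]_n => exists w : 'rV_#|T|, u = w *m G)) => [|u v|i _].
  - by exists 0; rewrite mul0mx.
  - exact: spanD.
  by have := spang (inr i) (q 0 i); rewrite /= scalerMnr.
have [L uL [R uR [d _ GE]]] := int_Smith_normal_form G.
set D := (X in L *m X *m R) in GE.
(* There are at least [n] generators, so every column of the Smith form has a diagonal entry. *)
have leT : (n <= #|T|)%N by rewrite card_sum card_ord leq_addl.
have colD (w : 'rV_#|T|) j : (w *m D) 0 j = w 0 (widen_ord leT j) * d`_j.
  rewrite mxE (bigD1 (widen_ord leT j)) //= big1 => [|i ij].
    by rewrite addr0 mxE eqxx mulr1n.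
  rewrite mxE (_ : (i == j :> nat) = false) ?mulr0n ?mulr0 //.
  by apply: contraNF ij => /eqP ij; apply/eqP/val_inj.
have HD' l : H l <-> forall j, (d`_j %| (l *m invmx R) 0%R j)%Z.
  rewrite HG; split=> [[w ->] j|h].
    by rewrite GE !mulmxA mulmxK // colD dvdz_mull.
  pose w : 'rV_#|T| := \row_i (if insub (i : nat) is Some j
      then ((l *m invmx R) 0%R (j : 'I_n) %/ d`_j)%Z else 0).
  exists (w *m invmx L); rewrite GE !mulmxA mulmxKV //.
  rewrite -[LHS](mulmxKV uR); congr (_ *m _); apply/rowP => j.
  rewrite colD /w [X in _ = X * _]mxE (_ : insub _ = Some j); last by rewrite /= valK.
  by rewrite divzK.
(* The element N e_j R of [H] shows that the [j]-th elementary divisor divides N, so it is not 0. *)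
have d0 (j : 'I_n) : d`_j != 0.
  have /HD'/(_ j) := HN' ('e_j *m R); rewrite -scaler_nat -scalemxAl mulmxK // !mxE !eqxx mulr1.
  by apply: contraTneq => ->; rewrite dvd0z natz eqz_nat -lt0n.
exists (invmx R), (fun j : 'I_n => absz d`_j); split; first by rewrite unitmx_inv.
  by move=> i; rewrite absz_gt0.
move=> l; rewrite HD'; split=> [h|/congP h] => [|j].
  by apply/congP => j; rewrite [X in _ - X]mxE subr0; have := h j; rewrite !dvdzE.
by have := h j; rewrite [X in _ - X]mxE subr0 !dvdzE.
Qed.

End FiniteIndex.

Section IsogradedTrans.
Variables (k : fieldType) (L L' L'' : zmodType) (B B' B'' : naAlgType k).
Variables (g : grading L B) (g' : grading L' B') (g'' : grading L'' B'').

Lemma isograded_trans : isograded_isomorphic g g' -> isograded_isomorphic g' g'' ->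
  isograded_isomorphic g g''.
Proof.
move=> [phi [nu [bnu hnu]]] [phi' [nu' [bnu' hnu']]].
have Fm : {morph (phi' \o phi : {linear B -> B''}) : x y / x ** y}.
  by move=> x y /=; rewrite !iso_mul.
have FK : cancel (phi' \o phi) (iso_inv phi \o iso_inv phi').
  by move=> x; rewrite /= !iso_funK.
have FVK : cancel (iso_inv phi \o iso_inv phi') (phi' \o phi).
  by move=> x; rewrite /= !iso_invK.
exists (AlgIso Fm FK FVK), (nu' \o nu : {additive L -> L''}); split.
  exact: bij_comp.
by move=> l /=; rewrite -hnu' -hnu image_comp.
Qed.

End IsogradedTrans.

(** * Transport of a grading along a group isomorphism *)

Section Regrade.
Variables (k : fieldType) (L L' : zmodType) (B : naAlgType k) (g : grading L B).
Variables (nu : {additive L -> L'}) (mu : {additive L' -> L}).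
Hypotheses (nuK : cancel nu mu) (muK : cancel mu nu).

Fact regrade_span x : exists (s : seq L') (f : L' -> B),
  (forall l, g (mu l) (f l)) /\ x = \sum_(l <- s) f l.
Proof.
have [s [f [hf ->]]] := gcomp_span g x.
exists (map nu s), (f \o mu); split=> [l|]; first exact: hf.
by rewrite big_map; apply: eq_bigr => l _; rewrite /= nuK.
Qed.

Fact regrade_indep (s : seq L') (f : L' -> B) : uniq s ->
  (forall l, g (mu l) (f l)) -> \sum_(l <- s) f l = 0 ->
  forall l, l \in s -> f l = 0.
Proof.
move=> us hf s0 l ls; rewrite -[l]muK -[f _]/((f \o nu) _).
apply: (gcomp_indep (g := g) (s := map mu s)).
- by rewrite map_inj_uniq //; apply: can_inj muK.
- by move=> l'; rewrite /= -{1}[l']nuK; apply: hf.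
- by rewrite big_map -[RHS]s0; apply: eq_bigr => l' _; rewrite /= muK.
- exact: map_f.
Qed.

Fact regrade_mul l l' x y : g (mu l) x -> g (mu l') y -> g (mu (l + l')) (x ** y).
Proof. by rewrite raddfD; apply: gcomp_mul. Qed.

Definition regrade : grading L' B :=
  @Grading k L' B (fun l => g (mu l)) (fun l => gcomp_submod g (mu l))
    regrade_span regrade_indep regrade_mul.

Definition alg_iso_id : alg_iso B B :=
  @AlgIso k B B (idfun : {linear B -> B}) id (fun _ _ => erefl) (fun _ => erefl)
    (fun _ => erefl).

Lemma regrade_iso : graded_iso g regrade alg_iso_id nu.
Proof.
split; first by exists mu.
by move=> l /=; rewrite nuK; apply/seteqP; split=> [_ [x gx <-]|x gx] //; exists x.
Qed.

End Regrade.

(** A coset of [H] is determined by the reduced coordinates of its elements, which range over the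
    finite box. *)
Lemma finite_index_cong (n : nat) (L : zmodType) (m : 'I_n -> nat)
    (nu : {additive L -> 'rV[int]_n}) (H : set L) : (forall i, (0 < m i)%N) ->
  (forall l, H l <-> cong m (nu l) 0) -> finite_index H.
Proof.
move=> m_gt0 hH; pose f (b : 'rV[int]_n) := [set x | rmod m (nu x) = b].
apply: (@sub_finite_set _ _ (f @` [set` box m])); last first.
  exact/finite_image/finite_seq.
move=> _ [l _ <-]; exists (rmod m (nu l)); first exact: rmod_box.
apply/seteqP; split=> [x /= /eqP xl|_ [h Hh <-]]; last first.
  rewrite /f /= raddfD; apply/eqP; rewrite -cong_rmod congB addrAC subrr add0r.
  exact/hH.
exists (x - l); last by rewrite addrC subrK.
by apply/hH; rewrite raddfB -congB cong_rmod.
Qed.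

(** * Realization by multiloop algebras and the fgc criterion *)

Section PartOne.
Variables (k : fieldType) (char0 : [pchar k] =i pred0) (zeta : compatible_roots k).
Variables (n : nat) (L : zmodType) (B : naAlgType k) (gB : grading L B).

Lemma multiloop_realization : free_abelian_of_rank L n ->
  graded_central_simple gB -> finite_index (centroid_support gB) ->
  exists (A : naAlgType k) (m : 'I_n -> nat) (m_gt0 : forall i, (0 < m i)%N)
    (sg : 'I_n -> alg_iso A A),
    [/\ central_simple A, commuting_periods m sg &
        isograded_isomorphic gB (multiloop_grading zeta m_gt0 sg)].
Proof.
move=> [b [al alK bK]] gcs finG; have [_ gs] := gcs.
set be := (fun c : 'rV[int]_n => _) in alK bK.
have beB : {morph be : x y / x - y}.
  by move=> x y; rewrite /be -sumrB; apply: eq_bigr => i _; rewrite !mxE mulrzBr.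
have alB : {morph al : x y / x - y}.
  by move=> x y; apply: (can_inj alK); rewrite beB !bK.
have be0 : be 0 = 0 by have := beB 0 0; rewrite !subrr.
pose H : set 'rV[int]_n := [set q | centroid_support gB (be q)].
have H0 : H 0 by rewrite /H /= be0; apply: centroid_support0.
have HB x y : H x -> H y -> H (x - y).
  by move=> hx hy; rewrite /H /= beB; apply: centroid_supportB.
have alD : {morph al : x y / x + y}.
  have al0 : al 0 = 0 by have := alB 0 0; rewrite !subrr.
  by move=> x y; rewrite -[y in LHS]opprK alB -[- y]sub0r alB al0 sub0r opprK.
have finH : finite_index H.
  apply: (@sub_finite_set _ _ ((fun S : set L => al @` S) @`
      range (fun l => [set l + h | h in centroid_support gB]))).
    move=> _ [q _ <-]; exists [set be q + h | h in centroid_support gB].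
      by exists (be q).
    apply/seteqP; split=> [_ [_ [h hh <-] <-]|_ [h hh <-]].
      by exists (al h); rewrite ?alD ?alK // /H /= bK.
    by exists (be q + be h); rewrite ?alD ?alK //; exists (be h).
  exact: finite_image.
have [R [m [uR m_gt0 hR]]] := adapted_basis H0 HB finH.
(* [al] gives the coordinates in the given basis, and [R] passes to the basis adapted to the
   centroid support, where the latter becomes diag(m) Z^n. *)
pose nuf l := al l *m R; pose muf q := be (q *m invmx R).
have nufB : {morph nuf : x y / x - y} by move=> x y; rewrite /nuf alB mulmxBl.
have mufB : {morph muf : x y / x - y} by move=> x y; rewrite /muf mulmxBl beB.
pose nu : {additive L -> 'rV[int]_n} :=
  HB.pack nuf (GRing.isZmodMorphism.Build L 'rV[int]_n nuf nufB).
pose mu : {additive 'rV[int]_n -> L} :=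
  HB.pack muf (GRing.isZmodMorphism.Build 'rV[int]_n L muf mufB).
have nuK : cancel nu mu by move=> l; rewrite /= /nuf /muf mulmxK // bK.
have muK : cancel mu nu by move=> l; rewrite /= /nuf /muf alK mulmxKV.
have iso := regrade_iso gB nuK muK.
have isog : isograded_isomorphic gB (regrade gB nuK muK) by exists (alg_iso_id B), nu.
have [d|A [sg [csA per isoA]]] := graded_central_simple_multiloop char0 zeta m_gt0
    (graded_central_simple_iso isog gcs).
  rewrite -[d]muK (graded_iso_centroid_supportE _ iso) -[l in _ <-> cong m l 0]/(al _ *m R) -hR.
  by rewrite /H /= bK.
exists A, m, m_gt0, sg; split=> //; exact: isograded_trans isog isoA.
Qed.

Variables (A : naAlgType k) (m : 'I_n -> nat) (m_gt0 : forall i, (0 < m i)%N).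
Variable sg : 'I_n -> alg_iso A A.
Hypotheses (csA : central_simple A) (per : commuting_periods m sg).
Hypothesis isoB : isograded_isomorphic gB (multiloop_grading zeta m_gt0 sg).

Lemma isograded_multiloop_graded_central_simple :
  graded_central_simple gB /\ finite_index (centroid_support gB).
Proof.
split.
  apply: graded_central_simple_iso (isograded_sym isoB) _.
  exact: multiloop_graded_central_simple.
have [phi [nu giso]] := isoB; apply: (finite_index_cong (nu := nu) m_gt0) => l.
rewrite -(graded_iso_centroid_supportE _ giso).
exact: multiloop_centroid_support.
Qed.

Lemma isograded_multiloop_fgc : finite_dimensional A <-> fgc B.
Proof.
have [phi _] := isoB; split=> [fA|fB].
  by apply: (fgc_iso (iso_sym phi)); apply: finite_dimensional_fgc.
by apply: (@fgc_finite_dimensional _ char0 zeta _ _ _ m_gt0 sg) => //; apply: fgc_iso phi fB.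
Qed.

End PartOne.

(** * Integer matrices and products of powers of automorphisms *)

Section IntegerLattice.
Variable n : nat.
Implicit Types (m : 'I_n -> nat) (P N : 'M[int]_n).

Lemma rV_int_ind (H : 'rV[int]_n -> Prop) : H 0 ->
  (forall x y, H x -> H y -> H (x - y)) -> (forall i, H (delta_mx 0 i)) ->
  forall x, H x.
Proof.
move=> H0 HB Hd.
have HN x : H x -> H (- x) by move=> hx; rewrite -sub0r; apply: HB.
have HD x y : H x -> H y -> H (x + y).
  by move=> hx hy; rewrite -[y]opprK; apply: HB => //; apply: HN.
have Hn x (q : nat) : H x -> H (x *+ q).
  by move=> hx; elim: q => [|q IH]; rewrite ?mulr0n // mulrS; apply: HD.
move=> x; rewrite [x]row_sum_delta; elim/big_ind: _ => // i _.
rewrite -[x 0 i]intz scaler_int; case: (x 0 i) => q; first exact: Hn.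
by rewrite NegzE mulrNz; apply/HN/Hn.
Qed.

Lemma additive_rV_mx (nu : {additive 'rV[int]_n -> 'rV[int]_n}) x :
  nu x = x *m \matrix_i nu (delta_mx 0 i).
Proof.
move: x; apply: rV_int_ind => [|x y hx hy|i]; first by rewrite raddf0 mul0mx.
  by rewrite raddfB mulmxBl hx hy.
by rewrite -rowE rowK.
Qed.

Lemma mulmx_rV_inj (N N' : 'M[int]_n) : (forall x : 'rV_n, x *m N = x *m N') -> N = N'.
Proof. by move=> h; apply/row_matrixP => i; rewrite !rowE. Qed.

Definition scale_mx m : 'M[int]_n := diag_mx (\row_i (m i)%:Z).

Lemma mul_scale_mx m P i j : (P *m scale_mx m) i j = P i j * (m j)%:Z.
Proof. by rewrite mul_mx_diag !mxE. Qed.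

Lemma scale_mx_mul m P i j : (scale_mx m *m P) i j = (m i)%:Z * P i j.
Proof. by rewrite mul_diag_mx !mxE. Qed.

Lemma dil_scale_mx m q : dil m q = q *m scale_mx m.
Proof. by apply/rowP => j; rewrite mul_mx_diag !mxE. Qed.

Lemma cong0_dil m d : cong m d 0 <-> exists q, d = dil m q.
Proof.
split=> [/congP h|[q ->]]; last first.
  by apply/congP => i; rewrite !mxE subr0 dvdz_mull.
exists (\row_i (d 0%R i %/ m i)%Z); apply/rowP => i; rewrite !mxE.
by rewrite divzK //; have := h i; rewrite mxE subr0.
Qed.

Lemma scale_mx_inj m P P' : (forall i, (0 < m i)%N) ->
  P *m scale_mx m = P' *m scale_mx m -> P = P'.
Proof.
move=> m0 /matrixP h; apply/matrixP => i j; have := h i j.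
by rewrite !mul_scale_mx; apply: mulIf; rewrite eqz_nat -lt0n.
Qed.

(** [N] carries diag(m) Z^n into diag(m') Z^n and [N'] carries it back. [P] is the matrix of [N] in
    the bases m_i e_i and m'_j e_j, and the matrix obtained likewise from [N'] is its inverse. *)
Lemma lattice_iso_mx m m' N N' : (forall i, (0 < m i)%N) -> (forall i, (0 < m' i)%N) ->
  N *m N' = 1%:M ->
  (forall d, cong m d 0 -> cong m' (d *m N) 0) ->
  (forall d, cong m' d 0 -> cong m (d *m N') 0) ->
  exists2 P, P \in unitmx & P *m scale_mx m' = scale_mx m *m N.
Proof.
move=> m0 m'0 NN' h h'.
have aux (m1 m2 : 'I_n -> nat) (Q : 'M[int]_n) :
    (forall d, cong m1 d 0 -> cong m2 (d *m Q) 0) ->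
    exists P, P *m scale_mx m2 = scale_mx m1 *m Q.
  move=> hQ; exists (\matrix_(i, j) ((m1 i)%:Z * Q i j %/ m2 j)%Z).
  apply/matrixP => i j; rewrite mul_scale_mx scale_mx_mul mxE divzK //.
  have /hQ/congP/(_ j) : cong m1 (dil m1 (delta_mx 0 i)) 0.
    by apply/cong0_dil; exists (delta_mx 0 i).
  by rewrite dil_scale_mx -mulmxA -rowE [X in _ - X]mxE subr0 mxE scale_mx_mul.
have [P PE] := aux _ _ _ h; have [P' P'E] := aux _ _ _ h'.
exists P => //; have /mulmx1_unit[] // : P *m P' = 1%:M.
apply: (scale_mx_inj m0).
by rewrite -mulmxA P'E mulmxA PE -mulmxA NN' mulmx1 mul1mx.
Qed.

(** Transposing and clearing the denominator turns the rational equation for Q into an integral one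
    for N = Q^T, adapted to row vectors. *)
Lemma admissibleP m m' P : (forall i, (0 < m i)%N) ->
  admissible m' m P <-> exists2 N, N \in unitmx & P *m scale_mx m' = scale_mx m *m N.
Proof.
move=> m0.
have pE (m1 : 'I_n -> nat) : period_mx m1 = map_mx intr (scale_mx m1).
  by rewrite map_diag_mx; congr diag_mx; apply/rowP => i; rewrite !mxE.
have um : period_mx m \in unitmx.
  rewrite unitmxE det_diag unitfE; apply/prodf_neq0 => i _.
  by rewrite mxE pnatr_eq0 -lt0n.
have tE (m1 : 'I_n -> nat) : (period_mx m1)^T = period_mx m1 by rewrite tr_diag_mx.
have key (Q : 'M[int]_n) :
    period_mx m' *m (map_mx intr P)^T *m invmx (period_mx m) = map_mx intr Q <->
    P *m scale_mx m' = scale_mx m *m Q^T.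
  split=> [h|h].
    have : period_mx m' *m (map_mx intr P)^T = map_mx intr Q *m period_mx m.
      by rewrite -h mulmxKV.
    move=> /(congr1 trmx); rewrite !trmx_mul !tE trmxK !pE map_trmx -!map_mxM.
    move=> hh; apply/matrixP => i j; apply: (@intr_inj rat).
    by move/matrixP/(_ i j): hh; rewrite ![map_mx _ _ _ _]mxE.
  have : period_mx m' *m (map_mx intr P)^T = map_mx intr Q *m period_mx m.
    apply: trmx_inj; rewrite !trmx_mul !tE trmxK !pE map_trmx -!map_mxM.
    by rewrite h.
  by move=> ->; rewrite mulmxK.
split=> [[Q uQ /key h]|[N uN h]].
  by exists Q^T; rewrite ?unitmx_tr.
by exists N^T; rewrite ?unitmx_tr //; apply/key; rewrite trmxK.
Qed.

End IntegerLattice.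

Section AutPow.
Variables (k : fieldType) (A : naAlgType k).
Implicit Types (s : alg_iso A A) (u v : A) (a : k).

Lemma aut_pow_linear s p : linear (aut_pow s p).
Proof.
by case: p => q; [exact: iter_linear|exact: (iter_linear (iso_inv s : {linear A -> A}))].
Qed.

Lemma aut_pow_eigen s p a v : a != 0 -> s v = a *: v -> aut_pow s p v = a ^ p *: v.
Proof.
move=> a0 sv; case: p => q.
  elim: q => [|q IH]; first by rewrite scale1r.
  by rewrite /= in IH *; rewrite IH linearZ /= sv scalerA -!exprnP exprSr.
have iv : iso_inv s v = a^-1 *: v.
  by apply: (@iso_inj _ _ _ s); rewrite iso_invK linearZ /= sv scalerA mulVf // scale1r.
rewrite [X in a ^ X]NegzE -exprz_inv -exprnP /aut_pow; elim: q.+1 => [|r IH].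
  by rewrite scale1r.
by rewrite iterS IH linearZ /= iv scalerA -exprSr.
Qed.

Variable (n : nat).
Implicit Types (sg : 'I_n -> alg_iso A A) (p : 'I_n -> int).

Definition aut_prod sg p : A -> A :=
  \big[(fun f g : A -> A => f \o g)/id]_(i < n) aut_pow (sg i) (p i).

Fact aut_prod_linear sg p : linear (aut_prod sg p).
Proof.
rewrite /aut_prod; elim/big_ind: _ => // [f g lf lg a u v /=|i _].
  by rewrite lg lf.
exact: aut_pow_linear.
Qed.

HB.instance Definition _ sg p :=
  GRing.isLinear.Build k A A _ (aut_prod sg p) (aut_prod_linear sg p).

Lemma aut_prod_eigen (zeta : compatible_roots k) (m : 'I_n -> nat) sg p l v :
  (forall i, (0 < m i)%N) -> v \in eigencomp zeta m sg l ->
  aut_prod sg p v = (\prod_i zeta (m i) ^ (l 0 i * p i)) *: v.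
Proof.
move=> m0 /eigencompP hv; rewrite /aut_prod.
apply: (big_rec2 (fun (F : A -> A) (a : k) => F v = a *: v)) => [|i a F _ /= ->].
  by rewrite scale1r.
rewrite (lin_Z (aut_pow_linear _ _)) (aut_pow_eigen _ _ (hv i)).
  by rewrite scalerA mulrC exprz_exp.
by rewrite expfz_neq0 // root_neq0.
Qed.

End AutPow.

(** * Isograded isomorphism from related automorphisms *)

Section Related.
Variables (k : fieldType) (char0 : [pchar k] =i pred0) (zeta : compatible_roots k).
Variables (n : nat) (A A' : naAlgType k) (m m' : 'I_n -> nat).
Hypotheses (m_gt0 : forall i, (0 < m i)%N) (m'_gt0 : forall i, (0 < m' i)%N).
Variables (sg : 'I_n -> alg_iso A A) (sg' : 'I_n -> alg_iso A' A').
Hypotheses (per : commuting_periods m sg) (per' : commuting_periods m' sg').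
Implicit Types (l : 'rV[int]_n) (P N : 'M[int]_n).

Local Notation M := (multiloop zeta sg m_gt0).
Local Notation gM := (multiloop_grading zeta m_gt0 sg).
Local Notation M' := (multiloop zeta sg' m'_gt0).
Local Notation gM' := (multiloop_grading zeta m'_gt0 sg').
Local Notation eigen := (eigencomp zeta m sg).
Local Notation eigen' := (eigencomp zeta m' sg').

(** Entrywise the hypothesis reads P_ij m'_j = m_i N_ij, so zeta(m_i)^P_ij = zeta(m'_j)^N_ij by
    compatibility of the roots. *)
Lemma aut_prod_col_eigen P N j l v : P *m scale_mx m' = scale_mx m *m N ->
  v \in eigen l -> aut_prod sg (P^~ j) v = zeta (m' j) ^ (l *m N) 0 j *: v.
Proof.
move=> PN hv; rewrite (aut_prod_eigen (P^~ j) m_gt0 hv); congr (_ *: _).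
rewrite mxE.
have z0 := root_neq0 zeta (m'_gt0 j).
rewrite (big_morph (fun t : int => zeta (m' j) ^ t) (id1 := 1) (op1 := *%R)) //; last first.
  by move=> x y; rewrite expfzDr.
apply: eq_bigr => i _; rewrite -!exprz_exp; rewrite !exprz_exp mulrC [l 0 i * _]mulrC -!exprz_exp.
congr (_ ^ _); apply: root_expz_ratio => //.
have /matrixP/(_ i j) := PN; rewrite mul_scale_mx scale_mx_mul => ->.
by rewrite mulrC.
Qed.

Lemma related_eigen P N (phi : alg_iso A A') l v : P *m scale_mx m' = scale_mx m *m N ->
  related_by sg sg' P phi -> v \in eigen l -> phi v \in eigen' (l *m N).
Proof.
move=> PN rel hv; apply/eigencompP => j; rewrite (rel j) /= iso_funK.
by rewrite -/(aut_prod sg (P^~ j) v) (aut_prod_col_eigen j PN hv) linearZ.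
Qed.

(** The eigenspaces span [A], so it suffices that both sides have the same eigenvalue on each of
    them. *)
Lemma eigen_related P N (phi : alg_iso A A') : P *m scale_mx m' = scale_mx m *m N ->
  (forall l v, v \in eigen l -> phi v \in eigen' (l *m N)) ->
  related_by sg sg' P phi.
Proof.
move=> PN hphi j w /=; rewrite -/(aut_prod sg (P^~ j) (iso_inv phi w)).
rewrite -{1}[w](iso_invK phi); move: (iso_inv phi w) => {w}.
apply: (eigen_ind char0 (zeta := zeta) m_gt0 per) => [|u v hu hv|l u hu].
- by rewrite !linear0.
- by rewrite !linearD /= hu hv.
have /eigencompP -> := hphi _ _ hu.
by rewrite (aut_prod_col_eigen j PN hu) linearZ.
Qed.

Lemma cong_lattice P N l l' : P \in unitmx -> N \in unitmx ->
  P *m scale_mx m' = scale_mx m *m N -> cong m' (l *m N) (l' *m N) = cong m l l'.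
Proof.
move=> uP uN PN; rewrite congB -mulmxBl [RHS]congB; set d := l - l'.
apply/idP/idP => /cong0_dil[q]; rewrite dil_scale_mx => qE; apply/cong0_dil.
  exists (q *m invmx P); rewrite dil_scale_mx.
  have /(congr1 (mulmx^~ (invmx N))) := qE; rewrite mulmxK // => ->.
  by rewrite -[q in LHS](mulmxKV uP) -(mulmxA _ P) PN mulmxA mulmxK.
by exists (q *m P); rewrite dil_scale_mx -mulmxA PN mulmxA -qE.
Qed.

(** The isomorphism sends v z^l to phi(v) z^(l N). It is well defined and invertible because [phi]
    intertwines the joint eigenprojectors, which is [phi_pr]. *)
Lemma related_isograded P N (phi : alg_iso A A') : P \in unitmx -> N \in unitmx ->
  P *m scale_mx m' = scale_mx m *m N -> related_by sg sg' P phi ->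
  isograded_isomorphic gM gM'.
Proof.
move=> uP uN PN rel.
pose pr := eigenproj zeta m sg; pose pr' := eigenproj zeta m' sg'.
have phi_pr l u : pr' (l *m N) (phi u) = phi (pr l u).
  elim/(eigen_ind char0 (zeta := zeta) m_gt0 per): u => [|u v hu hv|p u hu].
  - by rewrite /pr /pr' !linear0.
  - by rewrite /pr /pr' !linearD /= -/pr -/pr' hu hv.
  rewrite /pr /pr' (eigenproj_on_eigen char0 m_gt0 _ hu).
  rewrite (eigenproj_on_eigen char0 m'_gt0 _ (related_eigen PN rel hu)).
  by rewrite (cong_lattice _ _ uP uN PN); case: ifP => // _; rewrite linear0.
pose ml := mlift zeta m_gt0 per; pose ml' := mlift zeta m'_gt0 per'.
pose F : {linear M -> M'} := gext gM (fun l => ml' (l *m N) \o phi \o @ev _ _ _ _ _ _ _).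
pose F' : {linear M' -> M} :=
  gext gM' (fun l => ml (l *m invmx N) \o (iso_inv phi : {linear A' -> A}) \o @ev _ _ _ _ _ _ _).
have FE l f : gM l f -> F f = ml' (l *m N) (phi (ev f)) by apply: gext_hom.
have F'E l f : gM' l f -> F' f = ml (l *m invmx N) (iso_inv phi (ev f)) by apply: gext_hom.
have Fg l f : gM l f -> gM' (l *m N) (F f).
  by move=> gf; rewrite (FE _ _ gf); apply: mlift_in.
have pr_ev l f : gM l f -> pr l (ev f) = ev f.
  by move=> gf; apply: eigenproj_id => //; apply: ev_in.
have pr'_ev l f : gM' l f -> pr' l (ev f) = ev f.
  by move=> gf; apply: eigenproj_id => //; apply: ev_in.
have evF l f : gM l f -> ev (F f) = phi (ev f).
  by move=> gf; rewrite (FE _ _ gf) ev_mlift -/pr' phi_pr pr_ev.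
pose nuf (l : 'rV[int]_n) := l *m N.
have nufB : {morph nuf : x y / x - y} by move=> x y; rewrite /nuf mulmxBl.
pose nu : {additive 'rV[int]_n -> 'rV[int]_n} :=
  HB.pack nuf (GRing.isZmodMorphism.Build 'rV[int]_n 'rV[int]_n nuf nufB).
suff [psi hpsi] : exists psi : alg_iso M M', graded_iso gM gM' psi nu by exists psi, nu.
apply: (@isograded_build _ _ _ _ _ _ _ F F' nu).
- by exists (mulmx^~ (invmx N)) => l; rewrite /= /nuf ?mulmxK ?mulmxKV.
- exact: Fg.
- move=> l f gf; rewrite (F'E _ _ gf) /= /nuf mulmxK //; exact: mlift_in.
- move=> l f gf; rewrite (F'E _ _ (Fg _ _ gf)) (evF _ _ gf) iso_funK mulmxK //.
  exact: mlift_ev.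
- move=> l f gf; have gF'f : gM l (F' f).
    by rewrite (F'E _ _ gf) /= /nuf mulmxK //; apply: mlift_in.
  rewrite (FE _ _ gF'f) (F'E _ _ gf) /= /nuf mulmxK // ev_mlift -/pr -phi_pr iso_invK.
  by rewrite (pr'_ev _ _ gf); apply: mlift_ev.
- move=> l l' f h gf gh; rewrite (FE _ _ (gcomp_mul gf gh)) ev_mul iso_mul.
  have gFF := gcomp_mul (Fg _ _ gf) (Fg _ _ gh).
  by rewrite -(evF _ _ gf) -(evF _ _ gh) -ev_mul mulmxDl; apply: mlift_ev.
Qed.

(** * Supports that generate the grading group *)

Section Generating.
Hypotheses (gen : gen_subgroup (gsupport gM) = setT).
Hypotheses (gen' : gen_subgroup (gsupport gM') = setT).
Variables (P : 'M[int]_n) (phi : alg_iso A A').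
Hypotheses (uP : P \in unitmx) (rel : related_by sg sg' P phi).

Lemma gen_subgroup_ind (S H : set 'rV[int]_n) : gen_subgroup S = setT ->
  H 0 -> (forall x y, H x -> H y -> H (x - y)) -> S `<=` H -> forall x, H x.
Proof.
move=> gS H0 HB SH x; have : gen_subgroup S x by rewrite gS.
apply; split=> //; split; first by rewrite inE.
by move=> u v; rewrite !inE; apply: HB.
Qed.

Lemma gsupport_ev (A1 : naAlgType k) (m1 : 'I_n -> nat) (m1_gt0 : forall i, (0 < m1 i)%N)
    (s1 : 'I_n -> alg_iso A1 A1) l : commuting_periods m1 s1 ->
  gsupport (multiloop_grading zeta m1_gt0 s1) l ->
  exists2 v, v \in eigencomp zeta m1 s1 l & v <> 0.
Proof.
move=> per1 /(setP0 (gcomp0 _ l))[f gf f0].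
exists (ev f); first exact: ev_in.
by move=> f1; apply: f0; rewrite -(mlift_ev char0 per1 gf) f1 linear0.
Qed.

(** The period m'_j of [sg' j] makes the product of the zeta(m_i)^(l_i P_ij m'_j) equal to 1 for [l]
    in the first support, hence for all [l]. At l = e_i this says that m_i divides P_ij m'_j, so [N]
    is integral; its invertibility comes from the second support. *)
Lemma generating_lattice :
  exists2 N, N \in unitmx & P *m scale_mx m' = scale_mx m *m N.
Proof.
have z0 i : zeta (m i) != 0 by apply: root_neq0.
have div i j : (m i %| P i j * m' j)%Z.
  rewrite -(root_expz_eq1 zeta) //.
  pose H : set 'rV[int]_n := [set l | \prod_i zeta (m i) ^ (l 0 i * (P i j * m' j)) = 1].
  have Hall : forall l, H l.
    apply: (gen_subgroup_ind gen) => [|x y hx hy|l].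
    - by rewrite /H /= big1 // => i' _; rewrite mxE mul0r expr0z.
    - rewrite /H /= in hx hy *; under eq_bigr do rewrite !mxE mulrBl expfzDr // -invr_expz.
      by rewrite prodf_div hx hy divr1.
    move=> /gsupport_ev[//|v hv v0]; rewrite /H /=.
    have sv : sg' j (phi v) = (\prod_i zeta (m i) ^ (l 0 i * P i j)) *: phi v.
      rewrite (rel j) /= iso_funK -/(aut_prod sg (P^~ j) v).
      by rewrite (aut_prod_eigen (P^~ j) m_gt0 hv) linearZ.
    have : iter (m' j) (sg' j) (phi v) = phi v by apply: per'.2.
    have -> q : iter q (sg' j) (phi v) = (\prod_i zeta (m i) ^ (l 0 i * P i j)) ^+ q *: phi v.
      elim: q => [|q IH]; first by rewrite scale1r.
      by rewrite iterS IH linearZ /= sv scalerA -exprSr.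
    move=> /eqP; rewrite -subr_eq0 -[X in _ - X]scale1r -scalerBl scaler_eq0.
    move=> /orP[|/eqP phiv]; last first.
      by case: v0; apply: (@iso_inj _ _ _ phi); rewrite phiv linear0.
    rewrite subr_eq0 -prodrXl => /eqP h; rewrite -[RHS]h; apply: eq_bigr => i' _.
    by rewrite exprnP exprz_exp mulrA.
  have := Hall (delta_mx 0 i); rewrite /H /= (bigD1 i) //= big1 => [|i' ii'].
    by rewrite mulr1 mxE !eqxx mul1r => ->.
  by rewrite mxE eqxx (negbTE ii') mul0r expr0z.
pose N : 'M[int]_n := \matrix_(i, j) ((P i j * (m' j)%:Z) %/ m i)%Z.
have PN : P *m scale_mx m' = scale_mx m *m N.
  apply/matrixP => i j; rewrite mul_scale_mx scale_mx_mul mxE mulrC [RHS]mulrC.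
  by rewrite divzK // mulrC.
exists N => //.
(* The image of [N] is a subgroup, so it suffices to reach the degrees [l'] of the second support. A
   nonzero eigencomponent of the preimage of an eigenvector gives [l] with l N congruent to l'
   modulo m'. *)
have im : forall l', exists x : 'rV[int]_n, l' = x *m N.
  apply: (gen_subgroup_ind gen') => [|x y [u ->] [v ->]|l'].
  - by exists 0; rewrite mul0mx.
  - by exists (u - v); rewrite mulmxBl.
  move=> /gsupport_ev[//|w /eigencompP hw w0].
  pose u := iso_inv phi w.
  have [l prl] : exists l, eigenproj zeta m sg l u <> 0.
    apply: contrapT => hn; apply: w0; rewrite -(iso_invK phi w) -/u.
    rewrite (eigenproj_sum char0 zeta m_gt0 per 0 u) big1 ?linear0 // => b _.
    by apply: contrapT => h; apply: hn; exists (b + 0).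
  have c : cong m' (l *m N) l'.
    apply/congP => j; rewrite -(root_expz_eq zeta) //.
    have Su : aut_prod sg (P^~ j) u = zeta (m' j) ^ (l' 0 j) *: u.
      apply: (@iso_inj _ _ _ phi); rewrite linearZ /= iso_invK -hw (rel j) /=.
      by [].
    have comm x : eigenproj zeta m sg l (aut_prod sg (P^~ j) x) =
        aut_prod sg (P^~ j) (eigenproj zeta m sg l x).
      elim/(eigen_ind char0 (zeta := zeta) m_gt0 per): x => [|x y hx hy|p x hx].
      - by rewrite !linear0.
      - by rewrite !linearD /= hx hy.
      rewrite (aut_prod_eigen (P^~ j) m_gt0 hx) linearZ /=.
      rewrite (eigenproj_on_eigen char0 m_gt0 _ hx); case: ifP => _.
        by rewrite (aut_prod_eigen (P^~ j) m_gt0 hx).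
      by rewrite !linear0.
    have := congr1 (eigenproj zeta m sg l) Su; rewrite comm linearZ /=.
    rewrite (aut_prod_col_eigen j PN (eigenproj_in _ m_gt0 per l u)).
    move=> /eqP; rewrite -subr_eq0 -scalerBl scaler_eq0 subr_eq0.
    by move=> /orP[//|/eqP].
  rewrite cong_sym congB in c; have [q qE] := (cong0_dil _ _).1 c.
  (* The remainder q diag(m') is also in the image of [N], since diag(m) N = P diag(m') with [P]
     invertible. *)
  exists (q *m invmx P *m scale_mx m + l).
  rewrite mulmxDl -(mulmxA _ (scale_mx m)) -PN mulmxA mulmxKV // -dil_scale_mx -qE.
  by rewrite subrK.
pose N' : 'M[int]_n := \matrix_i projT1 (cid (im (delta_mx 0 i))).
have /mulmx1_unit[] // : N' *m N = 1%:M.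
apply/row_matrixP => i; rewrite row_mul rowK row1; by case: cid.
Qed.

End Generating.
End Related.

(** * Related automorphisms from isograded isomorphism *)

Lemma closed_field_root (k : closedFieldType) (a : k) (m : nat) : (0 < m)%N ->
  exists b : k, b ^+ m = a.
Proof.
move=> m0; have /closed_rootP[b] : size ('X^m - a%:P : {poly k}) != 1%N.
  by rewrite size_XnsubC // eqSS -lt0n.
by rewrite rootE !hornerE subr_eq0 => /eqP; exists b.
Qed.

Section Necessity.
Variables (k : closedFieldType) (char0 : [pchar k] =i pred0) (zeta : compatible_roots k).
Variables (n : nat) (A A' : naAlgType k) (m m' : 'I_n -> nat).
Hypotheses (m_gt0 : forall i, (0 < m i)%N) (m'_gt0 : forall i, (0 < m' i)%N).
Variables (sg : 'I_n -> alg_iso A A) (sg' : 'I_n -> alg_iso A' A').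
Hypotheses (per : commuting_periods m sg) (per' : commuting_periods m' sg').
Hypotheses (csA : central_simple A) (csA' : central_simple A').
Implicit Types (l d : 'rV[int]_n).

Local Notation M := (multiloop zeta sg m_gt0).
Local Notation gM := (multiloop_grading zeta m_gt0 sg).
Local Notation M' := (multiloop zeta sg' m'_gt0).
Local Notation gM' := (multiloop_grading zeta m'_gt0 sg').
Local Notation mlift := (mlift zeta m_gt0 per).

Variables (phi : alg_iso M M') (nu : {additive 'rV[int]_n -> 'rV[int]_n}).
Hypothesis giso : graded_iso gM gM' phi nu.

Let N : 'M[int]_n := \matrix_i nu (delta_mx 0 i).

Let nuE l : nu l = l *m N.
Proof. exact: additive_rV_mx. Qed.

(** An isograded isomorphism maps one centroid support onto the other, and these are the lattices
    diag(m) Z^n and diag(m') Z^n. *)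
Lemma necessary_lattice : N \in unitmx /\
  exists2 P, P \in unitmx & P *m scale_mx m' = scale_mx m *m N.
Proof.
have [nu' [nuK nu'K] _] := graded_iso_sym giso.
pose N' : 'M[int]_n := \matrix_i nu' (delta_mx 0 i).
have nu'E l : nu' l = l *m N' by apply: additive_rV_mx.
have NN' : N *m N' = 1%:M.
  by apply: mulmx_rV_inj => x; rewrite mulmxA -nuE -nu'E nuK mulmx1.
split; first by case/mulmx1_unit: NN'.
have E d : cong m d 0 <-> cong m' (nu d) 0.
  rewrite -(multiloop_centroid_support char0 zeta m_gt0 per csA).
  rewrite -(multiloop_centroid_support char0 zeta m'_gt0 per' csA').
  by rewrite (graded_iso_centroid_supportE _ giso).
apply: (lattice_iso_mx m_gt0 m'_gt0 NN') => d; first by rewrite -nuE => /E.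
by rewrite -nu'E => h; apply/E; rewrite nu'K.
Qed.

Lemma ev_eq0 l (f : M) : gM l f -> ev f = 0 -> f = 0.
Proof. by move=> gf f0; rewrite -(mlift_ev char0 per gf) f0 linear0. Qed.

(* G is phi followed by specialization and divided by a character chi of Z^n,
   for which chi (m_i e_i) is the scalar by which phi fails to intertwine the
   shifts of degree m_i e_i. *)
Lemma invariant_specialization : exists (chi : 'rV[int]_n -> k) (G : {linear M -> A'}),
  [/\ forall l, chi l != 0, forall l l', chi (l + l') = chi l * chi l',
      forall l f, gM l f -> G f = (chi l)^-1 *: ev (phi f)
    & forall l l' f, gM l f -> cong m l l' -> G (mlift l' (ev f)) = G f].
Proof.
(* Conjugated by [phi], the shift of degree [d] is a centroid element of the second multiloop
   algebra, so it specializes to a scalar on the central algebra [A']. *)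
have cT d : cong m d 0 -> exists2 a : k, a != 0 &
    forall f : M, ev (phi (mshift per d f)) = a *: ev (phi f).
  move=> cd; have [cs _] := mshift_centroid char0 zeta m_gt0 per cd.
  have [a ha] := centroid_descends char0 per' csA' (centroid_conj phi cs).
  have haf f : ev (phi (mshift per d f)) = a *: ev (phi f).
    by rewrite -(ha (phi f)) /= iso_funK.
  (* If the scalar were 0, [phi] would kill all shifts of homogeneous elements; every lift of [x]
     would vanish, and so would [x]. *)
  exists a => //; apply/eqP => a0.
  have [[x [y xy]] _] := csA.2; apply: xy; suff -> : x = 0 by rewrite namul0l.
  apply: (@mlift_eq0 _ char0 zeta _ _ _ m_gt0 _ per _ 0) => b _; rewrite addr0.
  set f := mlift b x; have gf : gM b f by apply: mlift_in.
  have := haf f; rewrite a0 scale0r (mshift_hom per d gf) => ev0.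
  have gT : gM (b + d) (mlift (b + d) (ev f)) by apply: mlift_in.
  have phi0 : phi (mlift (b + d) (ev f)) = 0.
    by rewrite -(mlift_ev char0 per' (graded_iso_in giso gT)) ev0 linear0.
  have T0 : mlift (b + d) (ev f) = 0.
    by apply: (@iso_inj _ _ _ phi); rewrite phi0 linear0.
  apply: (ev_eq0 gf); rewrite -(ev_mlift_ev char0 per gf (l' := b + d)) ?T0 ?linear0 //.
  by rewrite [b + d]addrC -cong_subr subrr cong_sym.
have cd i : cong m (dil m (delta_mx 0 i)) 0 by apply/cong0_dil; exists (delta_mx 0 i).
pose a i := s2val (cid2 (cT _ (cd i))).
have a0 i : a i != 0 by rewrite /a; case: cid2.
have aP i f : ev (phi (mshift per (dil m (delta_mx 0 i)) f)) = a i *: ev (phi f).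
  by rewrite /a; case: cid2.
pose b i := projT1 (cid (closed_field_root (a i) (m_gt0 i))).
have bP i : b i ^+ m i = a i by rewrite /b; case: cid.
have b0 i : b i != 0.
  by apply: contraNneq (a0 i) => bi; rewrite -bP bi expr0n eqn0Ngt m_gt0.
pose chi l := \prod_i b i ^ l 0 i.
have chi0 l : chi l != 0 by apply/prodf_neq0 => i _; apply: expfz_neq0.
have chiD l l' : chi (l + l') = chi l * chi l'.
  by rewrite -big_split; apply: eq_bigr => i _; rewrite mxE expfzDr.
have chid i : chi (dil m (delta_mx 0 i)) = a i.
  rewrite /chi (bigD1 i) //= big1 => [|j ji].
    by rewrite !mxE !eqxx mul1r mulr1 -bP.
  by rewrite !mxE eqxx (negbTE ji) mul0r expr0z.
pose G : {linear M -> A'} :=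
  gext gM (fun l => GRing.scale (chi l)^-1 \o @ev _ _ _ _ _ _ _ \o phi).
have GE l f : gM l f -> G f = (chi l)^-1 *: ev (phi f) by apply: gext_hom.
exists chi, G; split=> //.
(* The [q] for which moving by [dil m q] preserves [G] form a subgroup, so only the basis vectors
   matter, where [chi] was chosen to match the scalars [a i]. *)
suff key q : forall l f, gM l f -> G (mlift (l + dil m q) (ev f)) = G f.
  move=> l l' f gf; rewrite cong_sym congB => /cong0_dil[q qE].
  by rewrite -(key q l f gf) -qE addrC subrK.
have cong_dil l q' : cong m l (l + dil m q').
  by rewrite addrC -cong_subr subrr cong_sym; apply/cong0_dil; exists q'.
have dil0 : dil m 0 = 0 by apply/rowP => i; rewrite !mxE mul0r.
have dilB x y : dil m (x - y) = dil m x - dil m y.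
  by apply/rowP => i; rewrite !mxE mulrBl.
move: q; apply: rV_int_ind => [|x y hx hy|i] l f gf.
- by rewrite dil0 addr0 (mlift_ev char0 per gf).
- have gf' : gM (l + dil m (x - y)) (mlift (l + dil m (x - y)) (ev f)) by apply: mlift_in.
  rewrite -(hy _ _ gf') (ev_mlift_ev char0 per gf (cong_dil _ _)).
  by rewrite dilB -addrA subrK hx.
have gT := mlift_in zeta m_gt0 per (l + dil m (delta_mx 0 i)) (ev f).
rewrite (GE _ _ gT) (GE _ _ gf) -(mshift_hom per _ gf) aP chiD chid invfM scalerA.
by rewrite -mulrA mulVf // mulr1.
Qed.

(** As [G] does not see shifts by diag(m) Z^n, it factors through [ev] as a map [psi]. It is
    multiplicative because [chi] is a character, and onto because [phi] maps components onto
    components. *)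
Lemma isograded_related : exists P (psi : alg_iso A A'),
  [/\ P \in unitmx, admissible m' m P & related_by sg sg' P psi].
Proof.
have [uN [P uP PN]] := necessary_lattice.
have [chi [G [chi0 chiD GE Ginv]]] := invariant_specialization.
have [psi psi_def] : exists psi : {linear A -> A'},
    forall u, psi u = G (msec zeta m_gt0 per u) by exists (G \o msec zeta m_gt0 per).
have psiE l f : gM l f -> psi (ev f) = G f.
  move=> gf; rewrite psi_def /msec linear_sum.
  rewrite (bigD1_seq (rmod m l)) ?box_uniq ?rmod_box //= big_seq_cond big1 => [|b /andP[bb bl]].
    by rewrite addr0 (Ginv l) // rmod_cong.
  rewrite (mlift_ev_neq char0 per gf) ?linear0 //.
  by apply: contraNN bl; rewrite cong_rmod (rmod_id bb) eq_sym.
have psiM : {morph psi : x y / x ** y}.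
  move=> x y; elim/(alg_ind char0 (zeta := zeta) (m_gt0 := m_gt0) per): x => [|x x' hx hx'|l f gf].
  - by rewrite !(namul0l, linear0).
  - by rewrite !(namulDl, linearD) hx hx'.
  elim/(alg_ind char0 (zeta := zeta) (m_gt0 := m_gt0) per): y => [|y y' hy hy'|l' h gh].
  - by rewrite !(namul0r, linear0).
  - by rewrite !(namulDr, linearD) hy hy'.
  have gfh := gcomp_mul gf gh.
  rewrite -ev_mul (psiE _ _ gfh) (psiE _ _ gf) (psiE _ _ gh).
  rewrite (GE _ _ gfh) (GE _ _ gf) (GE _ _ gh) iso_mul ev_mul namulZl namulZr scalerA.
  by rewrite chiD invfM.
have psi_surj y : exists x, psi x = y.
  elim/(alg_ind char0 (zeta := zeta) (m_gt0 := m'_gt0) per'): y => [|y y' [x <-] [x' <-]|l' f' gf'].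
  - by exists 0; rewrite linear0.
  - by exists (x + x'); rewrite linearD.
  have [nui nuK nuiK] := giso.1; rewrite -(nuiK l') -giso.2 in gf'.
  have [f gf <-] := gf'; exists (chi (nui l') *: ev f).
  by rewrite linearZ_LR (psiE _ _ gf) (GE _ _ gf) scalerA mulfV // scale1r.
(* The kernel is an ideal of the simple algebra [A], and it is proper because [A'] has a nonzero
   product. *)
have psi_inj : injective psi.
  have idK : ideal [set x | psi x = 0].
    split=> [|x y x0]; last by rewrite /= !psiM (x0 : psi x = 0) namul0l namul0r.
    split=> [|a x y]; rewrite !inE /=; first by rewrite linear0.
    by move=> hx hy; rewrite linearP hx hy scaler0 addr0.
  have [K0|KT] := csA.2.2 _ idK.
    move=> x y xy; apply/eqP; rewrite -subr_eq0; apply/eqP.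
    have : [set x | psi x = 0] (x - y) by rewrite /= linearB xy subrr.
    by rewrite K0.
  have [[x [y xy]] _] := csA'.2; exfalso; apply: xy.
  have [x' <-] := psi_surj x.
  by have -> : psi x' = 0 by [have : [set x | psi x = 0] x' by [rewrite KT]]; rewrite namul0l.
have [psi' psi'E] := alg_iso_build psiM psi_inj psi_surj.
exists P, psi'; split=> //; first by apply/(admissibleP m' P m_gt0); exists N.
apply: (eigen_related char0 m_gt0 m'_gt0 per PN) => l v hv; rewrite psi'E.
have gv := mlift_in zeta m_gt0 per l v.
have vE : v = ev (mlift l v) by rewrite ev_mlift (eigenproj_id char0 m_gt0 hv).
rewrite vE (psiE _ _ gv) (GE _ _ gv) -nuE.
have hev : ev (phi (mlift l v)) \in eigencomp zeta m' sg' (nu l).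
  by apply: ev_in; apply: (graded_iso_in giso).
have [e0 eP] := eigencomp_submod zeta m' sg' (nu l).
by rewrite -[X in X \in _]addr0; apply: eP.
Qed.

End Necessity.

Theorem theorem8p3p2 (k : closedFieldType) (char0 : [pchar k] =i pred0)
    (zeta : compatible_roots k) :
  (* (i) *)
  (forall (n : nat) (L : zmodType) (B : naAlgType k) (gB : grading L B),
    (0 < n)%N -> free_abelian_of_rank L n ->
    (graded_central_simple gB /\ finite_index (centroid_support gB)) <->
    (exists (A : naAlgType k) (m : 'I_n -> nat) (m_gt0 : forall i, (0 < m i)%N)
        (sg : 'I_n -> alg_iso A A),
      [/\ central_simple A, commuting_periods m sg &
          isograded_isomorphic gB (multiloop_grading zeta m_gt0 sg)]))
  /\
  (* (ii) *)
  (forall (n : nat) (A A' : naAlgType k) (m m' : 'I_n -> nat)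
      (m_gt0 : forall i, (0 < m i)%N) (m'_gt0 : forall i, (0 < m' i)%N)
      (sg : 'I_n -> alg_iso A A) (sg' : 'I_n -> alg_iso A' A'),
    let gB := multiloop_grading zeta m_gt0 sg in
    let gB' := multiloop_grading zeta m'_gt0 sg' in
    central_simple A -> central_simple A' ->
    commuting_periods m sg -> commuting_periods m' sg' ->
    (isograded_isomorphic gB gB' <->
      exists (P : 'M[int]_n) (phi : alg_iso A A'),
        [/\ P \in unitmx, admissible m' m P & related_by sg sg' P phi])
    /\
    (gen_subgroup (gsupport gB) = setT -> gen_subgroup (gsupport gB') = setT ->
      (isograded_isomorphic gB gB' <->
        exists (P : 'M[int]_n) (phi : alg_iso A A'),
          P \in unitmx /\ related_by sg sg' P phi)))
  /\
  (* (iii) *)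
  (forall (n : nat) (L : zmodType) (B : naAlgType k) (gB : grading L B)
      (A : naAlgType k) (m : 'I_n -> nat) (m_gt0 : forall i, (0 < m i)%N)
      (sg : 'I_n -> alg_iso A A),
    (0 < n)%N -> free_abelian_of_rank L n ->
    graded_central_simple gB -> finite_index (centroid_support gB) ->
    central_simple A -> commuting_periods m sg ->
    isograded_isomorphic gB (multiloop_grading zeta m_gt0 sg) ->
    finite_dimensional A <-> fgc B).
Proof.
split; last split.
- move=> n L B gB _ freeL; split=> [[gcs fi]|[A [m [m_gt0 [sg [csA per iso]]]]]].
    exact: multiloop_realization.
  exact: isograded_multiloop_graded_central_simple csA per iso.
- move=> n A A' m m' m_gt0 m'_gt0 sg sg' gB gB' csA csA' per per'.
  have nec : isograded_isomorphic gB gB' -> exists (P : 'M[int]_n) (phi : alg_iso A A'),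
      [/\ P \in unitmx, admissible m' m P & related_by sg sg' P phi].
    by move=> [phi [nu giso]]; apply: isograded_related giso.
  split.
    split=> // -[P [phi [uP /(admissibleP _ _ m_gt0)[N uN PN] rel]]].
    exact: related_isograded uP uN PN rel.
  move=> gen gen'; split=> [/nec[P [phi [uP _ rel]]]|[P [phi [uP rel]]]].
    by exists P, phi.
  have [N uN PN] := generating_lattice char0 per per' gen gen' uP rel.
  exact: related_isograded uP uN PN rel.
- move=> n L B gB A m m_gt0 sg _ _ _ _ csA per iso.
  exact: isograded_multiloop_fgc csA per iso.
Qed.
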